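(* Let $g:\mathbb{R}\to\mathbb{R}$ be a differentiable function such that: (i) $g$ is nondecreasing and $g(0)=0$; (ii) $yg(y)>0$ for all $y\neq 0$; (iii) there is a constant $c_2>0$ with $|g(x+y)|\le c_2(|g(x)|+|g(y)|+1)$ for all $x,y\in\mathbb{R}$; (iv) there is a constant $c_3\ge 1$ with $|g'(y)|\le c_3\frac{1+|g(y)|}{1+|y|}$ for all $y\in\mathbb{R}$. Let $(W,W')$ be an exchangeable pair of real random variables, $\Delta=W-W'$, and suppose that $|\Delta|\le\delta$ for some constant $\delta>0$ and that $$\mathrm{E}(\Delta\mid W)=\lambda\bigl(g(W)-R(W)\bigr)$$ for some $0<\lambda<1$ and some random variable $R(W)$ (a function of $W$). Put $\hat K_1=\frac{1}{2\lambda}\Delta^2$. Assume that there exist $\tau_1>0$, $\tau_2>0$, $\delta_1>0$, $\delta_2\ge 0$ such that $$|\mathrm{E}(\hat K_1\mid W)-1|\le\delta_1(|g(W)|^{\tau_1}+1),\qquad |R(W)|\le\delta_2(|g(W)|^{\tau_2}+1),$$ and constants $d_0\ge 1$, $d_1>0$, $0\le\alpha<1$ such that $$\mathrm{E}(\hat K_1\mid W)\le d_0,\qquad \delta|g(W)|\le d_1,\qquad |R(W)|\le\alpha(|g(W)|+1).$$ Let $Y$ be a random variable with density $p(y)=c_1e^{-G(y)}$, $y\in\mathbb{R}$. Then $$\frac{\mathrm{P}(W>z)}{\mathrm{P}(Y>z)}=1+O(1)\Bigl(\delta\bigl(1+zg^2(z)\bigr)+\delta_1\bigl(1+zg^{\tau_1+1}(z)\bigr)+\delta_2\bigl(1+zg^{\tau_2}(z)\bigr)\Bigr)$$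 for all $z\ge 0$ satisfying $\delta zg^2(z)+\delta_1zg^{\tau_1+1}(z)+\delta_2zg^{\tau_2}(z)\le 1$, where $O(1)$ denotes a quantity bounded in absolute value by a finite constant depending only on $d_0,d_1,c_1,c_2,c_3,\tau_1,\tau_2,\alpha$ and $\max(g(1),|g(-1)|)$.
   Context: $(W,W')$ is exchangeable if $(W,W')$ and $(W',W)$ have the same joint distribution. $G(y)=\int_0^yg(t)\,dt$, and $c_1$ is the normalizing constant making $p(y)=c_1e^{-G(y)}$ a probability density on $\mathbb{R}$. $g^{\tau}(z)$ means $(g(z))^{\tau}$. Inequalities between random variables are understood almost surely. *)

(* Defs.v *)
From HB Require Import structures.
From mathcomp Require Import all_boot all_order all_algebra.
From mathcomp Require Import all_classical all_reals all_analysis.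
Set Implicit Arguments.
Unset Strict Implicit.
Unset Printing Implicit Defensive.
Import Order.TTheory GRing.Theory Num.Theory.
Import numFieldNormedType.Exports.
Local Open Scope classical_set_scope.
Local Open Scope ring_scope.

(* G(y) = \int_0^y g(t) dt, an oriented integral: for y < 0 it is minus the
   integral of g over [y, 0]. *)
Definition oriented_primitive (R : realType) (g : R -> R) (y : R) : R :=
  if 0 <= y then \int[@lebesgue_measure R]_(t in `[0, y]) g t
  else - \int[@lebesgue_measure R]_(t in `[y, 0]) g t.

Definition is_pdf (R : realType) (p : R -> R) : Prop :=
  [/\ measurable_fun setT p, (forall y, 0 <= p y) &
      (\int[@lebesgue_measure R]_y (p y)%:E = 1)%E].

Definition has_density (R : realType) (d : measure_display)
    (T : measurableType d) (P : probability T R) (Y : {RV P >-> R})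
    (p : R -> R) : Prop :=
  forall B : set R, measurable B ->
    distribution P Y B = (\int[@lebesgue_measure R]_(y in B) (p y)%:E)%E.

Definition exchangeable (R : realType) (d : measure_display)
    (T : measurableType d) (P : probability T R) (W W' : {RV P >-> R}) : Prop :=
  forall B : set (R * R), measurable B ->
    P ((fun w => (W w, W' w)) @^-1` B) = P ((fun w => (W' w, W w)) @^-1` B).

(* Z is a version of E(X | W): Z is sigma(W)-measurable and integrable, and has
   the same integral as X over every event of sigma(W). Versions are unique
   only up to P-null sets. *)
Definition is_cond_exp (R : realType) (d : measure_display)
    (T : measurableType d) (P : probability T R)
    (X : T -> R) (W : {RV P >-> R}) (Z : T -> R) : Prop :=
  [/\ P.-integrable setT (EFin \o X),
      (forall B : set R, measurable B ->
         g_sigma_algebra_preimage W (Z @^-1` B)),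
      P.-integrable setT (EFin \o Z) &
      forall A : set T, g_sigma_algebra_preimage W A ->
        (\int[P]_(w in A) (Z w)%:E = \int[P]_(w in A) (X w)%:E)%E].

(* Main.v *)
Require Import Defs.
From HB Require Import structures.
From mathcomp Require Import all_boot all_order all_algebra.
From mathcomp Require Import all_classical all_reals all_analysis.
From mathcomp Require Import measurable_realfun ring lra.
Set Implicit Arguments.
Unset Strict Implicit.
Unset Printing Implicit Defensive.
Import Order.TTheory GRing.Theory Num.Theory.
Import numFieldNormedType.Exports.
Local Open Scope classical_set_scope.
Local Open Scope ring_scope.

(** Write [F] for the distribution function of [Y], [Q z = 1 - F z] and
    [r] for the remainder. The theorem is an instance of Stein's method: if
    [f] solves [f' - g f = 1_(w <= z) - F z], then
    [P(W <= z) - F z] is the expectation of [f'(W) - g(W) f(W)], and this is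
    small because the pair [(W, W')] nearly satisfies [E f'(W) = E g(W) f(W)].
    The difficulty is to have an error that is small relative to [Q z].

    One inequality carries all the probability. By exchangeability and the
    regression property,
    [2 lambda E ((g - r) f)(W) = E ((W - W') (f W - f W'))]. So if
    [(w - w') (f w - f w') <= (w - w')^2 (h w + rho w)] for nearby [w], [w'],
    with [rho >= 0], then, by conditioning [(W - W')^2 / (2 lambda)] on [W],
    [[
      E ((g - r) f) <= E h + 2 delta1 E ((1 + |g|)^tau1 |h|) + d0 E rho
    ]]
    at [W]; one should think of [h] as [f'] and of [rho] as the variation of
    [f'] at distance [delta]. The record [stein_law] axiomatizes an expectation
    functional with this property, [law_of_pair] establishes it for the given
    pair, and everything else follows by choosing [f].

    - Odd powers of [g] bound the moments of [g(W)] ([moment_bound]).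
    - [f = exp (G w - th w)] on [[0, z]] yields the key estimate
      ([tilted_balance], [key_bounds]): [E (exp (G (W^+)); W <= z)] is
      [O(1 + z)] and [E (1 + |g(W)|; W > z)] is [O(exp (- G z))]. For [th = 0]
      the terms [E (g f)] and [E f'] cancel exactly and only errors of size
      [rate z * E f] remain, where [(1 + z) rate z] is bounded by assumption.
      With [th = K / (1 + z)] and [K] large the gain [th E f] absorbs
      these errors, while [exp (th z) <= exp K] is harmless.
    - Powers of [1 + g (max (w, z))] bound the higher moments of [g(W)] beyond
      [z], by induction on the exponent ([tail_moment]).
    - The solution of the Stein equation, with both signs, then gives
      [|P(W > z) - Q z| <= C Q z (1 + z) rate z] ([stein_comparison],
      [tail_comparison]). The solution is at most of order
      [Q z * exp (G w)] for [0 <= w <= z] and [1 / (1 + g z)] for [w > z]; the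
      estimates above match these weights, and
      [Q z >= c exp (- G z) / (1 + g z)] ([tail_lower]) turns the part beyond
      [z] into a multiple of [Q z].

    The second and the last test functions have a corner at [z], and a pair
    [w], [w'] on both sides of it sees the slope of the wrong side. A
    multiple of a ramp that increases by [2 delta] across [z] is subtracted
    from them. Its increments have the sign of [w - w'], so that it compensates
    the corner in the inequality above, and its cost is a multiple of [delta]
    times a mass beyond [z - delta].

    Since [c1 exp (- G)] has mass 1, [exp (G x) >= c1 x], whence [g] is
    bounded below by a constant beyond a point that depends on [c1] only. This
    makes [(1 + z) rate z] comparable to the error term of the theorem
    ([weight_convert]). If one of [delta], [delta1], [delta2] exceeds 1, the
    restriction on [z] confines it to a bounded interval, on which the ratio
    of the tails is bounded.

    Uniformity is expressed by the order of the quantifiers: each estimate has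
    the form [exists C, forall g ...], where [C] is chosen from the
    constants [c1], [c3], [A], [d0], [alpha], [tau1], [tau2], [K0]. Here [A]
    bounds the growth of [1 + |g|] under unit shifts and [K0] bounds
    [(1 + z) rate z]. *)

(** * The density and its Mills ratios *)

(** The mean value theorem without an order on the endpoints, since a pair
    [w], [w'] comes in either order. *)
Lemma mvt_between (R : realType) (f df : R -> R) (a b : R) :
  (forall x : R, is_derive x 1 f (df x)) ->
  exists2 c, (Num.min a b <= c <= Num.max a b) & f a - f b = df c * (a - b).
Proof.
move=> fd.
have cf x : {for x, continuous f}.
  by apply: differentiable_continuous; apply/derivable1_diffP; case: (fd x).
wlog ab : a b / a <= b => [wl|].
  have [ab|ba] := orP (le_total a b); first exact: wl.
  have [c cab E] := wl b a ba; exists c; first by rewrite minC maxC.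
  by rewrite -opprB E -mulrN opprB.
have cab : {within `[a, b], continuous f} by apply: continuous_subspaceT => x; exact: cf.
have [c] := @MVT_segment R f df a b ab (fun x _ => fd x) cab.
rewrite in_itv/= => {}cab E; exists c; first by rewrite (min_idPl ab) (max_idPr ab).
by rewrite -opprB E -mulrN opprB.
Qed.

Section Between.
Variables (R : realType) (a b c : R).
Hypothesis cab : Num.min a b <= c <= Num.max a b.

Lemma between_ge (l : R) : l <= a -> l <= b -> l <= c.
Proof. by move=> la lb; case/andP: cab => + _; apply: le_trans; rewrite le_min la. Qed.

Lemma between_le (u : R) : a <= u -> b <= u -> c <= u.
Proof. by move=> au bu; case/andP: cab => _ /le_trans; apply; rewrite ge_max au. Qed.

Lemma between_dist : `|c - a| <= `|a - b|.
Proof.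
have h1 := ler_norm (a - b); have h2 := ler_norm (b - a); rewrite distrC in h2.
rewrite ler_norml; apply/andP; split.
  by rewrite lerBrDr; apply: between_ge; lra.
by rewrite lerBlDr; apply: between_le; lra.
Qed.

End Between.

Lemma max_dist (R : realType) (a b z : R) :
  `|Num.max a z - Num.max b z| <= `|a - b|.
Proof.
have := ler_norm (a - b); have := ler_norm (b - a); rewrite distrC => n1 n2.
by have [h1|h1] := leP a z; have [h2|h2] := leP b z; rewrite ler_norml; lra.
Qed.

Section Clip.
Variable R : realType.
Implicit Types a b w : R.

(** The projection onto [[a, b]]. It truncates test functions, and
    [clip (z - d) (z + d)] is the ramp across a corner at [z]. *)
Definition clip a b w := Num.min (Num.max w a) b.

Lemma clip_in a b w : a <= b -> a <= clip a b w <= b.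
Proof.
by move=> ab; rewrite /clip le_min le_max ge_min !lexx ab !orbT.
Qed.

Lemma clip_id a b w : a <= w <= b -> clip a b w = w.
Proof. by case/andP=> aw wb; rewrite /clip (max_idPl aw) (min_idPl wb). Qed.

Lemma clip_left a b w : a <= b -> w <= a -> clip a b w = a.
Proof. by move=> ab wa; rewrite /clip (max_idPr wa) (min_idPl ab). Qed.

Lemma clip_right a b w : a <= b -> b <= w -> clip a b w = b.
Proof.
by move=> ab bw; rewrite /clip (max_idPl (le_trans ab bw)) (min_idPr bw).
Qed.

Lemma clip_mono a b : {homo clip a b : x y / x <= y}.
Proof.
move=> x y xy; rewrite /clip le_min ge_min; apply/andP; split.
  by apply/orP; left; rewrite ge_max !le_max xy lexx orbT.
by rewrite ge_min lexx orbT.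
Qed.

Lemma clip_lip a b w w' : a <= b -> w' <= w -> clip a b w - clip a b w' <= w - w'.
Proof.
move=> ab ww; have [h1|h1] := leP w a.
  by rewrite !clip_left ?subrr ?subr_ge0// (le_trans ww).
have [h2|h2] := leP b w'.
  by rewrite !clip_right ?subrr ?subr_ge0// (le_trans h2).
rewrite lerB//.
  by rewrite /clip ge_min (max_idPl (ltW h1)) lexx.
by rewrite /clip le_min le_max lexx (ltW h2).
Qed.

Lemma clip_dist a b w w' : a <= b -> `|clip a b w - clip a b w'| <= `|w - w'|.
Proof.
move=> ab; wlog ww : w w' / w' <= w => [wl|].
  have [h|h] := orP (le_total w' w); first exact: wl.
  by rewrite distrC (distrC w); exact: wl.
by rewrite !ger0_norm ?subr_ge0 ?clip_lip ?clip_mono.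
Qed.

(** Because of the left inequality, subtracting a multiple of [clip] from a
    test function preserves upper bounds on [(w - w') (f w - f w')]; that is
    how ramps compensate corners. *)
Lemma clip_sign a b w w' : a <= b ->
  0 <= (w - w') * (clip a b w - clip a b w') <= (w - w') ^+ 2.
Proof.
move=> ab; wlog ww : w w' / w' <= w => [wl|].
  have [h|h] := orP (le_total w' w); first exact: wl.
  by rewrite -mulrNN -(sqrrN (w - w')) !opprB; exact: wl.
by rewrite mulr_ge0 ?subr_ge0 ?clip_mono// expr2 ler_wpM2l ?subr_ge0 ?clip_lip.
Qed.

Lemma clip_measurable a b : measurable_fun setT (clip a b).
Proof. by apply: measurable_minr => //; apply: measurable_maxr. Qed.

End Clip.

(** A function [g] with its derivative [dg], its primitive [G] and the
    distribution function [F] of the density [c1 exp (- G)], reduced to the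
    properties that the estimates use. [A] replaces the constants [c2] and
    [max (g 1, |g (-1)|)]. *)
Record stein_target (R : realType) (c1 c3 A : R) (g dg G F : R -> R) : Prop := {
  tg_c1 : 0 < c1 ;
  tg_c3 : 0 <= c3 ;
  tg_A : 1 <= A ;
  tg_der : forall x : R, is_derive x 1 g (dg x) ;
  tg_dg : forall x, `|dg x| <= c3 * (1 + `|g x|) ;
  tg_mono : {homo g : x y / x <= y} ;
  tg_0 : g 0 = 0 ;
  tg_shift : forall x t : R, `|t| <= 1 -> 1 + `|g (x + t)| <= A * (1 + `|g x|) ;
  tG_der : forall x : R, is_derive x 1 G (g x) ;
  tG_0 : G 0 = 0 ;
  tF_der : forall x : R, is_derive x 1 F (c1 * expR (- G x)) ;
  tF_ge0 : forall x, 0 <= F x ;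
  tF_le1 : forall x, F x <= 1 ;
  tF_top : forall e : R, 0 < e -> exists2 x : R, 0 <= x & 1 - F x < e ;
  tF_bot : forall e : R, 0 < e -> exists2 x : R, x <= 0 & F x < e }.

Section Target.
Variables (R : realType) (c1 c3 A : R).
Variables (g dg G F : R -> R).
Hypothesis Tg : stein_target c1 c3 A g dg G F.
Let c1_gt0 := tg_c1 Tg.
Let c3_ge0 := tg_c3 Tg.
Let A_ge1 := tg_A Tg.

Lemma g_ge0 x : 0 <= x -> 0 <= g x.
Proof. by move=> x0; rewrite -(tg_0 Tg); apply: (tg_mono Tg). Qed.

Lemma g_le0 x : x <= 0 -> g x <= 0.
Proof. by move=> x0; rewrite -(tg_0 Tg); apply: (tg_mono Tg). Qed.

(** [g] is nondecreasing, so its primitive is convex and stays above its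
    tangents. *)
Lemma G_convex (x y : R) : G y - G x <= g y * (y - x).
Proof.
have [c /andP[c1' c2'] ->] := mvt_between y x (tG_der Tg).
have [xy|/ltW yx] := leP x y.
  rewrite (max_idPl xy) in c2'.
  by apply: ler_wpM2r; [rewrite subr_ge0|exact: (tg_mono Tg)].
rewrite (min_idPl yx) in c1'.
by rewrite -subr_ge0 -mulrBl mulr_le0 ?subr_le0 //; exact: (tg_mono Tg).
Qed.

Lemma G_ge0 x : 0 <= G x.
Proof. by have := G_convex x 0; rewrite (tG_0 Tg) (tg_0 Tg) mul0r sub0r oppr_le0. Qed.

Lemma G_mono (x y : R) : 0 <= x -> x <= y -> G x <= G y.
Proof.
move=> x0 xy; rewrite -subr_le0; apply: le_trans (G_convex _ _) _.
by apply: mulr_ge0_le0; [exact: g_ge0|rewrite subr_le0].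
Qed.

Lemma F_mono (x y : R) : x <= y -> F x <= F y.
Proof.
move=> xy; rewrite -subr_ge0.
have [c _ ->] := mvt_between y x (tF_der Tg).
by rewrite mulr_ge0 ?subr_ge0// mulr_ge0 ?expR_ge0// ltW.
Qed.

(** The density is nonincreasing on the positive half-line. *)
Lemma F_increment (x h : R) : 0 <= x -> 0 <= h ->
  h * (c1 * expR (- G (x + h))) <= F (x + h) - F x.
Proof.
move=> x0 h0; have [c cxy ->] := mvt_between (x + h) x (tF_der Tg).
have xh : x <= x + h by rewrite lerDl.
rewrite (min_idPr xh) (max_idPl xh) in cxy; case/andP: cxy => xc ch.
rewrite addrAC subrr add0r mulrC ler_wpM2r// ler_wpM2l ?(ltW c1_gt0)//.
by rewrite ler_expR lerN2 G_mono// (le_trans x0).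
Qed.

(** The interval [[0, x]] has mass at most 1, and the density is at least
    [c1 exp (- G x)] on it. *)
Lemma expG_growth (x : R) : 0 <= x -> c1 * x <= expR (G x).
Proof.
move=> x0; have := F_increment (lexx 0) x0; rewrite add0r => Fi.
have F1 : F x - F 0 <= 1 by have := tF_le1 Tg x; have := tF_ge0 Tg 0; lra.
have := le_trans Fi F1; rewrite expRN mulrA (mulrC x).
by rewrite -[_ / _ <= _]/(_ / expR (G x) <= 1) ler_pdivrMr ?expR_gt0// mul1r.
Qed.

(** By [expG_growth], [G >= 1] at this point, which depends on [c1] only. *)
Definition growth_point := expR 1 / c1.

Lemma growth_point_gt0 : 0 < growth_point.
Proof. by rewrite divr_gt0 ?expR_gt0. Qed.

(** At the growth point [X], convexity gives [1 <= G X <= X * g X]. *)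
Lemma g_lower (x : R) : growth_point <= x -> growth_point^-1 <= g x.
Proof.
move=> Xx; apply: le_trans (tg_mono Tg Xx).
have X0 := growth_point_gt0.
have := expG_growth (ltW X0).
rewrite [c1 * _]mulrC divfK ?gt_eqF// ler_expR => G1.
have := G_convex 0 growth_point; rewrite (tG_0 Tg) !subr0 => Gc.
by rewrite -div1r ler_pdivrMr// (le_trans G1).
Qed.

(** [x] is reached from 0 by [n] shifts of length at most 1. *)
Lemma shift_bound n (x : R) : 0 <= x -> x <= n%:R -> 1 + g x <= A ^+ n.
Proof.
elim: n x => [x x0 xn|n IH x x0 xn].
  have -> : x = 0 by apply/eqP; rewrite eq_le x0 xn.
  by rewrite (tg_0 Tg) addr0 expr0.
have An : 1 <= A ^+ n by rewrite exprn_ege1.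
have [x1|x1] := leP x 1.
  have := tg_shift Tg 0 (t := x); rewrite ger0_norm// add0r (tg_0 Tg) normr0 addr0 mulr1.
  move=> /(_ x1); rewrite ger0_norm ?g_ge0// => /le_trans; apply.
  by rewrite exprS ler_peMr//; have := A_ge1; lra.
have x1' : 0 <= x - 1 by lra.
have := tg_shift Tg (x - 1) (t := 1); rewrite normr1 subrK lexx => /(_ isT).
rewrite !ger0_norm ?g_ge0// => /le_trans; apply.
rewrite exprS ler_wpM2l ?(le_trans ler01)// IH//.
by move: xn; rewrite -natr1; lra.
Qed.

(** The function [c1 exp (- G) + g w * F] is nonincreasing to the
    right of [w], because [g >= g w] there; compare its values at [w] and far
    to the right. *)
Lemma mills_right (w : R) : 0 <= w -> g w * (1 - F w) <= c1 * expR (- G w).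
Proof.
move=> w0; have gw := g_ge0 w0; apply/ler_addgt0Pr => /= e e0.
(* The tail beyond [b] costs at most [e], so the limit is avoided. *)
have [b b0 Fb] : exists2 b, w <= b & g w * (1 - F b) <= e.
  have [|b b0 Fb] := tF_top Tg (e := e / (1 + g w)); first by rewrite divr_gt0//; lra.
  exists (Num.max b w); first by rewrite le_max lexx orbT.
  have Fm : F b <= F (Num.max b w) by apply: F_mono; rewrite le_max lexx.
  apply: (@le_trans _ _ (g w * (e / (1 + g w)))); first by rewrite ler_wpM2l//; lra.
  by rewrite mulrCA ler_piMr ?(ltW e0)// ler_pdivrMr; lra.
suff : g w * (F b - F w) <= c1 * expR (- G w) by lra.
pose H (x : R) := c1 * expR (- G x) + g w * F x.
have dH (x : R) : is_derive x 1 H (c1 * (expR (- G x) * - g x) + g w * (c1 * expR (- G x))).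
  have dG := tG_der Tg x; have dF := tF_der Tg x.
  rewrite /H; apply: is_deriveD.
have [c /andP[cw cb] HH] := mvt_between b w dH.
rewrite (min_idPr b0) in cw.
have : H b - H w <= 0.
  rewrite HH mulr_le0_ge0 ?subr_ge0//.
  have := tg_mono Tg cw; have := mulr_gt0 c1_gt0 (expR_gt0 (- G c)); nra.
rewrite /H; have := mulr_gt0 c1_gt0 (expR_gt0 (- G b)); lra.
Qed.

(** The mirror image of [mills_right]. *)
Lemma mills_left (w : R) : w <= 0 -> - g w * F w <= c1 * expR (- G w).
Proof.
move=> w0; have gw : 0 <= - g w by rewrite oppr_ge0 g_le0.
apply/ler_addgt0Pr => /= e e0.
have [b b0 Fb] : exists2 b, b <= w & - g w * F b <= e.
  have [|b b0 Fb] := tF_bot Tg (e := e / (1 - g w)); first by rewrite divr_gt0//; lra.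
  exists (Num.min b w); first by rewrite ge_min lexx orbT.
  have Fm : F (Num.min b w) <= F b by apply: F_mono; rewrite ge_min lexx.
  apply: (@le_trans _ _ (- g w * (e / (1 - g w)))); first by rewrite ler_wpM2l//; lra.
  by rewrite mulrCA ler_piMr ?(ltW e0)// ler_pdivrMr; lra.
suff : - g w * (F w - F b) <= c1 * expR (- G w) by lra.
pose H (x : R) := c1 * expR (- G x) + g w * F x.
have dH (x : R) : is_derive x 1 H (c1 * (expR (- G x) * - g x) + g w * (c1 * expR (- G x))).
  have dG := tG_der Tg x; have dF := tF_der Tg x.
  rewrite /H; apply: is_deriveD.
have [c /andP[cw cb] HH] := mvt_between w b dH.
rewrite (max_idPl b0) in cb.
have : 0 <= H w - H b.
  rewrite HH mulr_ge0 ?subr_ge0//.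
  have := tg_mono Tg cb; have := mulr_gt0 c1_gt0 (expR_gt0 (- G c)); nra.
rewrite /H; have := mulr_gt0 c1_gt0 (expR_gt0 (- G b)); lra.
Qed.

(** The solutions of [u' = 1 + g u] and [v' = - 1 + g v] that stay bounded at
    minus infinity and at plus infinity respectively. The solution of the
    Stein equation is made of multiples of them, joined at [z]. *)
Definition mills_cdf (x : R) := F x * expR (G x) / c1.
Definition mills_tail (x : R) := (1 - F x) * expR (G x) / c1.
Local Notation u := mills_cdf.
Local Notation v := mills_tail.

Lemma mills_cdf_der (x : R) : is_derive x 1 u (1 + g x * u x).
Proof.
have dG := tG_der Tg x; have dF := tF_der Tg x.
rewrite /u; apply: is_derive_eq.
rewrite /GRing.scale/= expRN; have := expR_gt0 (G x) => e0.
field; rewrite (gt_eqF c1_gt0) (gt_eqF e0)//.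
Qed.

Lemma mills_tail_der (x : R) : is_derive x 1 v (-1 + g x * v x).
Proof.
have dG := tG_der Tg x; have dF := tF_der Tg x.
rewrite /v; apply: is_derive_eq.
rewrite /GRing.scale/= expRN; have := expR_gt0 (G x) => e0.
field; rewrite (gt_eqF c1_gt0) (gt_eqF e0)//.
Qed.

Lemma mills_cdf_ge0 (x : R) : 0 <= u x.
Proof. by rewrite /u divr_ge0 ?(ltW c1_gt0)// mulr_ge0 ?expR_ge0// (tF_ge0 Tg). Qed.

Lemma mills_tail_ge0 (x : R) : 0 <= v x.
Proof.
by rewrite /v divr_ge0 ?(ltW c1_gt0)// mulr_ge0 ?expR_ge0// subr_ge0 (tF_le1 Tg).
Qed.

Lemma mills_cdf_slope (x : R) : x <= 0 -> - g x * u x <= 1.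
Proof.
move=> x0; rewrite /u !mulrA ler_pdivrMr// mul1r.
by rewrite -ler_pdivlMr ?expR_gt0// -expRN mills_left.
Qed.

Lemma mills_tail_slope (x : R) : 0 <= x -> g x * v x <= 1.
Proof.
move=> x0; rewrite /v !mulrA ler_pdivrMr// mul1r.
by rewrite -ler_pdivlMr ?expR_gt0// -expRN mills_right.
Qed.

(** [u] increases on the negative half-line, by [mills_cdf_slope]; on the
    positive one [F <= 1] suffices. *)
Lemma mills_cdf_le (x : R) : u x <= expR (G (Num.max x 0)) / c1.
Proof.
have [x0|x0] := leP x 0; last first.
  by rewrite /u ler_pM2r ?invr_gt0// ler_piMl ?expR_ge0// (tF_le1 Tg).
rewrite (tG_0 Tg) expR0; apply: (@le_trans _ _ (u 0)); last first.
  by rewrite /u (tG_0 Tg) expR0 mulr1 ler_pM2r ?invr_gt0// (tF_le1 Tg).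
have [c /andP[_ c0] E] := mvt_between 0 x mills_cdf_der.
rewrite (max_idPl x0) in c0.
rewrite -subr_ge0 E mulr_ge0 ?subr_ge0//.
have := mills_cdf_slope c0; lra.
Qed.

(** [v] decreases on the positive half-line, by [mills_tail_slope]. *)
Lemma mills_tail_le (x : R) : 0 <= x -> v x <= c1^-1.
Proof.
move=> x0; apply: (@le_trans _ _ (v 0)); last first.
  rewrite /v (tG_0 Tg) expR0 mulr1 ler_pdivrMr// mulVf ?gt_eqF//.
  have := tF_ge0 Tg 0; lra.
have [c /andP[c0 _] E] := mvt_between x 0 mills_tail_der.
rewrite (min_idPr x0) in c0.
rewrite -subr_le0 E mulr_le0_ge0 ?subr_ge0//.
have := mills_tail_slope c0; lra.
Qed.

Lemma g_mills_cdf_der (x : R) :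
  is_derive x 1 (fun y => g y * u y) (g x * (1 + g x * u x) + u x * dg x).
Proof. by have := tg_der Tg x; have := mills_cdf_der x => d1 d2; apply: is_deriveM. Qed.

Lemma g_mills_tail_der (x : R) :
  is_derive x 1 (fun y => g y * v y) (g x * (-1 + g x * v x) + v x * dg x).
Proof. by have := tg_der Tg x; have := mills_tail_der x => d1 d2; apply: is_deriveM. Qed.

(** The derivative of [g u] is, up to a constant factor, the second
    derivative of the left branch of the solution of the Stein equation. *)
Lemma g_mills_cdf_slope (x : R) :
  `|g x * (1 + g x * u x) + u x * dg x|
    <= (1 + (1 + c3) / c1) * ((1 + `|g x|) ^+ 2 * expR (G (Num.max x 0))).
Proof.
have ul := mills_cdf_le x; have u0 := mills_cdf_ge0 x.
have dgb := tg_dg Tg x; have g0 := normr_ge0 (g x).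
have e1 : 1 <= expR (G (Num.max x 0)) by rewrite -expR0 ler_expR G_ge0.
have c1' := c1_gt0; have c3' := c3_ge0.
set e := expR _ in ul e1 *.
have eE : e = e / c1 * c1 by rewrite divfK ?gt_eqF.
have ec0 : 0 <= e / c1 by rewrite divr_ge0 ?(ltW c1_gt0)//; lra.
apply: le_trans (ler_normD _ _) _; rewrite (normrM (g x)) (normrM (u x)).
rewrite (ger0_norm u0).
have h1 : `|1 + g x * u x| <= 1 + `|g x| * (e / c1).
  apply: le_trans (ler_normD _ _) _; rewrite normr1 normrM (ger0_norm u0).
  by rewrite lerD2l ler_wpM2l.
have h2 : u x * `|dg x| <= (e / c1) * (c3 * (1 + `|g x|)) by rewrite ler_pM.
have h3 : `|g x| * `|1 + g x * u x| <= `|g x| * (1 + `|g x| * (e / c1)) by rewrite ler_wpM2l.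
apply: le_trans (lerD h3 h2) _.
have -> : (1 + (1 + c3) / c1) * ((1 + `|g x|) ^+ 2 * e) =
   (1 + `|g x|) ^+ 2 * e + (1 + c3) * (1 + `|g x|) ^+ 2 * (e / c1).
  by field; rewrite gt_eqF.
set q := e / c1 in ec0 *; set a := `|g x| in g0 *.
have t1 : a <= (1 + a) ^+ 2 * e by nra.
have t2 : c3 * (1 + a) * q <= c3 * (1 + a) ^+ 2 * q by rewrite ler_wpM2r// ler_wpM2l//; nra.
have t3 : a * a * q <= (1 + a) ^+ 2 * q by rewrite ler_wpM2r//; nra.
have E : a * (1 + a * q) + q * (c3 * (1 + a)) = a + a * a * q + c3 * (1 + a) * q by ring.
rewrite E; have -> : (1 + c3) * (1 + a) ^+ 2 * q = (1 + a) ^+ 2 * q + c3 * (1 + a) ^+ 2 * q by ring.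
lra.
Qed.

(** The counterpart of [g_mills_cdf_slope] for the right branch; it carries no
    exponential because [v] and [g v] are bounded on the positive half-line. *)
Lemma g_mills_tail_slope (x : R) : 0 <= x ->
  `|g x * (-1 + g x * v x) + v x * dg x| <= (1 + c3 / c1) * (1 + `|g x|).
Proof.
move=> x0; have vl := mills_tail_le x0; have v0 := mills_tail_ge0 x.
have dgb := tg_dg Tg x; have g0 := g_ge0 x0.
have gv := mills_tail_slope x0; have gv0 : 0 <= g x * v x by rewrite mulr_ge0.
have c3' := c3_ge0.
apply: le_trans (ler_normD _ _) _; rewrite (normrM (g x)) (normrM (v x)).
rewrite (ger0_norm v0) (ger0_norm g0) in dgb *.
have h1 : `|-1 + g x * v x| <= 1 by rewrite ler_norml; lra.
have h2 : v x * `|dg x| <= c1^-1 * (c3 * (1 + g x)) by rewrite ler_pM.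
have h3 : g x * `|-1 + g x * v x| <= g x * 1 by rewrite ler_wpM2l.
apply: le_trans (lerD h3 h2) _.
have -> : (1 + c3 / c1) * (1 + g x) = 1 + g x + c1^-1 * (c3 * (1 + g x)) by ring.
lra.
Qed.

(** As [d * g z] will be bounded, a shift by [d] below [z] changes the weight
    [exp (G (max (x, 0)))] by a bounded factor only. *)
Lemma G_pos_shift (x y z d : R) : 0 <= z -> `|y - x| <= d -> y <= z ->
  G (Num.max y 0) <= G (Num.max x 0) + d * g z.
Proof.
move=> z0 yx yz; rewrite -lerBlDl.
have d0 : 0 <= d by rewrite (le_trans _ yx).
have gz := g_ge0 z0.
have y0 : 0 <= Num.max y 0 by rewrite le_max lexx orbT.
have yz' : Num.max y 0 <= z by rewrite ge_max yz.
apply: le_trans (G_convex _ _) _.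
have gy : g (Num.max y 0) <= g z by apply: (tg_mono Tg).
have gy0 := g_ge0 y0.
have dd : Num.max y 0 - Num.max x 0 <= d.
  rewrite lerBlDr ge_max; apply/andP; split.
    have : x <= Num.max x 0 by rewrite le_max lexx.
    by move: yx; rewrite ler_norml; lra.
  have : 0 <= Num.max x 0 by rewrite le_max lexx orbT.
  lra.
by rewrite mulrC; apply: (@le_trans _ _ (d * g (Num.max y 0))); rewrite ?ler_wpM2r ?ler_wpM2l.
Qed.

(** On the interval of length [1 / (1 + g z)] to the right of [z], the function
    [G] increases by at most [A]; this bounds the mass of the interval from
    below. *)
Lemma tail_lower (z : R) : 0 <= z ->
  c1 * expR (- A) * (expR (- G z) / (1 + g z)) <= 1 - F z.
Proof.
move=> z0; have gz := g_ge0 z0; pose h := (1 + g z)^-1.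
have h0 : 0 <= h by rewrite invr_ge0; lra.
have h1 : h <= 1 by rewrite invf_le1; lra.
have A0 := A_ge1.
have zh : 0 <= z + h by rewrite addr_ge0.
have Gh : G (z + h) <= G z + A.
  rewrite -lerBlDl; apply: le_trans (G_convex _ _) _.
  have := tg_shift Tg z (t := h); rewrite (ger0_norm h0) => /(_ h1).
  rewrite !ger0_norm ?g_ge0// => gs.
  have -> : z + h - z = h by ring.
  rewrite ler_pdivrMr; lra.
have := F_increment z0 h0; have := tF_le1 Tg (z + h) => F1 Fi.
apply: (@le_trans _ _ (h * (c1 * expR (- G (z + h))))); last by lra.
have -> : c1 * expR (- A) * (expR (- G z) / (1 + g z)) =
    h * (c1 * (expR (- A) * expR (- G z))) by rewrite /h; ring.
rewrite ler_wpM2l// ler_wpM2l ?(ltW c1_gt0)// -expRD ler_expR; lra.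
Qed.

Lemma measurable_of_derivative (f df : R -> R) : (forall x : R, is_derive x 1 f (df x)) ->
  measurable_fun setT f.
Proof.
move=> fd; apply: continuous_measurable_fun => x.
by apply: differentiable_continuous; apply/derivable1_diffP; case: (fd x).
Qed.

(** The test function of the key estimate. The factor [exp (- th x)] makes its
    slope [(g - th) * tilt], which leaves a gain [th * tilt] over the exact
    cancellation that holds for [exp G]. *)
Definition tilt (th x : R) := expR (G x - th * x).
Definition dtilt (th x : R) := (g x - th) * tilt th x.

Lemma tilt_der th (x : R) : is_derive x 1 (tilt th) (dtilt th x).
Proof.
have dG := tG_der Tg x; rewrite /dtilt /tilt; apply: is_derive_eq.
by rewrite /GRing.scale/=; ring.
Qed.

Lemma dtilt_der th (x : R) :
  is_derive x 1 (dtilt th) ((dg x + (g x - th) ^+ 2) * tilt th x).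
Proof.
have dG := tG_der Tg x; have dg' := tg_der Tg x; have dt := tilt_der th x.
rewrite /dtilt; apply: is_derive_eq.
by rewrite /GRing.scale/= /dtilt; ring.
Qed.

End Target.

(** * The exchangeable pair as an abstract functional *)

(** Test functions are only evaluated at [W], and [W] lies almost surely in a
    set [S] on which [g] is bounded, so boundedness is required on [S] only. *)
Definition bdd_on (R : realType) (S : set R) (f : R -> R) : Prop :=
  measurable_fun setT f /\ exists M, forall w, S w -> `|f w| <= M.

Section Bdd.
Variables (R : realType) (S : set R).
Implicit Types f h : R -> R.

Lemma bdd_cst (c : R) : bdd_on S (fun=> c).
Proof. by split; [exact: measurable_cst|exists `|c|]. Qed.

Lemma bddD f h : bdd_on S f -> bdd_on S h -> bdd_on S (fun w => f w + h w).
Proof.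
move=> [mf [M fM]] [mh [N hN]]; split; first exact: measurable_funD.
by exists (M + N) => w Sw; rewrite (le_trans (ler_normD _ _))// lerD ?fM ?hN.
Qed.

Lemma bddM f h : bdd_on S f -> bdd_on S h -> bdd_on S (fun w => f w * h w).
Proof.
move=> [mf [M fM]] [mh [N hN]]; split; first exact: measurable_funM.
by exists (M * N) => w Sw; rewrite normrM ler_pM ?fM ?hN.
Qed.

Lemma bddN f : bdd_on S f -> bdd_on S (fun w => - f w).
Proof.
move=> [mf [M fM]]; split; first exact: measurableT_comp.
by exists M => w Sw; rewrite normrN fM.
Qed.

Lemma bddX f n : bdd_on S f -> bdd_on S (fun w => f w ^+ n).
Proof.
move=> bf; elim: n => [|n IH]; first exact: bdd_cst.
by under eq_fun do rewrite exprS; apply: bddM.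
Qed.

Lemma bdd_norm f : bdd_on S f -> bdd_on S (fun w => `|f w|).
Proof.
move=> [mf [M fM]]; split; first exact: measurableT_comp.
by exists M => w Sw; rewrite normr_id fM.
Qed.

Lemma bdd_powR f (a : R) : 0 <= a -> bdd_on S f -> (forall w, 0 <= f w) ->
  bdd_on S (fun w => f w `^ a).
Proof.
move=> a0 [mf [M fM]] f0; split; first exact: (measurableT_comp (measurable_powR _)).
exists (M `^ a) => w Sw; rewrite ger0_norm ?powR_ge0//.
have := fM _ Sw; rewrite ger0_norm// => fM'.
by apply: ge0_ler_powR; rewrite ?nnegrE//; apply: le_trans fM'.
Qed.

Lemma bdd_lt (z : R) : bdd_on S (fun w => (z < w)%R%:R).
Proof.
split; last by exists 1 => w _; case: (z < w); rewrite ?normr1 ?normr0.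
have -> : (fun w : R => (z < w)%R%:R) = \1_(`]z, +oo[%classic : set R) :> (R -> R).
  by apply/funext => w; rewrite indicE mem_setE in_itv/= andbT.
by apply: measurable_indic.
Qed.

Lemma bdd_le (z : R) : bdd_on S (fun w => (w <= z)%R%:R).
Proof.
split; last by exists 1 => w _; case: (w <= z); rewrite ?normr1 ?normr0.
have -> : (fun w : R => (w <= z)%R%:R) = \1_(`]-oo, z]%classic : set R) :> (R -> R).
  by apply/funext => w; rewrite indicE mem_setE in_itv/=.
by apply: measurable_indic.
Qed.

Lemma bdd_clip (a b : R) : a <= b -> bdd_on S (clip a b).
Proof.
move=> ab; split; first exact: clip_measurable.
exists (`|a| + `|b|) => w _; have /andP[h1 h2] := clip_in w ab.
have := ler_norm b; have := ler_norm (- a); rewrite normrN => n1 n2.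
have := normr_ge0 a; have := normr_ge0 b => n3 n4.
by rewrite ler_norml; lra.
Qed.

End Bdd.

(** What the estimates use of an exchangeable pair: [E f] stands for the
    expectation of [f(W)], [d] for the bound on [|W - W'|] and [r] for the
    remainder, while [e1], [e2] are the small parameters of the conditional
    variance and of the remainder. In [law_stein] the function [h], of either
    sign, is multiplied by a conditional variance close to 1, and the error
    [rho] by one that is at most [d0]. The hypothesis on [f] is one-sided, so
    that ramps may be subtracted from [f]. *)
Record stein_law (R : realType) (d0 alpha tau1 tau2 : R) (g : R -> R)
    (d e1 e2 : R) (S : set R) (r : R -> R) (E : (R -> R) -> R) : Prop := {
  law_d : 0 < d <= 1 ;
  law_e1 : 0 <= e1 ;
  law_e2 : 0 <= e2 ;
  law_lin : forall a f h, bdd_on S f -> bdd_on S h ->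
    E (fun w => a * f w + h w) = a * E f + E h ;
  law_le : forall f h, bdd_on S f -> bdd_on S h ->
    (forall w, S w -> f w <= h w) -> E f <= E h ;
  law_1 : E (fun=> 1) = 1 ;
  law_g : bdd_on S g ;
  law_r : bdd_on S r ;
  law_r2 : forall w, S w -> `|r w| <= e2 * (1 + `|g w|) `^ tau2 ;
  law_ra : forall w, S w -> `|r w| <= alpha * (`|g w| + 1) ;
  law_stein : forall f h rho, bdd_on S f -> bdd_on S h -> bdd_on S rho ->
    (forall w, 0 <= rho w) ->
    (forall w w', `|w - w'| <= d ->
       (w - w') * (f w - f w') <= (w - w') ^+ 2 * (h w + rho w)) ->
    E (fun w => (g w - r w) * f w) <=
      E h + e1 * E (fun w => (1 + `|g w|) `^ tau1 * `|h w|) + d0 * E rho }.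

Section Law.
Variables (R : realType) (d0 alpha tau1 tau2 : R) (g : R -> R).
Variables (d e1 e2 : R) (S : set R) (r : R -> R) (E : (R -> R) -> R).
Hypothesis L : stein_law d0 alpha tau1 tau2 g d e1 e2 S r E.

Lemma law_Z a f : bdd_on S f -> E (fun w => a * f w) = a * E f.
Proof.
move=> bf; have := law_lin L a bf (bdd_cst S 0); have := law_lin L 0 bf (bdd_cst S 0).
under eq_fun do rewrite mul0r add0r.
rewrite mul0r add0r; have := law_lin L 1 (bdd_cst S 0) (bdd_cst S 0).
under eq_fun do rewrite mulr0 add0r.
rewrite mul1r => H0 _; under eq_fun do rewrite addr0.
by move=> ->; lra.
Qed.

Lemma law_D f h : bdd_on S f -> bdd_on S h -> E (fun w => f w + h w) = E f + E h.
Proof.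
move=> bf bh; have := law_lin L 1 bf bh; rewrite mul1r => <-.
by under [in RHS]eq_fun do rewrite mul1r.
Qed.

Lemma law_cst c : E (fun=> c) = c.
Proof.
rewrite -[RHS]mulr1 -[X in _ = _ * X](law_1 L) -law_Z; last exact: bdd_cst.
by under [in RHS]eq_fun do rewrite mulr1.
Qed.

Lemma law_ge0 f : bdd_on S f -> (forall w, S w -> 0 <= f w) -> 0 <= E f.
Proof. by move=> bf f0; rewrite -(law_cst 0); apply: (law_le L) => //; exact: bdd_cst. Qed.

Lemma law_le2 f h k a b : bdd_on S f -> bdd_on S h -> bdd_on S k ->
  (forall w, S w -> f w <= a * h w + b * k w) -> E f <= a * E h + b * E k.
Proof.
move=> bf bh bk fhk; rewrite -(law_Z b bk) -(law_lin L) //; last exact: (bddM (bdd_cst _ _)).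
by apply: (law_le L) => //; apply: bddD => //; apply: (bddM (bdd_cst _ _)).
Qed.

Lemma law_le1 f h a : bdd_on S f -> bdd_on S h ->
  (forall w, S w -> f w <= a * h w) -> E f <= a * E h.
Proof.
move=> bf bh fh; rewrite -(law_Z a bh).
by apply: (law_le L) => //; apply: (bddM (bdd_cst _ _)).
Qed.

Lemma law_comb3 f1 f2 f3 h a1 a2 a3 :
  bdd_on S f1 -> bdd_on S f2 -> bdd_on S f3 ->
  (forall w, h w = a1 * f1 w + (a2 * f2 w + a3 * f3 w)) ->
  E h = a1 * E f1 + (a2 * E f2 + a3 * E f3).
Proof.
move=> b1 b2 b3 hE.
have bZ a f : bdd_on S f -> bdd_on S (fun w => a * f w) by move=> ?; exact: (bddM (bdd_cst _ _)).
have -> : h = (fun w => a1 * f1 w + (a2 * f2 w + a3 * f3 w)) by apply/funext.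
rewrite -(law_Z a3 b3) -(law_lin L a2 b2 (bZ a3 _ b3)).
by rewrite -(law_lin L a1 b1 (bddD (bZ a2 _ b2) (bZ a3 _ b3))).
Qed.

Lemma law_ge4 f1 f2 f3 f4 h a1 a2 a3 a4 :
  bdd_on S f1 -> bdd_on S f2 -> bdd_on S f3 -> bdd_on S f4 -> bdd_on S h ->
  (forall w, S w -> a1 * f1 w + (a2 * f2 w + (a3 * f3 w + a4 * f4 w)) <= h w) ->
  a1 * E f1 + (a2 * E f2 + (a3 * E f3 + a4 * E f4)) <= E h.
Proof.
move=> b1 b2 b3 b4 bh fh.
have bZ a f : bdd_on S f -> bdd_on S (fun w => a * f w) by move=> ?; exact: (bddM (bdd_cst _ _)).
rewrite -(law_Z a4 b4) -(law_lin L a3 b3 (bZ a4 _ b4)).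
rewrite -(law_lin L a2 b2 (bddD (bZ a3 _ b3) (bZ a4 _ b4))).
rewrite -(law_lin L a1 b1 (bddD (bZ a2 _ b2) (bddD (bZ a3 _ b3) (bZ a4 _ b4)))).
by apply: (law_le L) => //; do !apply: bddD => //; exact: bZ.
Qed.

(** The case [h = 0], for test functions of which only the order of magnitude
    of the slope matters. *)
Lemma law_stein_lip f rho : bdd_on S f -> bdd_on S rho ->
  (forall w, 0 <= rho w) ->
  (forall w w', `|w - w'| <= d -> `|f w - f w'| <= rho w * `|w - w'|) ->
  E (fun w => (g w - r w) * f w) <= d0 * E rho.
Proof.
move=> bf brho rho0 flip.
have := law_stein L bf (bdd_cst S 0) brho rho0.
rewrite law_cst; under [X in e1 * E X]eq_fun do rewrite normr0 mulr0.
rewrite law_cst mulr0 !add0r; apply=> w w' ww'; rewrite add0r.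
apply: le_trans (ler_norm _) _; rewrite normrM -real_normK ?num_real// expr2 -mulrA.
by rewrite ler_wpM2l// mulrC flip.
Qed.

End Law.

(** * Moments of g(W) *)

Ltac bdd := repeat match goal with
  | H : bdd_on ?S ?f |- bdd_on ?S ?f => exact: H
  | |- bdd_on _ (fun _ => ?c) => exact: bdd_cst
  | |- bdd_on _ (fun w => @?f w + @?h w) => apply: (@bddD _ _ f h)
  | |- bdd_on _ (fun w => @?f w * @?h w) => apply: (@bddM _ _ f h)
  | |- bdd_on _ (fun w => - @?f w) => apply: (@bddN _ _ f)
  | |- bdd_on _ (fun w => @?f w ^+ ?n) => apply: (@bddX _ _ f n)
  | |- bdd_on _ (fun w => `|@?f w|) => apply: (@bdd_norm _ _ f)
  | L : stein_law _ _ _ _ ?g _ _ _ _ _ _ |- bdd_on _ (fun w => ?g w) => exact: (law_g L)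
  | L : stein_law _ _ _ _ _ _ _ _ _ ?r _ |- bdd_on _ (fun w => ?r w) => exact: (law_r L)
  | |- bdd_on _ _ => first [assumption | exact: bdd_lt | exact: bdd_le]
  end.

(** The leading power wins for large [x], and the constant [D] covers the rest;
    moments of lower order are absorbed by the leading one in this way. *)
Lemma pow_absorb (R : realType) k (a C : R) : 0 < a ->
  exists2 D, 0 <= D & forall x, 0 <= x -> C * (1 + x) ^+ k <= a * x ^+ k.+1 + D.
Proof.
move=> a0; pose B := Num.max 1 (2 ^+ k * `|C| / a).
have B1 : 1 <= B by rewrite le_max lexx.
have B0 : 0 <= B by rewrite (le_trans ler01).
exists (`|C| * (1 + B) ^+ k); first by rewrite mulr_ge0 ?exprn_ge0// addr_ge0.
move=> x x0; have x1 : 0 <= 1 + x by rewrite addr_ge0.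
apply: (@le_trans _ _ (`|C| * (1 + x) ^+ k)).
  by rewrite ler_wpM2r ?ler_norm// exprn_ge0.
have [xB|/ltW Bx] := leP x B.
  apply: (@le_trans _ _ (`|C| * (1 + B) ^+ k)); last first.
    by rewrite lerDr mulr_ge0 ?(ltW a0)// exprn_ge0.
  by rewrite ler_wpM2l// lerXn2r ?nnegrE ?addr_ge0// lerD2l.
apply: (@le_trans _ _ (a * x ^+ k.+1)); last first.
  by rewrite lerDl mulr_ge0 ?exprn_ge0// addr_ge0.
apply: (@le_trans _ _ (`|C| * (2 * x) ^+ k)).
  rewrite ler_wpM2l// lerXn2r ?nnegrE ?mulr_ge0//.
  by have := le_trans B1 Bx; lra.
rewrite exprMn exprS mulrA [leRHS]mulrA ler_wpM2r ?exprn_ge0//.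
have : 2 ^+ k * `|C| / a <= x by rewrite (le_trans _ Bx)// le_max lexx orbT.
by rewrite ler_pdivrMr// mulrC [x * a]mulrC.
Qed.

Lemma pow_lipschitz (R : realType) (f df : R -> R) k (a b B D : R) :
  (forall x : R, is_derive x 1 f (df x)) -> 0 <= D ->
  (forall c, Num.min a b <= c <= Num.max a b -> `|f c| <= B /\ `|df c| <= D * B) ->
  `|f a ^+ k - f b ^+ k| <= k%:R * D * B ^+ k * `|a - b|.
Proof.
case: k => [|k] fd D0 fB; first by rewrite !expr0 subrr normr0 !mul0r.
have dk (x : R) : is_derive x 1 (fun y => f y ^+ k.+1) (k.+1%:R * f x ^+ k * df x).
  have dfx := fd x.
  by rewrite -exprfctE; exact: (is_deriveX k.+1 dfx).
have [c /fB [fc dfc] ->] := mvt_between a b dk.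
have f0 := normr_ge0 (f c).
rewrite normrM ler_wpM2r// normrM normrM normrX normr_nat.
have -> : k.+1%:R * D * B ^+ k.+1 = k.+1%:R * B ^+ k * (D * B) by rewrite exprS; ring.
rewrite -[leLHS]mulrA -[leRHS]mulrA ler_wpM2l// ler_pM ?exprn_ge0//.
by rewrite lerXn2r ?nnegrE//; lra.
Qed.

Section Moments.
Variables (R : realType) (c1 c3 A d0 alpha tau1 tau2 : R).
Hypotheses (d0_ge1 : 1 <= d0) (alpha_ge0 : 0 <= alpha) (alpha_lt1 : alpha < 1).

(** Take [f = g ^+ k] with [k] odd. Then [(g - r) f] is at least
    [(1 - alpha) |g| ^+ k.+1] up to a term of order [k], and the slope of [f]
    is of order [(1 + |g|) ^+ k] since [|g'| <= c3 (1 + |g|)]. Stein's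
    inequality bounds the moment of order [k + 1] by the one of order [k], which
    is absorbed. *)
Lemma moment_bound (n : nat) : exists2 C, 0 <= C &
  forall g dg G F d e1 e2 S r E,
  stein_target c1 c3 A g dg G F ->
  stein_law d0 alpha tau1 tau2 g d e1 e2 S r E ->
  E (fun w => (1 + `|g w|) ^+ n) <= C.
Proof.
have a0 := alpha_ge0; have a1 := alpha_lt1; have d1 := d0_ge1.
have a1' : 0 < (1 - alpha) / 2 by lra.
(* Odd, so that [g * g ^+ k = |g| ^+ k.+1], and at least [n]. *)
have [k kE] : exists k, k = n.*2.+1 by exists n.*2.+1.
pose D := d0 * (k%:R * c3 * A ^+ k) + 1.
have [D1 D10 HD1] := pow_absorb k D a1'.
have [D2 D20 HD2] := pow_absorb k (1 : R) ltr01.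
exists (2 / (1 - alpha) * D1 + D2).
  by rewrite addr_ge0// mulr_ge0// divr_ge0//; lra.
move=> g dg G F d e1 e2 S r E T L.
have c3' := tg_c3 T; have A1 := tg_A T.
have Gk1 w : g w ^+ k.+1 = `|g w| ^+ k.+1.
  by rewrite -normrX ger0_norm// kE -[_.+2]/(n.*2.+2) -doubleS -muln2 mulnC exprM exprn_ge0// sqr_ge0.
have stein : E (fun w => (g w - r w) * g w ^+ k) <=
    d0 * E (fun w => k%:R * c3 * A ^+ k * (1 + `|g w|) ^+ k).
  apply: (law_stein_lip L); [by bdd|by bdd| |].
    by move=> w; rewrite !mulr_ge0 ?exprn_ge0 ?addr_ge0//; lra.
  move=> w w' ww'.
  have -> : k%:R * c3 * A ^+ k * (1 + `|g w|) ^+ k = k%:R * c3 * (A * (1 + `|g w|)) ^+ k.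
    by rewrite exprMn; ring.
  apply: (@pow_lipschitz R g dg k w w' (A * (1 + `|g w|)) c3 (tg_der T)) => // c cw.
  have gc : 1 + `|g c| <= A * (1 + `|g w|).
    have -> : c = w + (c - w) by ring.
    apply: (tg_shift T); have /andP[_ dl1] := law_d L; apply: le_trans dl1.
    exact: le_trans (between_dist cw) ww'.
  split; first by apply: le_trans gc; rewrite lerDr.
  by rewrite (le_trans (tg_dg T c))// ler_wpM2l.
have low : (1 - alpha) * E (fun w => `|g w| ^+ k.+1) <= D * E (fun w => (1 + `|g w|) ^+ k).
  have -> : D * E (fun w => (1 + `|g w|) ^+ k) =
      d0 * E (fun w => k%:R * c3 * A ^+ k * (1 + `|g w|) ^+ k) + E (fun w => (1 + `|g w|) ^+ k).
    by rewrite (law_Z L (k%:R * c3 * A ^+ k)); [rewrite /D; ring|by bdd].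
  rewrite -lerBlDr; apply: le_trans stein.
  rewrite lerBlDr -(law_Z L) -?(law_D L); [|by bdd..].
  apply: (law_le L); [by bdd..|] => w Sw.
  have gk : `|g w ^+ k| <= (1 + `|g w|) ^+ k.
    by rewrite normrX lerXn2r ?nnegrE ?addr_ge0//; lra.
  have ra := law_ra L Sw.
  have -> : (g w - r w) * g w ^+ k = g w ^+ k.+1 - r w * g w ^+ k by rewrite exprS; ring.
  rewrite Gk1.
  have : r w * g w ^+ k <= alpha * (`|g w| + 1) * `|g w ^+ k|.
    by apply: le_trans (ler_norm _) _; rewrite normrM ler_wpM2r.
  have gk0 := normr_ge0 (g w ^+ k).
  have : alpha * `|g w ^+ k| <= (1 + `|g w|) ^+ k by nra.
  have -> : `|g w| ^+ k.+1 = `|g w| * `|g w ^+ k| by rewrite normrX exprS.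
  lra.
have up : D * E (fun w => (1 + `|g w|) ^+ k) <=
   (1 - alpha) / 2 * E (fun w => `|g w| ^+ k.+1) + D1.
  rewrite -(law_cst L D1) -!(law_Z L) -?(law_D L); [|by bdd..].
  by apply: (law_le L); [by bdd..|] => w Sw; exact: HD1.
have Ek : E (fun w => `|g w| ^+ k.+1) <= 2 / (1 - alpha) * D1.
  have -> : 2 / (1 - alpha) * D1 = D1 / ((1 - alpha) / 2) by field; lra.
  by rewrite ler_pdivlMr//; lra.
apply: (@le_trans _ _ (1 * E (fun w => `|g w| ^+ k.+1) + D2 * E (fun => 1))); last first.
  by rewrite (law_cst L); lra.
apply: (law_le2 L); [by bdd..|] => w Sw; rewrite mulr1.
apply: le_trans (HD2 _ (normr_ge0 _)); rewrite mul1r ler_weXn2l ?lerDl//.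
by rewrite kE -addnn -addSn leq_addl.
Qed.

End Moments.

(** * The tilted test function *)

Section TiltedTest.
Variables (R : realType) (c1 c3 A : R) (g dg G F : R -> R).
Variables (K0 th z d : R).

(** The slope of the ramp, large enough to dominate the slope of the tilted
    exponential on [[z - d, z]] ([dtilt_kink]). *)
Definition tilted_kink := expR 1 * (g z * tilt G th z).
(** The tilted exponential, frozen outside [[0, z]]. Its slope falls to 0 at
    [z], but a pair with [w] beyond [z] and [w'] before it still sees the
    positive slope of the left side; the increasing ramp takes this away. *)
Definition tilted_test (w : R) :=
  tilt G th (clip 0 z w) - tilted_kink * (clip (z - d) (z + d) w - (z - d)).
Definition window (w : R) : R := (0 < w)%R%:R * (w <= z)%R%:R.
Definition tilted_slope (w : R) := dtilt g G th w * window w.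
(** The first term pays for the corner at 0, the second for the variation of
    the slope at distance [d]. *)
Definition tilted_error (w : R) :=
  2 * (A * expR A)
  + (c3 + 1) * expR (K0 + 1) * (d * (1 + g z) ^+ 2) * (tilt G th w * window w).

Hypothesis T : stein_target c1 c3 A g dg G F.
Hypotheses (th0 : 0 <= th) (th1 : th <= 1) (thg : th <= (growth_point c1)^-1).
Hypotheses (d_gt0 : 0 < d) (d_le1 : d <= 1) (zX : growth_point c1 + 1 <= z).
Hypothesis dgz : d * g z <= K0.

Let z_ge1 : 1 <= z.
Proof. have := growth_point_gt0 T; have := zX; lra. Qed.

(** The corner at 0 needs no ramp: near 0 all slopes are bounded. *)
Lemma dtilt_near0 x : 0 <= x <= 1 -> `|dtilt g G th x| <= A * expR A.
Proof.
move=> /andP[x0 x1]; have A1 := tg_A T; have t0 := th0; have t1 := th1.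
have g0 := g_ge0 T x0.
have gA : 1 + g x <= A by rewrite -[A]expr1 (shift_bound T).
rewrite normrM [`|tilt _ _ _|]ger0_norm ?expR_ge0// ler_pM ?expR_ge0//.
  by rewrite ler_norml; lra.
rewrite ler_expR.
have := G_convex T 0 x; rewrite (tG_0 T) !subr0 => GA.
have : 0 <= th * x by rewrite mulr_ge0.
nra.
Qed.

(** [d * g z <= K0] bounds the change of [G] and [th <= 1] the change of the
    tilt. *)
Lemma tilt_shift x y : 0 <= x -> 0 <= y <= z -> `|y - x| <= d ->
  tilt G th y <= expR (K0 + 1) * tilt G th x.
Proof.
move=> x0 /andP[y0 yz] xy; rewrite -expRD ler_expR.
have d0 := d_gt0; have d1 := d_le1; have t0 := th0; have t1 := th1.
have gy0 := g_ge0 T y0; have gyz := tg_mono T yz; have dg' := dgz.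
have Gc := G_convex T x y.
have yd : g y * (y - x) <= g z * d.
  apply: (@le_trans _ _ (g y * d)); last by rewrite ler_wpM2r// ltW.
  by rewrite ler_wpM2l//; move: xy; rewrite ler_norml; lra.
have : th * (x - y) <= 1 * d.
  apply: (@le_trans _ _ (th * d)); last by rewrite ler_wpM2r// ltW.
  by rewrite ler_wpM2l//; move: xy; rewrite ler_norml; lra.
lra.
Qed.

(** The second derivative of the tilted exponential is
    [(g' + (g - th)^2) * tilt], at most [(c3 + 1) (1 + g z)^2 * tilt] on
    [[0, z]], and [tilt_shift] moves it back to [x]. *)
Lemma dtilt_shift x y : 0 <= x <= z -> 0 <= y <= z -> `|x - y| <= d ->
  dtilt g G th y <= dtilt g G th x
    + (c3 + 1) * expR (K0 + 1) * (d * (1 + g z) ^+ 2) * tilt G th x.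
Proof.
move=> /andP[x0 xz] /andP[y0 yz] xy; rewrite -lerBlDl.
have [c cxy ->] := mvt_between y x (dtilt_der T th).
apply: le_trans (ler_norm _) _; rewrite normrM.
have c0 : 0 <= c := between_ge cxy y0 x0.
have cz : c <= z := between_le cxy yz xz.
have cx : `|c - x| <= d.
  by apply: le_trans xy; apply: between_dist; rewrite minC maxC.
have d0 := d_gt0; have d1 := d_le1; have t0 := th0; have t1 := th1.
have gc0 := g_ge0 T c0; have gcz := tg_mono T cz; have c3' := tg_c3 T.
have tc := tilt_shift x0 (introT andP (conj c0 cz)) cx.
have b : `|dg c + (g c - th) ^+ 2| <= (c3 + 1) * (1 + g z) ^+ 2.
  apply: le_trans (ler_normD _ _) _; rewrite [`|_ ^+ 2|]ger0_norm ?sqr_ge0//.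
  have := tg_dg T c; rewrite (ger0_norm gc0) => dgc.
  have : c3 * (1 + g c) <= c3 * (1 + g z) ^+ 2 by rewrite ler_wpM2l//; nra.
  have : (g c - th) ^+ 2 <= (1 + g z) ^+ 2 by nra.
  lra.
rewrite normrM [`|tilt _ _ _|]ger0_norm ?expR_ge0//.
have -> : (c3 + 1) * expR (K0 + 1) * (d * (1 + g z) ^+ 2) * tilt G th x =
  (c3 + 1) * (1 + g z) ^+ 2 * (expR (K0 + 1) * tilt G th x) * d by ring.
rewrite ler_pM ?mulr_ge0 ?expR_ge0//; last by rewrite distrC.
by rewrite ler_pM ?expR_ge0.
Qed.

Lemma dtilt_kink x : z - d <= x <= z -> dtilt g G th x <= tilted_kink.
Proof.
move=> /andP[zx xz]; have d0 := d_gt0; have d1 := d_le1; have t0 := th0; have t1 := th1.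
have z1 := z_ge1; have x0 : 0 <= x by lra.
have gx0 := g_ge0 T x0; have gxz := tg_mono T xz.
have : tilt G th x <= expR 1 * tilt G th z.
  rewrite -expRD ler_expR; have := G_mono T x0 xz.
  have : th * (z - x) <= 1 by nra.
  lra.
have := expR_gt0 (G x - th * x); rewrite -/(tilt G th x) => tx0 tz.
rewrite /dtilt /tilted_kink mulrCA.
apply: (@le_trans _ _ (g z * tilt G th x)); first by rewrite ler_wpM2r ?(ltW tx0)//; lra.
by rewrite ler_wpM2l//; lra.
Qed.

(** The hypothesis of Stein's inequality for [tilted_test], by the mean value
    theorem on the truncated arguments. *)
Lemma tilted_test_slope w w' : `|w - w'| <= d ->
  (w - w') * (tilted_test w - tilted_test w')
    <= (w - w') ^+ 2 * (tilted_slope w + tilted_error w).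
Proof.
move=> ww; have d0 := d_gt0; have d1 := d_le1; have z1 := z_ge1.
have A1 := tg_A T; have c3' := tg_c3 T.
have z0 : 0 <= z by lra.
have ww2 : - d <= w - w' <= d by rewrite -ler_norml.
have gz := g_ge0 T z0.
have kink0 : 0 <= tilted_kink by rewrite !mulr_ge0 ?expR_ge0.
have zdd : z - d <= z + d by lra.
have /andP[s1 s2] := clip_sign w w' zdd.
have /andP[t1 t2] := clip_sign w w' z0.
have ramp0 : 0 <= tilted_kink * ((w - w') * (clip (z - d) (z + d) w - clip (z - d) (z + d) w')).
  by rewrite mulr_ge0.
have AA : 0 <= A * expR A by rewrite mulr_ge0 ?expR_ge0//; lra.
have sq := sqr_ge0 (w - w').
have E : (w - w') * (tilted_test w - tilted_test w') =
   (w - w') * (tilt G th (clip 0 z w) - tilt G th (clip 0 z w')) -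
   tilted_kink * ((w - w') * (clip (z - d) (z + d) w - clip (z - d) (z + d) w')).
  by rewrite /tilted_test; ring.
have [c cww Ec] := mvt_between (clip 0 z w) (clip 0 z w') (tilt_der T th).
have /andP[cl0 clz] := clip_in w z0; have /andP[cl0' clz'] := clip_in w' z0.
have c0 : 0 <= c := between_ge cww cl0 cl0'.
have cz : c <= z := between_le cww clz clz'.
have cw : `|c - clip 0 z w| <= d.
  by rewrite (le_trans (between_dist cww))// (le_trans (clip_dist _ _ z0)).
rewrite {}Ec in E.
set q := (w - w') * (clip 0 z w - clip 0 z w') in t1 t2.
have {}E : (w - w') * (tilted_test w - tilted_test w') =
   q * dtilt g G th c -
   tilted_kink * ((w - w') * (clip (z - d) (z + d) w - clip (z - d) (z + d) w')).
  by rewrite E /q; ring.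
(* Left of 0 the target slope vanishes, and [c] lies in [[0, 1]]. *)
have [w0|w0] := leP w 0.
  rewrite /tilted_slope /tilted_error /window ltNge w0 mul0r !mulr0 addr0 add0r.
  have c1' : c <= 1.
    by move: cw; rewrite (clip_left z0 w0) subr0 ler_norml; lra.
  have := dtilt_near0 (introT andP (conj c0 c1')); rewrite ler_norml => /andP[_ dc].
  rewrite E; nra.
(* Beyond [z] the ramp has slope [tilted_kink] and outweighs the slope at [c]. *)
have [wz|zw] := leP w z; last first.
  rewrite /tilted_slope /tilted_error /window (leNgt w) zw !mulr0 addr0 add0r.
  have cwz : clip 0 z w = z by rewrite clip_right// ltW.
  have [zw'|w'z] := leP z w'.
    have : q = 0 by rewrite /q cwz (clip_right _ zw') ?subrr ?mulr0//.
    rewrite E => ->; nra.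
  have dc : dtilt g G th c <= tilted_kink.
    apply: dtilt_kink; move: cw; rewrite cwz ler_norml cz andbT; lra.
  rewrite E (@clip_id _ (z - d) (z + d) w) ?(@clip_id _ (z - d) (z + d) w'); try lra.
  nra.
rewrite /tilted_slope /tilted_error /window w0 wz !mulr1.
have cwE : clip 0 z w = w by apply: clip_id; rewrite wz (ltW w0).
rewrite cwE in cw.
have wI : 0 <= w <= z by rewrite wz (ltW w0).
have := dtilt_shift wI (introT andP (conj c0 cz)); rewrite distrC => /(_ cw).
set e := _ * tilt G th w; set lw := dtilt g G th w => dc.
have e0 : 0 <= e.
  by rewrite /e !mulr_ge0 ?expR_ge0 ?sqr_ge0 ?(ltW d0)//; lra.
have R0 : (w - w') ^+ 2 * (lw + e) <= (w - w') ^+ 2 * (lw + (2 * (A * expR A) + e)).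
  by rewrite ler_wpM2l//; lra.
rewrite E; apply: (@le_trans _ _ (q * dtilt g G th c)); first by rewrite gerBl.
(* Across the corner at 0, [q] may be less than the square, but both slopes
   are bounded. *)
have [w'0|w'0] := leP w' 0.
  have w1 : 0 <= w <= 1 by rewrite (ltW w0); lra.
  have c1' : 0 <= c <= 1.
    rewrite c0 (between_le cww) ?cwE ?(clip_left z0 w'0)//.
    by have /andP[] := w1.
  have := dtilt_near0 c1'; rewrite ler_norml => /andP[_ dcA].
  have := dtilt_near0 w1; rewrite ler_norml -/lw => /andP[lwA _].
  apply: (@le_trans _ _ ((w - w') ^+ 2 * (A * expR A))).
    by apply: (@le_trans _ _ (q * (A * expR A))); rewrite ?ler_wpM2l ?ler_wpM2r.
  by rewrite ler_wpM2l//; lra.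
apply: le_trans R0; apply: (@le_trans _ _ (q * (lw + e))); first by rewrite ler_wpM2l.
have [w'z|zw'] := leP w' z.
  by rewrite /q cwE (clip_id (a := 0)) ?w'z ?(ltW w'0)// expr2.
(* For [w'] beyond [z], [q] is at most the square, and the slope at [w] is
   nonnegative because [w] exceeds the growth point. *)
rewrite ler_wpM2r// addr_ge0// /lw /dtilt mulr_ge0 ?expR_ge0// subr_ge0.
apply: le_trans thg _; apply: (g_lower T); have := zX; lra.
Qed.

End TiltedTest.

(** The size of the error terms at level [z]; [(1 + z) * rate z] is comparable
    to the error term of the theorem. *)
Definition rate (R : realType) (tau1 tau2 d e1 e2 : R) (g : R -> R) (z : R) : R :=
  d * (1 + g z) ^+ 2 + e1 * (1 + g z) `^ (tau1 + 1) + e2 * (1 + g z) `^ tau2.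

Section Rate.
Variables (R : realType) (c1 c3 A d0 alpha tau1 tau2 : R).
Variables (g dg G F : R -> R) (d e1 e2 : R) (S : set R) (r : R -> R).
Variables (E : (R -> R) -> R) (K0 z : R).
Hypothesis T : stein_target c1 c3 A g dg G F.
Hypothesis L : stein_law d0 alpha tau1 tau2 g d e1 e2 S r E.
Hypotheses (z_ge0 : 0 <= z) (zrate : (1 + z) * rate tau1 tau2 d e1 e2 g z <= K0).

Lemma rate_parts : [/\ d * (1 + g z) ^+ 2 <= K0 / (1 + z),
  e1 * (1 + g z) `^ (tau1 + 1) <= K0 / (1 + z),
  e2 * (1 + g z) `^ tau2 <= K0 / (1 + z) & d * g z <= K0].
Proof.
have z1 := z_ge0; have g0 := g_ge0 T z_ge0; have := zrate; rewrite /rate mulrC -ler_pdivlMr; last lra.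
have /andP[d_gt0 d_le1] := law_d L.
have t1 : 0 <= d * (1 + g z) ^+ 2 by rewrite mulr_ge0 ?exprn_ge0 ?(ltW d_gt0)//; lra.
have t2 : 0 <= e1 * (1 + g z) `^ (tau1 + 1) by rewrite mulr_ge0 ?powR_ge0 ?(law_e1 L).
have t3 : 0 <= e2 * (1 + g z) `^ tau2 by rewrite mulr_ge0 ?powR_ge0 ?(law_e2 L).
move=> H; have H1 : d * (1 + g z) ^+ 2 <= K0 / (1 + z) by lra.
split; [by []|lra|lra|].
have K00 : 0 <= K0 / (1 + z) by lra.
have z2 : 0 < 1 + z by lra.
have : K0 / (1 + z) <= K0.
  by move: K00; rewrite pmulr_lge0 ?invr_gt0// => K00; rewrite ler_pdivrMr//; nra.
have : d * g z <= d * (1 + g z) ^+ 2 by rewrite ler_wpM2l ?(ltW d_gt0)//; nra.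
lra.
Qed.

End Rate.

Section KeyLarge.
Variables (R : realType) (c1 c3 A d0 alpha tau1 tau2 : R).
Variables (g dg G F : R -> R) (d e1 e2 : R) (S : set R) (r : R -> R).
Variables (E : (R -> R) -> R) (K0 th k1 z : R).
Hypothesis T : stein_target c1 c3 A g dg G F.
Hypothesis L : stein_law d0 alpha tau1 tau2 g d e1 e2 S r E.
Hypotheses (d0_ge1 : 1 <= d0) (tau1_ge0 : 0 <= tau1) (tau2_ge0 : 0 <= tau2).
Hypotheses (alpha_ge0 : 0 <= alpha) (alpha_lt1 : alpha < 1).
Hypotheses (th0 : 0 <= th) (th1 : th <= 1) (thg : th <= (growth_point c1)^-1).
Hypotheses (zX : growth_point c1 + 1 <= z) (zrate : (1 + z) * rate tau1 tau2 d e1 e2 g z <= K0).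
Hypothesis kink_small : 4 * d * expR 1 * g z <= k1 / 2.
Hypothesis drift : forall w, S w -> z < w -> k1 * (1 + g w) <= g w - r w.

Let z_ge1 : 1 <= z.
Proof. have := growth_point_gt0 T; have := zX; lra. Qed.

Let gz0 : 0 <= g z.
Proof. by apply: (g_ge0 T); have := z_ge1; lra. Qed.

Local Notation psi := (tilt G th).
Local Notation win := (window z).

(** A continuous function is bounded on the window, although it may be
    unbounded on [S]. *)
Lemma window_bdd (f df : R -> R) : (forall x : R, is_derive x 1 f (df x)) ->
  bdd_on S (fun w => f w * win w).
Proof.
move=> fd; split.
  apply: measurable_funM; first exact: measurable_of_derivative fd.
  have bw : bdd_on S win by rewrite /window; bdd.
  by case: bw.
have z1 := z_ge1; have z0 : 0 <= z by lra.
have cf : {within `[0, z], continuous (fun x => `|f x|)}.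
  apply: continuous_subspaceT => x; apply: continuous_comp; last exact: norm_continuous.
  by apply: differentiable_continuous; apply/derivable1_diffP; case: (fd x).
have [c _ fc] := EVT_max z0 cf.
exists `|f c| => w _; rewrite /window.
have [w0|_] := ltP 0 w; last by rewrite mul0r mulr0 normr0.
have [wz|_] := leP w z; last by rewrite mulr0 mulr0 normr0.
by rewrite !mulr1; apply: fc; rewrite in_itv/= wz ltW.
Qed.

Lemma test_bdd : bdd_on S (tilted_test g G th z d).
Proof.
have z1 := z_ge1; have z0 : 0 <= z by lra.
have /andP[d_gt0 d_le1] := law_d L.
have zdd : z - d <= z + d by lra.
rewrite /tilted_test; apply: bddD; last first.
  by have bc := bdd_clip S zdd; bdd.
split; first by apply: measurableT_comp (clip_measurable _ _); exact: measurable_of_derivative (tilt_der T th).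
exists (expR (G z)) => w _; rewrite ger0_norm ?expR_ge0// ler_expR.
have /andP[c0 cz] := clip_in w z0.
have := G_mono T c0 cz; have : 0 <= th * clip 0 z w by rewrite mulr_ge0.
lra.
Qed.

(** On the window, the remainder and the ramp cost a multiple of
    [psi / (1 + z)], by [rate_parts]. Beyond [z] the drift makes
    [(g - r) psi z] positive and the ramp takes away at most half of it. Left
    of 0 the test function is 1. *)
Lemma tilted_test_lower w : S w ->
  g w * (psi w * win w) + (k1 / 2 * psi z * ((1 + `|g w|) * (z < w)%R%:R)
    - ((K0 + 4 * expR (K0 + 2) * K0) / (1 + z) * (psi w * win w) + 2 * (1 + `|g w|)))
  <= (g w - r w) * tilted_test g G th z d w.
Proof.
move=> Sw; have z1 := z_ge1; have z0 : 0 <= z by lra.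
have /andP[d_gt0 d_le1] := law_d L; have g0 := gz0.
have zdd : z - d <= z + d by lra.
have [rd r1 r2 dgz] := rate_parts T L (le_trans ler01 z_ge1) zrate.
have ra : `|r w| <= 1 + `|g w|.
  apply: le_trans (law_ra L Sw) _; have := normr_ge0 (g w); have := alpha_lt1; nra.
have gr : `|g w - r w| <= 2 * (1 + `|g w|).
  by rewrite (le_trans (ler_normB _ _))//; lra.
have gr' := gr; rewrite ler_norml in gr'.
have K00 : 0 <= K0 / (1 + z).
  by apply: le_trans r2; rewrite mulr_ge0 ?powR_ge0 ?(law_e2 L).
rewrite /tilted_test /window.
have [w0|w0] := leP w 0.
  have zw : (z < w) = false by apply/negbTE; rewrite -leNgt; lra.
  rewrite zw mul0r !mulr0 (clip_left z0 w0) clip_left//; last lra.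
  rewrite subrr mulr0 subr0 /tilt (tG_0 T) mulr0 subr0 expR0; lra.
have px : 0 < psi w by exact: expR_gt0.
have pz : 0 < psi z by exact: expR_gt0.
have /andP[rp1 rp2] := clip_in w zdd.
set ramp := clip (z - d) (z + d) w - (z - d).
have rp0 : 0 <= ramp by rewrite subr_ge0.
have rp3 : ramp <= 2 * d by rewrite /ramp; lra.
have kE : tilted_kink g G th z * (2 * d) * 2 = 4 * d * expR 1 * g z * psi z.
  by rewrite /tilted_kink; ring.
have k0 : 0 <= tilted_kink g G th z.
  by rewrite /tilted_kink mulr_ge0 ?expR_ge0// mulr_ge0// ltW.
have kr0 : 0 <= tilted_kink g G th z * ramp by exact: mulr_ge0.
have [wz|zw] := leP w z; last first.
  rewrite !mulr0 !add0r !mulr1 (clip_right z0 (ltW zw)).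
  have gw0 : 0 <= g w by apply: (g_ge0 T); lra.
  have dr := drift Sw zw; rewrite (ger0_norm gw0) in gr gr' *.
  have : (g w - r w) * (tilted_kink g G th z * ramp) <= k1 / 2 * psi z * (1 + g w).
    apply: le_trans (ler_norm _) _; rewrite normrM.
    rewrite (ger0_norm kr0).
    apply: (@le_trans _ _ (2 * (1 + g w) * (tilted_kink g G th z * (2 * d)))).
      by apply: ler_pM => //; rewrite ler_wpM2l.
    have -> : 2 * (1 + g w) * (tilted_kink g G th z * (2 * d)) =
      (4 * d * expR 1 * g z * psi z) * (1 + g w) by rewrite -kE; ring.
    have g1 : 0 <= 1 + g w by lra.
    exact: (ler_wpM2r g1 (ler_wpM2r (ltW pz) kink_small)).
  have : k1 * (1 + g w) * psi z <= (g w - r w) * psi z.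
    by rewrite ler_wpM2r// (ltW pz).
  rewrite mulrBr; lra.
rewrite mulr0 mulr0 add0r mul1r mulr1 (clip_id (w := w)) ?wz ?(ltW w0)//.
have gw0 := g_ge0 T (ltW w0); have gwz := tg_mono T wz.
rewrite (ger0_norm gw0) in ra gr gr' *.
have rw : r w * psi w <= K0 / (1 + z) * psi w.
  rewrite ler_wpM2r ?(ltW px)//; apply: le_trans (ler_norm _) _.
  apply: le_trans (law_r2 L Sw) _; apply: le_trans r2; rewrite ler_wpM2l ?(law_e2 L)//.
  by apply: ge0_ler_powR; rewrite ?nnegrE ?tau2_ge0 ?(ger0_norm gw0)//; lra.
have kr : (g w - r w) * (tilted_kink g G th z * ramp)
    <= 4 * expR (K0 + 2) * (K0 / (1 + z)) * psi w.
  have [wd|wd] := leP w (z - d).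
    rewrite /ramp clip_left// subrr !mulr0.
    by apply: mulr_ge0; [rewrite mulr_ge0// mulr_ge0 ?expR_ge0|exact: ltW].
  have pzw : psi z <= expR (K0 + 1) * psi w.
    apply: (tilt_shift T th0 th1 d_gt0 d_le1 dgz (ltW w0)); first by rewrite z0 lexx.
    by rewrite ler_norml; lra.
  apply: le_trans (ler_norm _) _; rewrite normrM.
  rewrite (ger0_norm kr0).
  apply: (@le_trans _ _ (2 * (1 + g w) * (tilted_kink g G th z * (2 * d)))).
    by apply: ler_pM => //; rewrite ler_wpM2l.
  have -> : 2 * (1 + g w) * (tilted_kink g G th z * (2 * d)) =
      4 * expR 1 * psi z * (d * ((1 + g w) * g z)) by rewrite /tilted_kink; ring.
  have -> : 4 * expR (K0 + 2) * (K0 / (1 + z)) * psi w =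
      4 * expR 1 * (expR (K0 + 1) * psi w) * (K0 / (1 + z)).
    have -> : expR (K0 + 2) = expR 1 * expR (K0 + 1) by rewrite -expRD; congr expR; ring.
    ring.
  rewrite ler_pM ?mulr_ge0 ?expR_ge0 ?(ltW d_gt0)//; [lra| |].
    by rewrite ler_wpM2l ?mulr_ge0 ?expR_ge0.
  apply: le_trans rd; rewrite ler_wpM2l ?(ltW d_gt0)// expr2 ler_pM//; lra.
have -> : (K0 + 4 * expR (K0 + 2) * K0) / (1 + z) * psi w =
  K0 / (1 + z) * psi w + 4 * expR (K0 + 2) * (K0 / (1 + z)) * psi w by ring.
rewrite mulrBr mulrBl; lra.
Qed.

(** Stein's inequality for [tilted_test]. The expectation of [g psi] on the
    window occurs on both sides and cancels; what is left is the gain [th]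
    against a multiple of [1 / (1 + z)], both times the expectation of [psi]. *)
Lemma tilted_balance :
  k1 / 2 * psi z * E (fun w => (1 + `|g w|) * (z < w)%R%:R)
  + (th - (2 * K0 + 4 * expR (K0 + 2) * K0 + d0 * ((c3 + 1) * expR (K0 + 1) * K0)) / (1 + z))
      * E (fun w => psi w * win w)
  <= 2 * E (fun w => 1 + `|g w|) + 2 * d0 * (A * expR A).
Proof.
have [rd r1 r2 dgz] := rate_parts T L (le_trans ler01 z_ge1) zrate; have /andP[d_gt0 d_le1] := law_d L.
have z1 := z_ge1; have c3' := tg_c3 T; have A1 := tg_A T.
have bI := window_bdd (tilt_der T th).
have bt := test_bdd.
have bs : bdd_on S (tilted_slope g G th z) := window_bdd (dtilt_der T th).
have be : bdd_on S (tilted_error c3 A g G K0 th z d) by rewrite /tilted_error; bdd.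
have := law_stein L bt bs be.
have e0 w : 0 <= tilted_error c3 A g G K0 th z d w.
  have w0 : 0 <= psi w * win w by rewrite mulr_ge0 ?expR_ge0// mulr_ge0.
  have A0 : 0 <= A by lra.
  have c31 : 0 <= c3 + 1 by lra.
  rewrite /tilted_error addr_ge0//; first by rewrite !mulr_ge0 ?expR_ge0.
  by rewrite (mulr_ge0 _ w0)// mulr_ge0 ?(mulr_ge0 (ltW d_gt0)) ?sqr_ge0// mulr_ge0 ?expR_ge0.
move=> /(_ e0 (tilted_test_slope T th0 th1 thg d_gt0 d_le1 zX dgz)).
set m0 := E (fun w => psi w * win w); set m1 := E (fun w => (1 + `|g w|) * _).
have -> : E (tilted_slope g G th z) = E (fun w => g w * (psi w * win w)) - th * m0.
  rewrite -mulNr -(law_Z L)// -(law_D L); [|bdd|bdd].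
  by congr E; apply/funext => w; rewrite /tilted_slope /dtilt; ring.
have -> : E (tilted_error c3 A g G K0 th z d) =
   2 * (A * expR A) + (c3 + 1) * expR (K0 + 1) * (d * (1 + g z) ^+ 2) * m0.
  by rewrite -(law_Z L)// -[X in _ = X + _](law_cst L) -(law_D L); [|bdd|bdd].
have m00 : 0 <= m0.
  by apply: (law_ge0 L) => // w _; rewrite mulr_ge0 ?expR_ge0// mulr_ge0.
have hE : e1 * E (fun w => (1 + `|g w|) `^ tau1 * `|tilted_slope g G th z w|)
    <= K0 / (1 + z) * m0.
  apply: (@le_trans _ _ (e1 * ((1 + g z) `^ (tau1 + 1) * m0))); last first.
    by rewrite mulrA ler_wpM2r.
  rewrite ler_wpM2l ?(law_e1 L)//; apply: (law_le1 L) => //.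
    apply: bddM; last by bdd.
    by apply: bdd_powR => //; bdd.
  move=> w Sw; rewrite /tilted_slope /dtilt /window.
  have [w0|] := ltP 0 w; last by rewrite mul0r !mulr0 normr0 mulr0.
  have [wz|] := leP w z; last by rewrite !mulr0 normr0 mulr0.
  rewrite !mulr1 normrM [`|psi w|]ger0_norm ?expR_ge0// mulrA ler_wpM2r ?expR_ge0//.
  have gw0 := g_ge0 T (ltW w0); have gwz := tg_mono T wz; have t0 := th0; have t1 := th1.
  rewrite powRD ?powRr1; [|lra|by apply/implyP => _; apply/negP=> /eqP; lra].
  rewrite (ger0_norm gw0) ler_pM ?powR_ge0//.
    by apply: ge0_ler_powR; rewrite ?nnegrE ?tau1_ge0//; lra.
  by rewrite ler_norml; lra.
have lowE : E (fun w => g w * (psi w * win w)) + (k1 / 2 * psi z * m1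
    - ((K0 + 4 * expR (K0 + 2) * K0) / (1 + z) * m0 + 2 * E (fun w => 1 + `|g w|)))
  <= E (fun w => (g w - r w) * tilted_test g G th z d w).
  have bIg : bdd_on S (fun w => g w * (psi w * win w)) by bdd.
  have bI1 : bdd_on S (fun w => (1 + `|g w|) * (z < w)%R%:R) by bdd.
  have bIu : bdd_on S (fun w => 1 + `|g w|) by bdd.
  have bX : bdd_on S (fun w => (g w - r w) * tilted_test g G th z d w) by bdd.
  have := law_ge4 L (a1 := 1) (a2 := k1 / 2 * psi z) (a4 := -2)
    (a3 := - ((K0 + 4 * expR (K0 + 2) * K0) / (1 + z))) bIg bI1 bI bIu bX.
  rewrite mul1r !mulNr -opprD; apply => w Sw.
  by rewrite mul1r !mulNr -opprD; exact: tilted_test_lower.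
set X := E (fun w => g w * (psi w * win w)) in lowE *.
set Y := E (fun w => (g w - r w) * _) in lowE *.
move=> st; have dE : d0 * ((c3 + 1) * expR (K0 + 1) * (d * (1 + g z) ^+ 2) * m0) <=
    d0 * ((c3 + 1) * expR (K0 + 1) * K0) / (1 + z) * m0.
  have -> : d0 * ((c3 + 1) * expR (K0 + 1) * K0) / (1 + z) * m0 =
    d0 * ((c3 + 1) * expR (K0 + 1) * (K0 / (1 + z)) * m0) by ring.
  have d01 := d0_ge1; rewrite ler_wpM2l ?ler_wpM2r// ?ler_wpM2l ?mulr_ge0 ?expR_ge0//; lra.
move: st lowE hE dE; set W := E (fun w => (1 + `|g w|) `^ _ * _); set U := E _.
set V := (1 + z)^-1.
lra.
Qed.

End KeyLarge.

(** * Exponential moments below the level and drift above it *)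

(** A number of unit shifts that depends on [x0] only leads from 0 to [x],
    whence a bound for [g], and then [G x <= x * g x]. *)
Lemma target_bounded (R : realType) (c1 c3 A x0 : R) : exists2 C, 1 <= C &
  forall g dg G F, stein_target c1 c3 A g dg G F ->
  forall x, 0 <= x -> x <= x0 -> 1 + g x <= C /\ expR (G x) <= C.
Proof.
pose n := Num.bound x0; pose M := Num.max 1 (A ^+ n).
exists (expR (n%:R * M) + M).
  have : 1 <= M by rewrite le_max lexx.
  have := expR_ge0 (n%:R * M); lra.
move=> g dg G F T x xge0 xx0.
have xn : x <= n%:R.
  by rewrite (le_trans xx0)// ltW// /n archi_boundP// (le_trans xge0).
have gM : 1 + g x <= M by rewrite le_max (shift_bound T xge0 xn) orbT.
split; first by have := expR_ge0 (n%:R * M); lra.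
have GM : G x <= n%:R * M.
  have := G_convex T 0 x; rewrite (tG_0 T) !subr0 => /le_trans; apply.
  rewrite mulrC ler_pM//; [exact: (g_ge0 T)|lra].
have := expR_ge0 (n%:R * M); rewrite -ler_expR in GM.
have : 1 <= M by rewrite le_max lexx.
lra.
Qed.

Section KeyBounds.
Variables (R : realType) (c1 c3 A d0 alpha tau1 tau2 K0 : R).
Hypotheses (c1_gt0 : 0 < c1) (c3_ge0 : 0 <= c3) (A_ge1 : 1 <= A).
Hypotheses (d0_ge1 : 1 <= d0) (tau1_ge0 : 0 <= tau1) (tau2_ge0 : 0 <= tau2).
Hypotheses (alpha_ge0 : 0 <= alpha) (alpha_lt1 : alpha < 1) (K0_ge0 : 0 <= K0).

(** Where [g w >= 2 alpha / (1 - alpha)], the bound [alpha (g + 1)] on the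
    remainder suffices. Elsewhere [g w] is bounded and the remainder is at
    most a multiple of [e2], which is small since [z] is large, whereas [g w]
    is bounded below by [g_lower]. *)
Lemma drift_tail g dg G F d e1 e2 S r E z :
  stein_target c1 c3 A g dg G F ->
  stein_law d0 alpha tau1 tau2 g d e1 e2 S r E ->
  growth_point c1 <= z -> e2 * (1 + g z) `^ tau2 <= K0 / (1 + z) ->
  2 * growth_point c1 * K0 * (1 + 2 * alpha / (1 - alpha)) `^ tau2 <= 1 + z ->
  forall w, S w -> z < w ->
    (1 - alpha) / 2 / (1 + growth_point c1) * (1 + g w) <= g w - r w.
Proof.
move=> T L zX r2 zB w Sw zw; have X0 := growth_point_gt0 T.
have a0 := alpha_ge0; have a1 := alpha_lt1.
have z0 : 0 <= z by lra.
have gw : (growth_point c1)^-1 <= g w by apply: (g_lower T); lra.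
set X := growth_point c1 in zX zB X0 gw *.
have Xi0 : 0 < X^-1 by rewrite invr_gt0.
have gw0 : 0 < g w by lra.
have gwz : g z <= g w by apply: (tg_mono T); exact: ltW.
have gz0 := g_ge0 T z0.
have Xg : 1 + g w <= (1 + X) * g w.
  have : X * X^-1 <= X * g w by rewrite ler_wpM2l// ltW.
  by rewrite divff ?gt_eqF//; lra.
have low : (1 - alpha) / 2 / (1 + X) * (1 + g w) <= (1 - alpha) / 2 * g w.
  rewrite -mulrA ler_wpM2l//; first by lra.
  by rewrite mulrC ler_pdivrMr ?[g w * _]mulrC//; lra.
apply: le_trans low _; have := ler_norm (r w) => rr.
have [gB|gB] := leP (2 * alpha / (1 - alpha)) (g w).
  have := law_ra L Sw; rewrite (gtr0_norm gw0) => ra.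
  rewrite ler_pdivrMr in gB; last lra.
  nra.
have : `|r w| <= X^-1 / 2.
  apply: le_trans (law_r2 L Sw) _.
  set B := 1 + 2 * alpha / (1 - alpha) in zB.
  have B1 : 1 <= B.
    have : 0 <= 2 * alpha / (1 - alpha) by rewrite divr_ge0//; lra.
    by rewrite /B; lra.
  apply: (@le_trans _ _ (e2 * B `^ tau2)).
    rewrite ler_wpM2l ?(law_e2 L)//; apply: ge0_ler_powR; rewrite ?nnegrE ?tau2_ge0//; last first.
      by rewrite (gtr0_norm gw0) /B; lra.
    lra.
  have e2K : e2 <= K0 / (1 + z).
    apply: le_trans r2; rewrite ler_peMr ?(law_e2 L)//.
    by rewrite -[X in X <= _](powRr0 (1 + g z)) ler_powR//; lra.
  apply: (@le_trans _ _ (K0 / (1 + z) * B `^ tau2)); first by rewrite ler_wpM2r// powR_ge0.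
  have z1 : 0 < 1 + z by lra.
  have -> : K0 / (1 + z) * B `^ tau2 = (K0 * B `^ tau2) / (1 + z) by ring.
  rewrite ler_pdivrMr//.
  have -> : X^-1 / 2 * (1 + z) = (1 + z) / (2 * X) by field; rewrite gt_eqF.
  have X20 : 0 < 2 * X by lra.
  rewrite ler_pdivlMr//.
  by have -> : K0 * B `^ tau2 * (2 * X) = 2 * X * K0 * B `^ tau2 by ring.
have : 0 <= alpha * g w by rewrite mulr_ge0// ltW.
lra.
Qed.

Lemma expG_bdd g dg G F S z : stein_target c1 c3 A g dg G F -> 0 <= z ->
  bdd_on S (fun w => expR (G (Num.max w 0)) * (w <= z)%R%:R) /\
  forall w, expR (G (Num.max w 0)) * (w <= z)%R%:R <= expR (G z).
Proof.
move=> T z0.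
have le w : expR (G (Num.max w 0)) * (w <= z)%R%:R <= expR (G z).
  have [wz|] := leP w z; last by rewrite mulr0 expR_ge0.
  by rewrite mulr1 ler_expR (G_mono T)// ?le_max ?lexx ?orbT// ge_max wz.
split=> //; split; last first.
  by exists (expR (G z)) => w _; rewrite ger0_norm// mulr_ge0 ?expR_ge0.
apply: measurable_funM; last by case: (bdd_le S z).
apply: measurableT_comp => //; apply: measurableT_comp; first exact: measurable_of_derivative (tG_der T).
by apply: measurable_maxr.
Qed.

(** As [th * z <= K], removing the tilt costs a factor [expR K]. *)
Lemma untilt g dg G F d e1 e2 S r E (z K k1 C1 : R) :
  stein_target c1 c3 A g dg G F ->
  stein_law d0 alpha tau1 tau2 g d e1 e2 S r E ->
  growth_point c1 + 1 <= z -> 0 <= K -> 0 < k1 ->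
  let th := K / (1 + z) in
  k1 / 2 * tilt G th z * E (fun w => (1 + `|g w|) * (z < w)%R%:R)
    + (1 + z)^-1 * E (fun w => tilt G th w * window z w) <= C1 ->
  E (fun w => expR (G (Num.max w 0)) * (w <= z)%R%:R) <= 1 + expR K * (C1 * (1 + z)) /\
  E (fun w => (1 + `|g w|) * (z < w)%R%:R) <= 2 * C1 / k1 * expR K * expR (- G z).
Proof.
move=> T L zX K_ge0 k1_gt0; have X0 := growth_point_gt0 T.
have z0 : 0 <= z by lra.
have z1 : 0 < 1 + z by lra.
set th := K / (1 + z) => /=.
have th0 : 0 <= th by rewrite divr_ge0// ltW.
have thz x : x <= z -> th * x <= K.
  move=> xz; apply: (@le_trans _ _ (th * z)); first by rewrite ler_wpM2l.
  by rewrite /th -mulrA ler_piMr// ler_pdivrMl// mulr1; lra.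
have bI1 : bdd_on S (fun w => (1 + `|g w|) * (z < w)%R%:R) by bdd.
have bwin : bdd_on S (fun w => tilt G th w * window z w).
  exact: (window_bdd S T zX (tilt_der T th)).
have [bG _] := expG_bdd S T z0.
move: th thz th0 bwin => th thz _ bwin.
have m10 : 0 <= E (fun w => (1 + `|g w|) * (z < w)%R%:R).
  by apply: (law_ge0 L) => // w _; rewrite mulr_ge0// addr_ge0.
have m00 : 0 <= E (fun w => tilt G th w * window z w).
  by apply: (law_ge0 L) => // w _; rewrite mulr_ge0 ?expR_ge0// mulr_ge0.
have eE : E (fun w => expR (G (Num.max w 0)) * (w <= z)%R%:R) <=
    1 + expR K * E (fun w => tilt G th w * window z w).
  rewrite -[X in X + _](law_cst L) -[X in X + _]mul1r.
  apply: (law_le2 L) => //; first by bdd.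
  move=> w _; rewrite mulr1 /window.
  have [w0|w0] := leP w 0.
    rewrite (tG_0 T) expR0 mul0r !mulr0 addr0 mul1r.
    by case: (w <= z).
  have [wz|zw] := leP w z; last by rewrite !mulr0 addr0.
  rewrite !mulr1 /tilt -expRD -[leLHS]add0r lerD// ler_expR.
  by have := thz _ wz; lra.
have tz : expR (G z) <= expR K * tilt G th z.
  by rewrite -expRD ler_expR; have := thz _ (lexx z); lra.
move: eE m10 m00; set m1 := E (fun w => (1 + _) * _); set m0 := E (fun w => _ * window _ _).
move=> eE m10 m00 bal.
have p1 : 0 <= k1 / 2 * tilt G th z * m1.
  by rewrite mulr_ge0// mulr_ge0 ?expR_ge0// divr_ge0// ltW.
have p0 : 0 <= (1 + z)^-1 * m0 by rewrite mulr_ge0// invr_ge0 ltW.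
have m0C : m0 <= C1 * (1 + z) by rewrite -ler_pdivrMr// mulrC; lra.
have m1C : k1 / 2 * tilt G th z * m1 <= C1 by lra.
split.
  by apply: (le_trans eE); rewrite lerD2l ler_wpM2l ?expR_ge0.
rewrite expRN ler_pdivlMr ?expR_gt0//.
apply: (@le_trans _ _ (m1 * (expR K * tilt G th z))); first by rewrite ler_wpM2l.
have -> : m1 * (expR K * tilt G th z) = (k1 / 2 * tilt G th z * m1) * (2 / k1 * expR K).
  by field; rewrite gt_eqF.
have -> : 2 * C1 / k1 * expR K = C1 * (2 / k1 * expR K) by ring.
by rewrite ler_wpM2r// mulr_ge0 ?expR_ge0// divr_ge0// ltW.
Qed.

Lemma kink_cond (d e k1 z gz : R) : 0 < k1 -> 0 <= z -> 0 <= e -> 0 < d -> 0 <= gz ->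
  d * (1 + gz) ^+ 2 <= K0 / (1 + z) -> 8 * e * K0 / k1 <= 1 + z ->
  4 * d * e * gz <= k1 / 2.
Proof.
move=> k1_gt0 z0 e0 d_gt0 gz0 rd.
rewrite ler_pdivrMr// => Q.
have z1 : 0 < 1 + z by lra.
have h1 : d * gz <= K0 / (1 + z).
  by apply: le_trans rd; rewrite ler_wpM2l ?(ltW d_gt0)//; nra.
have -> : 4 * d * e * gz = 4 * e * (d * gz) by ring.
apply: (@le_trans _ _ (4 * e * (K0 / (1 + z)))); first by rewrite ler_wpM2l// mulr_ge0.
by rewrite mulrA ler_pdivrMr//; lra.
Qed.

(** Beyond a threshold that depends on the constants only, [tilted_balance]
    applies with [th = (K1 + 1) / (1 + z)] and leaves [1 / (1 + z)] times the
    expectation of [psi]. Below the threshold [G] is bounded. *)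
Lemma key_bounds : exists2 C, 0 <= C &
  forall g dg G F d e1 e2 S r E,
  stein_target c1 c3 A g dg G F ->
  stein_law d0 alpha tau1 tau2 g d e1 e2 S r E ->
  forall z, 0 <= z -> (1 + z) * rate tau1 tau2 d e1 e2 g z <= K0 ->
  E (fun w => expR (G (Num.max w 0)) * (w <= z)%R%:R) <= C * (1 + z) /\
  E (fun w => (1 + `|g w|) * (z < w)%R%:R) <= C * expR (- G z).
Proof.
have d01 := d0_ge1; have K00 := K0_ge0; have c30 := c3_ge0; have A1 := A_ge1.
have [M M0 HM] := moment_bound c1 c3 A tau1 tau2 d0_ge1 alpha_ge0 alpha_lt1 1.
have [X XE] : exists X, X = growth_point c1 by exists (growth_point c1).
have X0 : 0 < X by rewrite XE divr_gt0 ?expR_gt0.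
have [k1 k1E] : exists k1, k1 = (1 - alpha) / 2 / (1 + X) by eexists.
have k10 : 0 < k1 by rewrite k1E !divr_gt0 ?subr_gt0// addr_gt0.
have [K1 K1E] : exists K1, K1 =
  2 * K0 + 4 * expR (K0 + 2) * K0 + d0 * ((c3 + 1) * expR (K0 + 1) * K0) by eexists.
have K10 : 0 <= K1 by rewrite K1E !addr_ge0 ?mulr_ge0 ?expR_ge0//; lra.
have K1' : 0 <= K1 + 1 by lra.
have [B BE] : exists B, B = 2 * X * K0 * (1 + 2 * alpha / (1 - alpha)) `^ tau2 by eexists.
have B0 : 0 <= B by rewrite BE !mulr_ge0 ?powR_ge0 ?(ltW X0).
have [Q QE] : exists Q, Q = 8 * expR 1 * K0 / k1 by eexists.
have Q0 : 0 <= Q by rewrite QE divr_ge0 ?(ltW k10) ?mulr_ge0 ?expR_ge0.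
have KX0 : 0 <= (K1 + 1) * X by rewrite mulr_ge0 ?(ltW X0).
(* The summands of the threshold ensure in turn [growth_point + 1 <= z],
   [th <= 1], [th <= 1 / X], the smallness of the ramp and the drift. *)
have [C0 C01 HC0] := target_bounded c1 c3 A (X + 1 + (K1 + 1) + (K1 + 1) * X + Q + B).
have [C1 C1E] : exists C1, C1 = 2 * M + 2 * d0 * (A * expR A) by eexists.
have C10 : 0 <= C1 by rewrite C1E addr_ge0 ?mulr_ge0 ?expR_ge0//; lra.
have [q1 q1E] : exists q1, q1 = expR (K1 + 1) * C1 by eexists.
have [q2 q2E] : exists q2, q2 = 2 * C1 / k1 * expR (K1 + 1) by eexists.
have q10 : 0 <= q1 by rewrite q1E mulr_ge0 ?expR_ge0.
have q20 : 0 <= q2 by rewrite q2E mulr_ge0 ?expR_ge0// divr_ge0 ?(ltW k10) ?mulr_ge0.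
have C0M : C0 <= C0 * (1 + M) /\ M * C0 <= C0 * (1 + M) by split; nra.
exists (q1 + 1 + q2 + C0 * (1 + M)); first by rewrite !addr_ge0 ?mulr_ge0//; lra.
move=> g dg G F d e1 e2 S r E T L z zge0 zr.
have HM1 := HM _ _ _ _ _ _ _ _ _ _ T L.
have [bG leG] := expG_bdd S T zge0.
have eG := expR_gt0 (- G z).
case: C0M => C0M C0M'.
have [zz0|z0z] := leP z (X + 1 + (K1 + 1) + (K1 + 1) * X + Q + B).
  have [gC GC] := HC0 _ _ _ _ T z zge0 zz0.
  split.
    apply: (@le_trans _ _ (E (fun => C0))).
      by apply: (law_le L) => // [|w _]; [bdd|exact: le_trans (leG w) GC].
    by rewrite (law_cst L); nra.
  apply: (@le_trans _ _ M).
    apply: le_trans HM1; apply: (law_le L) => //; [by bdd|by bdd|] => w _.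
    by rewrite expr1 ler_piMr ?addr_ge0//; case: (z < w).
  rewrite expRN ler_pdivlMr ?expR_gt0//.
  apply: (@le_trans _ _ (M * C0)); first by rewrite ler_wpM2l.
  by lra.
have zX : growth_point c1 + 1 <= z by lra.
have z1 : 0 < 1 + z by lra.
have th0 : 0 <= (K1 + 1) / (1 + z) by rewrite divr_ge0// ltW.
have th1 : (K1 + 1) / (1 + z) <= 1.
  by rewrite ler_pdivrMr// mul1r; lra.
have thg : (K1 + 1) / (1 + z) <= (growth_point c1)^-1.
  by rewrite -XE ler_pdivrMr// mulrC ler_pdivlMr//; lra.
have [rd r1 r2 dgz] := rate_parts T L zge0 zr.
have [d_gt0 d_le1] := andP (law_d L).
have kink : 4 * d * expR 1 * g z <= k1 / 2.
  apply: kink_cond rd _ => //; rewrite ?expR_ge0 ?(g_ge0 T)// -QE.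
  by lra.
have zX' : growth_point c1 <= z by lra.
have dr : forall w, S w -> z < w -> k1 * (1 + g w) <= g w - r w.
  rewrite k1E XE; apply: (drift_tail T L zX' r2); rewrite -XE -BE.
  by lra.
have := tilted_balance T L d0_ge1 tau1_ge0 tau2_ge0 alpha_lt1 th0 th1 thg zX zr kink dr.
have HM1' : E (fun w => 1 + `|g w|) <= M.
  by apply: le_trans HM1; apply: (law_le L); [bdd|bdd|] => w _; rewrite expr1.
rewrite -K1E; have -> : (K1 + 1) / (1 + z) - K1 / (1 + z) = (1 + z)^-1 by ring.
move=> bal; have := untilt T L zX K1' k10 (C1 := C1) (le_trans bal _).
case; first by rewrite C1E; lra.
move=> h0 h1; split.
  apply: le_trans h0 _; rewrite mulrA -q1E; have := mulr_ge0 (ltW eG) q10.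
  by nra.
by apply: le_trans h1 _; rewrite -q2E; nra.
Qed.

End KeyBounds.

(** * Power moments of the tail *)

Section TailStep.
Variables (R : realType) (c1 c3 A d0 alpha tau1 tau2 : R).
Variables (g dg G F : R -> R) (d e1 e2 : R) (S : set R) (r : R -> R).
Variables (E : (R -> R) -> R) (z : R).
Hypothesis T : stein_target c1 c3 A g dg G F.
Hypothesis L : stein_law d0 alpha tau1 tau2 g d e1 e2 S r E.
Hypotheses (alpha_lt1 : alpha < 1) (alpha_ge0 : 0 <= alpha) (z0 : 0 <= z).

Lemma law_shift w c : `|c - w| <= d -> 1 + `|g c| <= A * (1 + `|g w|).
Proof.
move=> cw; have -> : c = w + (c - w) by ring.
by apply: (tg_shift T); have /andP[_ dl1] := law_d L; apply: le_trans dl1.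
Qed.

(** Between [z - d] and [z] the weight [exp (G (max (w, 0)))] is comparable to
    [exp (G z)], so the mass there is controlled by the exponential moment
    below [z]. *)
Lemma slab_bound k K0 : d * g z <= K0 ->
  E (fun w => (1 + `|g w|) ^+ k * (z - d < w)%R%:R) <=
  E (fun w => (1 + `|g w|) ^+ k * (z < w)%R%:R) +
  (A * (1 + g z)) ^+ k * expR K0 * expR (- G z) *
    E (fun w => expR (G (Num.max w 0)) * (w <= z)%R%:R).
Proof.
move=> dgz; have [bG _] := expG_bdd S T z0; have gz0 := g_ge0 T z0.
have /andP[d_gt0 d_le1] := law_d L.
rewrite -[X in _ <= X + _]mul1r; apply: (law_le2 L) => //; [by bdd|by bdd|] => w Sw.
rewrite mul1r; have A1 := tg_A T.
have c0 : 0 <= (A * (1 + g z)) ^+ k * expR K0 * expR (- G z).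
  by rewrite !mulr_ge0 ?expR_ge0// exprn_ge0// mulr_ge0//; lra.
have [zw|wz] := ltP z w.
  by rewrite !mulr1 mulr0 mulr0 addr0 ler_piMr ?exprn_ge0 ?addr_ge0//; case: (z - d < w).
rewrite mulr0 add0r mulr1.
have [zdw|] := ltP (z - d) w; last by rewrite mulr0 mulr_ge0 ?expR_ge0.
rewrite mulr1 -!mulrA.
have h : (1 + `|g w|) ^+ k <= (A * (1 + g z)) ^+ k.
  rewrite lerXn2r ?nnegrE ?addr_ge0 ?mulr_ge0 ?addr_ge0//; first lra.
  by rewrite -{1}(ger0_norm gz0); apply: law_shift; rewrite ler_norml; lra.
apply: (le_trans h); rewrite ler_peMr ?exprn_ge0 ?mulr_ge0 ?addr_ge0//; first lra.
rewrite -!expRD -expR0 ler_expR.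
have zw : `|z - w| <= d by rewrite ler_norml; lra.
have := G_pos_shift T z0 zw (lexx z); rewrite (max_idPl z0); lra.
Qed.

(** The test function [(1 + g (max (w, z))) ^+ k - (1 + g z) ^+ k] vanishes left
    of [z], so only the part beyond [z - d] of the error counts, and multiplying
    it by [g - r] raises the exponent by one beyond [z]. *)
Lemma tail_step k :
  (1 - alpha) * E (fun w => (1 + `|g w|) ^+ k.+1 * (z < w)%R%:R) <=
  d0 * (k%:R * c3 * A ^+ k * E (fun w => (1 + `|g w|) ^+ k * (z - d < w)%R%:R))
  + ((1 - alpha) * (1 + g z) ^+ k * E (fun w => (1 + `|g w|) * (z < w)%R%:R)
     + E (fun w => (1 + `|g w|) ^+ k * (z < w)%R%:R)).
Proof.
have /andP[d_gt0 d_le1] := law_d L; have gz0 := g_ge0 T z0.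
have A1 := tg_A T; have c3' := tg_c3 T; have a0 := alpha_ge0; have a1 := alpha_lt1.
pose f w := (1 + g (Num.max w z)) ^+ k - (1 + g z) ^+ k.
have mz w : z <= Num.max w z by rewrite le_max lexx orbT.
have bm : bdd_on S (fun w => g (Num.max w z)).
  split.
    apply: measurableT_comp; first exact: measurable_of_derivative (tg_der T).
    by apply: measurable_maxr.
  have [_ [M gM]] := law_g L; exists (M + g z) => w Sw.
  have := gM _ Sw; have := normr_ge0 (g w); have [wz|zw] := leP w z => g0 gM'.
    by rewrite ger0_norm//; lra.
  lra.
have bf : bdd_on S f by rewrite /f; bdd.
pose rho w := k%:R * c3 * A ^+ k * ((1 + `|g w|) ^+ k * (z - d < w)%R%:R).
have brho : bdd_on S rho by rewrite /rho; bdd.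
have kc : 0 <= k%:R * c3 * A ^+ k by rewrite !mulr_ge0 ?exprn_ge0//; lra.
have rho0 w : 0 <= rho w by rewrite /rho mulr_ge0// mulr_ge0// exprn_ge0// addr_ge0.
have lip w w' : `|w - w'| <= d -> `|f w - f w'| <= rho w * `|w - w'|.
  move=> ww; have ww2 : - d <= w - w' <= d by rewrite -ler_norml.
  have -> : f w - f w' = (1 + g (Num.max w z)) ^+ k - (1 + g (Num.max w' z)) ^+ k.
    by rewrite /f; ring.
  rewrite /rho; have [zw|wz] := ltP (z - d) w; last first.
    have -> : Num.max w z = z by apply/max_idPr; lra.
    have -> : Num.max w' z = z by apply/max_idPr; lra.
    by rewrite subrr normr0 mulr_ge0// mulr0 mulr0.
  have dg1 (x : R) : is_derive x 1 (fun y => 1 + g y) (dg x).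
    have dgx := tg_der T x.
    by rewrite -[dg x]add0r; exact: (is_deriveD (is_derive_cst (1 : R) x 1) dgx).
  have := @pow_lipschitz R (fun y => 1 + g y) dg k (Num.max w z) (Num.max w' z)
    (A * (1 + `|g w|)) c3 dg1 c3'.
  set a := Num.max w z; set b := Num.max w' z => pl.
  have ab : `|a - b| <= `|w - w'|.
    exact: max_dist.
  apply: le_trans (pl _) _ => [c cab|]; last first.
    have -> : k%:R * c3 * (A * (1 + `|g w|)) ^+ k =
      k%:R * c3 * A ^+ k * ((1 + `|g w|) ^+ k * true%:R) by rewrite exprMn /=; ring.
    by rewrite ler_wpM2l// mulr_ge0// mulr_ge0// exprn_ge0// addr_ge0.
  have cw : `|c - w| <= d.
    have aw : w - d <= a <= w + d by rewrite /a; have [h1|h1] := leP w z; lra.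
    have bw : w - d <= b <= w + d by rewrite /b; have [h1|h1] := leP w' z; lra.
    case/andP: aw => aw1 aw2; case/andP: bw => bw1 bw2.
    by rewrite ler_distl (between_ge cab aw1 bw1) (between_le cab aw2 bw2).
  have gc := law_shift cw.
  split; first by apply: le_trans gc; rewrite (le_trans (ler_normD _ _))// normr1.
  by rewrite (le_trans (tg_dg T c))// ler_wpM2l.
have st := law_stein_lip L bf brho rho0 lip.
have -> : d0 * (k%:R * c3 * A ^+ k * E (fun w => (1 + `|g w|) ^+ k * (z - d < w)%R%:R)) = d0 * E rho.
  by rewrite -(law_Z L)//; bdd.
rewrite -lerBlDr; apply: le_trans st.
have bX : bdd_on S (fun w => (g w - r w) * f w) by bdd.
have b1 : bdd_on S (fun w => (1 + `|g w|) ^+ k.+1 * (z < w)%R%:R) by bdd.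
have b2 : bdd_on S (fun w => (1 + `|g w|) * (z < w)%R%:R) by bdd.
have b3 : bdd_on S (fun w => (1 + `|g w|) ^+ k * (z < w)%R%:R) by bdd.
suff pt w : S w -> (1 - alpha) * ((1 + `|g w|) ^+ k.+1 * (z < w)%R%:R) +
    (- ((1 - alpha) * (1 + g z) ^+ k) * ((1 + `|g w|) * (z < w)%R%:R) +
    (-1 * ((1 + `|g w|) ^+ k * (z < w)%R%:R) + 0 * 0)) <= (g w - r w) * f w.
  have := law_ge4 L b1 b2 b3 (bdd_cst S 0) bX pt.
  by rewrite mul0r addr0 mulN1r mulNr -opprD.
move=> Sw; rewrite mul0r addr0 mulN1r mulNr -opprD /f.
have [wz|zw] := leP w z; first by rewrite subrr !mulr0 !addr0.
have gzw : g z <= g w by apply: (tg_mono T); exact: ltW.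
have gw0 : 0 <= g w by lra.
have ra := law_ra L Sw; rewrite (ger0_norm gw0) in ra *; have rn := ler_norm (r w).
rewrite !mulr1.
have p0 : 0 <= (1 + g z) ^+ k by rewrite exprn_ge0// addr_ge0.
have pk : (1 + g z) ^+ k <= (1 + g w) ^+ k by rewrite lerXn2r ?nnegrE//; lra.
rewrite exprS; set P := (1 + g w) ^+ k in pk *; set Q := (1 + g z) ^+ k in p0 pk *.
have : ((1 - alpha) * (1 + g w) - 1) * (P - Q) <= (g w - r w) * (P - Q).
  by rewrite ler_wpM2r//; lra.
lra.
Qed.

End TailStep.

Section TailBounds.
Variables (R : realType) (c1 c3 A d0 alpha tau1 tau2 K0 : R).
Hypotheses (c1_gt0 : 0 < c1) (c3_ge0 : 0 <= c3) (A_ge1 : 1 <= A).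
Hypotheses (d0_ge1 : 1 <= d0) (tau1_ge0 : 0 <= tau1) (tau2_ge0 : 0 <= tau2).
Hypotheses (alpha_ge0 : 0 <= alpha) (alpha_lt1 : alpha < 1) (K0_ge0 : 0 <= K0).

(** Induction on [k] with [tail_step]; [slab_bound] moves the threshold back
    from [z - d] to [z]. *)
Lemma tail_moment k : exists2 C, 0 <= C &
  forall g dg G F d e1 e2 S r E,
  stein_target c1 c3 A g dg G F ->
  stein_law d0 alpha tau1 tau2 g d e1 e2 S r E ->
  forall z, 0 <= z -> (1 + z) * rate tau1 tau2 d e1 e2 g z <= K0 ->
  E (fun w => (1 + `|g w|) ^+ k.+1 * (z < w)%R%:R) <=
    C * ((1 + z) * (1 + g z) ^+ k.+1 * expR (- G z)).
Proof.
have [C C0 HC] := key_bounds c1_gt0 c3_ge0 A_ge1 d0_ge1 tau1_ge0 tau2_ge0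
  alpha_ge0 alpha_lt1 K0_ge0.
have a1 : 0 < 1 - alpha by rewrite subr_gt0.
have A0 : 0 <= A by rewrite (le_trans ler01).
have d00 : 0 <= d0 by rewrite (le_trans ler01).
elim: k => [|k [D D0 HD]].
  exists C => // g dg G F d e1 e2 S r E T L z z0 zr.
  have [_ h] := HC _ _ _ _ _ _ _ _ _ _ T L z z0 zr.
  apply: (le_trans h); rewrite ler_wpM2l// ler_peMl ?expR_ge0//.
  rewrite expr1; have := g_ge0 T z0; nra.
have [q qE] : exists q, q = k.+1%:R * c3 * A ^+ k.+1 by eexists.
have q0 : 0 <= q by rewrite qE !mulr_ge0 ?exprn_ge0.
have [e eE] : exists e, e = A ^+ k.+1 * expR K0 * C by eexists.
have e0 : 0 <= e by rewrite eE !mulr_ge0 ?expR_ge0// exprn_ge0.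
exists ((d0 * (q * (D + e)) + (1 - alpha) * C + D) / (1 - alpha)).
  by rewrite divr_ge0 ?(ltW a1)// addr_ge0// addr_ge0 ?mulr_ge0 ?(ltW a1)// addr_ge0.
move=> g dg G F d e1 e2 S r E T L z z0 zr.
have [h0 h1] := HC _ _ _ _ _ _ _ _ _ _ T L z z0 zr.
have h2 := HD _ _ _ _ _ _ _ _ _ _ T L z z0 zr.
have [_ _ _ dgz] := rate_parts T L z0 zr.
have h3 := slab_bound T L z0 k.+1 dgz.
have h4 := tail_step T L alpha_lt1 alpha_ge0 z0 k.+1.
have gz0 := g_ge0 T z0.
rewrite mulrAC ler_pdivlMr// [leLHS]mulrC; apply: (le_trans h4).
rewrite -qE; have x0 := expR_ge0 (- G z).
have p0 : 0 <= (1 + g z) ^+ k.+1 by rewrite exprn_ge0// addr_ge0.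
have [U UE] : exists U, U = (1 + z) * (1 + g z) ^+ k.+1 * expR (- G z) by eexists.
have U0 : 0 <= U by rewrite UE !mulr_ge0 ?addr_ge0.
have UV : U <= (1 + z) * (1 + g z) ^+ k.+2 * expR (- G z).
  rewrite UE ler_wpM2r// ler_wpM2l ?addr_ge0// [_ ^+ k.+2]exprS ler_peMl//; lra.
rewrite -UE in h2.
have {}h3 : E (fun w => (1 + `|g w|) ^+ k.+1 * (z - d < w)%R%:R) <= (D + e) * U.
  apply: (le_trans h3); rewrite mulrDl lerD//.
  apply: (@le_trans _ _ ((A * (1 + g z)) ^+ k.+1 * expR K0 * expR (- G z) * (C * (1 + z)))).
    by rewrite ler_wpM2l// !mulr_ge0 ?expR_ge0// exprn_ge0// mulr_ge0// addr_ge0.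
  by rewrite exprMn eE UE le_eqVlt; apply/orP; left; apply/eqP; ring.
have {}h1 : (1 + g z) ^+ k.+1 * E (fun w => (1 + `|g w|) * (z < w)%R%:R) <= C * U.
  apply: (@le_trans _ _ ((1 + g z) ^+ k.+1 * (C * expR (- G z)))); first by rewrite ler_wpM2l.
  have -> : C * U = (1 + z) * ((1 + g z) ^+ k.+1 * (C * expR (- G z))) by rewrite UE; ring.
  by rewrite ler_peMl ?mulr_ge0//; lra.
have c0 : 0 <= d0 * (q * (D + e)) + (1 - alpha) * C + D.
  by rewrite addr_ge0// addr_ge0 ?mulr_ge0 ?(ltW a1)// addr_ge0.
apply: (@le_trans _ _ ((d0 * (q * (D + e)) + (1 - alpha) * C + D) * U)); last by rewrite ler_wpM2l.
have -> : (d0 * (q * (D + e)) + (1 - alpha) * C + D) * U =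
  d0 * (q * ((D + e) * U)) + ((1 - alpha) * (C * U) + D * U) by ring.
apply: lerD; first by rewrite ler_wpM2l// ler_wpM2l.
by apply: lerD => //; rewrite -mulrA ler_wpM2l// ltW.
Qed.

(** On the window [g] is at most [g z] and [key_bounds] applies; on the
    negative half-line the exponential is 1 and a moment of [g(W)] suffices. *)
Lemma weighted_left a : 0 <= a -> exists2 C, 0 <= C &
  forall g dg G F d e1 e2 S r E,
  stein_target c1 c3 A g dg G F ->
  stein_law d0 alpha tau1 tau2 g d e1 e2 S r E ->
  forall z, 0 <= z -> (1 + z) * rate tau1 tau2 d e1 e2 g z <= K0 ->
  E (fun w => (1 + `|g w|) `^ a * (expR (G (Num.max w 0)) * (w <= z)%R%:R)) <=
    C * ((1 + z) * (1 + g z) `^ a).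
Proof.
move=> a0; have [C C0 HC] := key_bounds c1_gt0 c3_ge0 A_ge1 d0_ge1 tau1_ge0 tau2_ge0
  alpha_ge0 alpha_lt1 K0_ge0.
have [M M0 HM] := moment_bound c1 c3 A tau1 tau2 d0_ge1 alpha_ge0 alpha_lt1 (Num.bound a).
exists (M + C); first by rewrite addr_ge0.
move=> g dg G F d e1 e2 S r E T L z z0 zr.
have [h0 _] := HC _ _ _ _ _ _ _ _ _ _ T L z z0 zr.
have h1 := HM _ _ _ _ _ _ _ _ _ _ T L.
have [bG _] := expG_bdd S T z0; have gz0 := g_ge0 T z0.
have bw : bdd_on S (fun w => (1 + `|g w|) `^ a).
  by apply: bdd_powR => //; bdd.
have p1 : 1 <= (1 + g z) `^ a.
  by rewrite -[X in X <= _](powRr0 (1 + g z)) ler_powR//; lra.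
apply: (@le_trans _ _ (1 * E (fun w => (1 + `|g w|) ^+ Num.bound a) + (1 + g z) `^ a *
    E (fun w => expR (G (Num.max w 0)) * (w <= z)%R%:R))).
  apply: (law_le2 L) => //; [by bdd|by bdd|] => w _.
  have [w0|w0] := leP w 0.
    have wz : w <= z := le_trans w0 z0.
    rewrite wz (tG_0 T) expR0 !mulr1 mul1r -[leLHS]addr0 lerD ?powR_ge0//.
    rewrite -powR_mulrn ?addr_ge0// ler_powR//; first by rewrite lerDl.
    by rewrite ltW// archi_boundP.
  rewrite mul1r -[leLHS]add0r lerD ?exprn_ge0 ?addr_ge0//.
  have [wz|] := leP w z; last by rewrite !mulr0.
  rewrite !mulr1 ler_wpM2r ?expR_ge0//.
  have gw0 := g_ge0 T (ltW w0); have gwz := tg_mono T wz.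
  by rewrite (ger0_norm gw0) ge0_ler_powR ?nnegrE//; lra.
rewrite mul1r mulrDl; apply: lerD.
  apply: (le_trans h1); rewrite -[leLHS]mulr1 ler_wpM2l//.
  by rewrite -[leLHS]mul1r ler_pM//; lra.
apply: (@le_trans _ _ ((1 + g z) `^ a * (C * (1 + z)))).
  by rewrite ler_wpM2l// powR_ge0.
by rewrite le_eqVlt; apply/orP; left; apply/eqP; ring.
Qed.

(** A real exponent is reduced to an integer [n] above it:
    [(1 + g z)^(n - a) (1 + g w)^a <= (1 + g w)^n] for [w > z]. *)
Lemma weighted_right a : 0 <= a -> exists2 C, 0 <= C &
  forall g dg G F d e1 e2 S r E,
  stein_target c1 c3 A g dg G F ->
  stein_law d0 alpha tau1 tau2 g d e1 e2 S r E ->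
  forall z, 0 <= z -> (1 + z) * rate tau1 tau2 d e1 e2 g z <= K0 ->
  E (fun w => (1 + `|g w|) `^ a * (z < w)%R%:R) <=
    C * ((1 + z) * (1 + g z) `^ a * expR (- G z)).
Proof.
move=> a0; have [C C0 HC] := tail_moment (Num.bound a).
exists C => // g dg G F d e1 e2 S r E T L z z0 zr.
have h := HC _ _ _ _ _ _ _ _ _ _ T L z z0 zr.
have gz0 := g_ge0 T z0; have g1 : 0 < 1 + g z by rewrite ltr_wpDr.
move: h; set n := (Num.bound a).+1 => h.
have an : a <= n%:R.
  by rewrite /n -natr1 (le_trans (ltW (archi_boundP a0)))// lerDl.
have p0 : 0 < (1 + g z) `^ (n%:R - a) by rewrite powR_gt0.
rewrite -(ler_pM2l p0).
have bw : bdd_on S (fun w => (1 + `|g w|) `^ a).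
  by apply: bdd_powR => //; bdd.
rewrite -(law_Z L); last by bdd.
apply: (@le_trans _ _ (E (fun w => (1 + `|g w|) ^+ n * (z < w)%R%:R))).
  apply: (law_le L); [by bdd|by bdd|] => w _.
  have [wz|zw] := leP w z; first by rewrite !mulr0.
  have gzw : g z <= g w by apply: (tg_mono T); exact: ltW.
  have gw1 : 0 < 1 + `|g w| by rewrite ltr_wpDr.
  rewrite !mulr1 -powR_mulrn ?addr_ge0//.
  apply: (@le_trans _ _ ((1 + `|g w|) `^ (n%:R - a) * (1 + `|g w|) `^ a)).
    rewrite ler_wpM2r ?powR_ge0// ge0_ler_powR ?nnegrE ?subr_ge0 ?addr_ge0//.
    by rewrite lerD2l ger0_norm//; lra.
  by rewrite -powRD ?subrK//; apply/implyP => _; rewrite gt_eqF.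
apply: (le_trans h).
have E1 : (1 + g z) ^+ n = (1 + g z) `^ (n%:R - a) * (1 + g z) `^ a.
  by rewrite -powRD ?subrK ?powR_mulrn ?addr_ge0//; apply/implyP => _; rewrite gt_eqF.
by rewrite E1 le_eqVlt; apply/orP; left; apply/eqP; ring.
Qed.

Lemma slab_right : exists2 C, 0 <= C &
  forall g dg G F d e1 e2 S r E,
  stein_target c1 c3 A g dg G F ->
  stein_law d0 alpha tau1 tau2 g d e1 e2 S r E ->
  forall z, 0 <= z -> (1 + z) * rate tau1 tau2 d e1 e2 g z <= K0 ->
  E (fun w => (1 + `|g w|) * (z - d < w)%R%:R) <=
    C * ((1 + z) * (1 + g z) * expR (- G z)).
Proof.
have [C C0 HC] := key_bounds c1_gt0 c3_ge0 A_ge1 d0_ge1 tau1_ge0 tau2_ge0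
  alpha_ge0 alpha_lt1 K0_ge0.
have A0 : 0 <= A by rewrite (le_trans ler01).
exists (C + A * expR K0 * C); first by rewrite addr_ge0// !mulr_ge0 ?expR_ge0.
move=> g dg G F d e1 e2 S r E T L z z0 zr.
have [h0 h1] := HC _ _ _ _ _ _ _ _ _ _ T L z z0 zr.
have [_ _ _ dgz] := rate_parts T L z0 zr; have gz0 := g_ge0 T z0.
have := slab_bound T L z0 1 dgz; rewrite expr1 => h3.
have bw : bdd_on S (fun w => (1 + `|g w|) * (z - d < w)%R%:R) by bdd.
have bw' : bdd_on S (fun w => (1 + `|g w|) ^+ 1 * (z - d < w)%R%:R) by bdd.
have bw1 : bdd_on S (fun w => (1 + `|g w|) * (z < w)%R%:R) by bdd.
have bw1' : bdd_on S (fun w => (1 + `|g w|) ^+ 1 * (z < w)%R%:R) by bdd.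
have {}h3 : E (fun w => (1 + `|g w|) * (z - d < w)%R%:R) <=
    E (fun w => (1 + `|g w|) * (z < w)%R%:R) + A * (1 + g z) * expR K0 * expR (- G z) * (C * (1 + z)).
  apply: le_trans (le_trans _ h3) _.
    by apply: (law_le L) => // w _; rewrite expr1.
  apply: lerD; first by apply: (law_le L) => // w _; rewrite expr1.
  by rewrite ler_wpM2l// !mulr_ge0 ?expR_ge0// addr_ge0.
apply: (le_trans h3); rewrite mulrDl; apply: lerD.
  apply: (le_trans h1); rewrite ler_wpM2l// ler_peMl ?expR_ge0//.
  nra.
by rewrite le_eqVlt; apply/orP; left; apply/eqP; ring.
Qed.

End TailBounds.

(** * Solution of the Stein equation *)

(** For a pair that straddles [z], [p] and [q] are the parts of [w - w'] before
    and after [z], [x], [y], [k] are variations of the slope along them and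
    [j] is the unit jump of the slope at [z]. *)
Lemma kink_combine (R : realType) (x y k j p q e1 e2 : R) :
  `|x| <= e1 -> `|y| <= e1 -> `|k| <= e2 -> `|j| = 1 -> 0 <= p * q ->
  `|x * p + (k + j + y) * q| <= (e1 + e2 + 1) * `|p + q|.
Proof.
move=> xe ye ke j1 pq.
have -> : `|p + q| = `|p| + `|q|.
  apply/eqP; rewrite eq_le ler_normD /=.
  have [p0|p0] := leP 0 p; have [q0|q0] := leP 0 q.
  - by rewrite !ger0_norm ?addr_ge0.
  - have -> : p = 0 by nra.
    by rewrite normr0 !add0r.
  - have -> : q = 0 by nra.
    by rewrite normr0 !addr0.
  - by rewrite !ltr0_norm//; lra.
have p0 := normr_ge0 p; have q0 := normr_ge0 q.
have e10 : 0 <= e1 := le_trans (normr_ge0 _) xe.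
have e20 : 0 <= e2 := le_trans (normr_ge0 _) ke.
apply: le_trans (ler_normD _ _) _; rewrite !normrM.
have h1 : `|x| * `|p| <= e1 * `|p| by rewrite ler_wpM2r.
have h2 : `|k + j + y| * `|q| <= (e2 + 1 + e1) * `|q|.
  rewrite ler_wpM2r//; apply: le_trans (ler_normD _ _) _; apply: lerD => //.
  by apply: le_trans (ler_normD _ _) _; rewrite j1 lerD2r.
nra.
Qed.

Section SteinSolution.
Variables (R : realType) (c1 c3 A : R) (g dg G F : R -> R).
Variables (K0 z d : R).
Hypothesis T : stein_target c1 c3 A g dg G F.
Hypotheses (z0 : 0 <= z) (d_gt0 : 0 < d) (d_le1 : d <= 1) (dgz : d * g z <= K0).

Local Notation u := (mills_cdf c1 G F).
Local Notation v := (mills_tail c1 G F).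

(** The solution of [f' - g f = 1_(w <= z) - F z]. The factors make its two
    branches agree at [z]. *)
Definition stein_sol (w : R) : R :=
  (1 - F z) * (u w * (w <= z)%R%:R) + F z * (v w * (z < w)%R%:R).
(** The derivative of [stein_sol]; at [z] it is the left one. *)
Definition stein_sol_slope (w : R) : R :=
  g w * stein_sol w + ((w <= z)%R%:R - F z).
(** Lipschitz constants of the slope of [stein_sol], up to the weights that
    occur in [stein_sol_error]. The second summand of [right_lip] serves when
    [w] is beyond [z] and [w'] is not ([left_lip_kink]). *)
Definition left_lip : R := (1 + (1 + c3) / c1) * (A ^+ 2 * expR K0).
Definition right_lip : R := (1 + c3 / c1) * A + left_lip * (1 + c1).
Definition stein_sol_error (w : R) : R :=
  d * (left_lip * (1 - F z)) * ((1 + `|g w|) ^+ 2 * (expR (G (Num.max w 0)) * (w <= z)%R%:R))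
  + d * right_lip * ((1 + `|g w|) * (z - d < w)%R%:R).
(** Its slope 1 is the size of the jump of [stein_sol_slope] at [z]. *)
Definition ramp (w : R) : R := clip (z - d) (z + d) w - (z - d).

Let Qz0 : 0 <= 1 - F z. Proof. by rewrite subr_ge0 (tF_le1 T). Qed.

Let near w c : `|c - w| <= d -> 1 + `|g c| <= A * (1 + `|g w|).
Proof.
move=> cw; have -> : c = w + (c - w) by ring.
by apply: (tg_shift T); apply: le_trans d_le1.
Qed.

Lemma left_slope_lip x y : x <= z -> y <= z -> `|x - y| <= d ->
  `|g x * u x - g y * u y| <=
    d * (left_lip * ((1 + `|g y|) ^+ 2 * expR (G (Num.max y 0)))).
Proof.
move=> xz yz xy; have c30 := tg_c3 T; have c10 := tg_c1 T; have A1 := tg_A T.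
have [c cxy ->] := mvt_between x y (g_mills_cdf_der T).
have cy : `|c - y| <= d.
  by rewrite (le_trans _ xy)// (distrC x); apply: between_dist; rewrite minC maxC.
have cz : c <= z := between_le cxy xz yz.
rewrite normrM mulrC ler_pM//.
apply: le_trans (g_mills_cdf_slope T c) _.
rewrite /left_lip -mulrA ler_wpM2l//.
  by rewrite addr_ge0// divr_ge0 ?(ltW c10)// addr_ge0.
have -> : A ^+ 2 * expR K0 * ((1 + `|g y|) ^+ 2 * expR (G (Num.max y 0))) =
  (A * (1 + `|g y|)) ^+ 2 * (expR K0 * expR (G (Num.max y 0))) by ring.
apply: ler_pM; rewrite ?exprn_ge0 ?addr_ge0 ?expR_ge0//.
  by rewrite lerXn2r ?nnegrE ?addr_ge0 ?mulr_ge0 ?addr_ge0//; [lra|exact: near].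
rewrite -expRD ler_expR.
by have := G_pos_shift T z0 cy cz; have := dgz; lra.
Qed.

Lemma right_slope_lip w x y : z <= x -> z <= y ->
  `|x - y| <= d -> `|x - w| <= d -> `|y - w| <= d ->
  `|g x * v x - g y * v y| <= d * ((1 + c3 / c1) * (A * (1 + `|g w|))).
Proof.
move=> zx zy xy xw yw; have c30 := tg_c3 T; have c10 := tg_c1 T.
have [c cxy ->] := mvt_between x y (g_mills_tail_der T).
have cw : `|c - w| <= d.
  move: xw yw; rewrite !ler_distl => /andP[x1 x2] /andP[y1 y2].
  by rewrite (between_ge cxy x1 y1) (between_le cxy x2 y2).
have c0 : 0 <= c := le_trans z0 (between_ge cxy zx zy).
rewrite normrM mulrC ler_pM//.
apply: le_trans (g_mills_tail_slope T c0) _.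
by rewrite ler_wpM2l ?near// addr_ge0// divr_ge0// ltW.
Qed.

Lemma left_lip_ge0 : 0 <= left_lip.
Proof.
have c30 := tg_c3 T; have c10 := tg_c1 T; have A1 := tg_A T.
have A0 : 0 <= A by lra.
rewrite /left_lip mulr_ge0 ?mulr_ge0 ?expR_ge0 ?exprn_ge0//.
by rewrite addr_ge0// divr_ge0 ?(ltW c10)// addr_ge0.
Qed.

(** [(1 - F z) exp (G z) = c1 v z], and both [v z] and [g z * v z] are bounded:
    at [z] the exponential weight of the left branch disappears. *)
Lemma left_lip_kink : (1 - F z) * (left_lip * ((1 + g z) ^+ 2 * expR (G z)))
  <= left_lip * (1 + c1) * (1 + g z).
Proof.
have c30 := tg_c3 T; have c10 := tg_c1 T; have A1 := tg_A T; have gz0 := g_ge0 T z0.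
have vE : (1 - F z) * expR (G z) = v z * c1.
  by rewrite /mills_tail divfK// gt_eqF.
apply: (@le_trans _ _ (left_lip * (v z * c1 * (1 + g z)) * (1 + g z))).
  by rewrite -vE le_eqVlt; apply/orP; left; apply/eqP; ring.
apply: ler_wpM2r; first by rewrite addr_ge0.
rewrite ler_wpM2l ?left_lip_ge0//.
have := mills_tail_le T z0; rewrite -div1r ler_pdivlMr// => v1.
have : g z * v z * c1 <= 1 * c1 by rewrite ler_wpM2r ?(ltW c10)// (mills_tail_slope T).
lra.
Qed.

Lemma right_lip_ge :
  [/\ 0 <= right_lip, (1 + c3 / c1) * A <= right_lip & left_lip * (1 + c1) <= right_lip].
Proof.
have c30 := tg_c3 T; have c10 := tg_c1 T; have A1 := tg_A T; have l0 := left_lip_ge0.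
have A0 : 0 <= A by lra.
have h1 : 0 <= (1 + c3 / c1) * A by rewrite mulr_ge0// addr_ge0// divr_ge0// ltW.
have h2 : 0 <= left_lip * (1 + c1) by rewrite mulr_ge0// addr_ge0// ltW.
by rewrite /right_lip; split; lra.
Qed.

Lemma stein_sol_left w : w <= z -> stein_sol w = (1 - F z) * u w.
Proof. by move=> wz; rewrite /stein_sol wz (le_gtF wz) !mulr0 addr0 mulr1. Qed.

Lemma stein_sol_right w : z <= w -> stein_sol w = F z * v w.
Proof.
rewrite le_eqVlt => /predU1P[<-|zw].
  by rewrite stein_sol_left// /mills_cdf /mills_tail; ring.
by rewrite /stein_sol zw (lt_geF zw) !mulr0 add0r mulr1.
Qed.

Lemma stein_slope_left w : w <= z -> stein_sol_slope w = (1 - F z) * (1 + g w * u w).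
Proof. by move=> wz; rewrite /stein_sol_slope stein_sol_left// wz /=; ring. Qed.

Lemma stein_slope_right w : z < w -> stein_sol_slope w = F z * (-1 + g w * v w).
Proof.
move=> zw; rewrite /stein_sol_slope stein_sol_right ?(ltW zw)// (lt_geF zw) /=; ring.
Qed.

Lemma stein_slope_jump :
  F z * (-1 + g z * v z) - (1 - F z) * (1 + g z * u z) = -1.
Proof. by rewrite /mills_cdf /mills_tail; ring. Qed.

(** A first-order expansion with the slope at [w]. The error is the variation of
    the slope at distance [d], plus the unit jump when [z] separates [w] and
    [w']. *)
Lemma stein_sol_increment w w' : `|w - w'| <= d ->
  `|stein_sol w - stein_sol w' - stein_sol_slope w * (w - w')|
  <= (stein_sol_error w + ((w <= z) != (w' <= z))%R%:R) * `|w - w'|.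
Proof.
move=> ww; have c30 := tg_c3 T; have c10 := tg_c1 T; have A1 := tg_A T.
have d0 : 0 <= d by exact: ltW.
have F0 := tF_ge0 T z; have F1 := tF_le1 T z.
have l0 := left_lip_ge0; have gz0 := g_ge0 T z0; have [r0 r1 r2] := right_lip_ge.
have uvz : (1 - F z) * u z = F z * v z by rewrite /mills_cdf /mills_tail; ring.
have wwd : `|w - w| <= d by rewrite subrr normr0.
have gw1 : 0 <= 1 + `|g w| by rewrite addr_ge0.
have m0 : 0 <= 1 + c3 / c1 by rewrite addr_ge0// divr_ge0// ltW.
have el y : 0 <= left_lip * ((1 + `|g y|) ^+ 2 * expR (G (Num.max y 0))).
  by rewrite mulr_ge0// mulr_ge0 ?expR_ge0// exprn_ge0// addr_ge0.
have Ag y : 0 <= A * (1 + `|g y|) by rewrite mulr_ge0 ?addr_ge0//; lra.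
have dul (x : R) : is_derive x 1 (fun y => (1 - F z) * u y) ((1 - F z) * (1 + g x * u x)).
  by have := mills_cdf_der T x => du; apply: is_derive_eq; rewrite /GRing.scale.
have dvr (x : R) : is_derive x 1 (fun y => F z * v y) (F z * (-1 + g x * v x)).
  by have := mills_tail_der T x => dv; apply: is_derive_eq; rewrite /GRing.scale.
(* Variation of the slope on each branch, without the jump. *)
have L1 x y : x <= z -> y <= z -> `|x - y| <= d ->
    `|(1 - F z) * (1 + g x * u x) - (1 - F z) * (1 + g y * u y)| <=
    d * (left_lip * (1 - F z)) * ((1 + `|g y|) ^+ 2 * expR (G (Num.max y 0))).
  move=> xz yz xy; have := left_slope_lip xz yz xy => h.
  have -> : (1 - F z) * (1 + g x * u x) - (1 - F z) * (1 + g y * u y) =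
    (1 - F z) * (g x * u x - g y * u y) by ring.
  rewrite normrM ger0_norm//.
  have -> : d * (left_lip * (1 - F z)) * ((1 + `|g y|) ^+ 2 * expR (G (Num.max y 0))) =
    (1 - F z) * (d * (left_lip * ((1 + `|g y|) ^+ 2 * expR (G (Num.max y 0))))) by ring.
  by rewrite ler_wpM2l.
have L2 x y : z <= x -> z <= y -> `|x - y| <= d -> `|x - w| <= d -> `|y - w| <= d ->
    `|F z * (-1 + g x * v x) - F z * (-1 + g y * v y)| <= d * ((1 + c3 / c1) * (A * (1 + `|g w|))).
  move=> zx zy xy xw yw; have h := right_slope_lip zx zy xy xw yw.
  have -> : F z * (-1 + g x * v x) - F z * (-1 + g y * v y) =
    F z * (g x * v x - g y * v y) by ring.
  by rewrite normrM ger0_norm// -[leRHS]mul1r ler_pM.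
have ww2 : - d <= w - w' <= d by rewrite -ler_norml.
have [wz|zw] := leP w z; have [wz'|zw'] := leP w' z.
- rewrite eqxx addr0 !stein_sol_left// stein_slope_left//.
  have [c cw ->] := mvt_between w w' dul.
  have cwd := le_trans (between_dist cw) ww.
  have cz : c <= z := between_le cw wz wz'.
  rewrite -mulrBl normrM ler_wpM2r//; apply: le_trans (L1 _ _ cz wz cwd) _.
  rewrite /stein_sol_error wz mulr1 lerDl.
  by apply: mulr_ge0; apply: mulr_ge0.
- rewrite stein_sol_left// stein_slope_left// (stein_sol_right (ltW zw')).
  have [c cw Ec] := mvt_between w z dul; have [c' cw' Ec'] := mvt_between z w' dvr.
  rewrite (min_idPl wz) (max_idPr wz) in cw; case/andP: cw => wc cz.
  rewrite (min_idPl (ltW zw')) (max_idPr (ltW zw')) in cw'; case/andP: cw' => zc' cw'.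
  have -> : (1 - F z) * u w - F z * v w' - (1 - F z) * (1 + g w * u w) * (w - w') =
    ((1 - F z) * (1 + g c * u c) - (1 - F z) * (1 + g w * u w)) * (w - z) +
    (F z * (-1 + g c' * v c') - F z * (-1 + g z * v z) + -1
      + ((1 - F z) * (1 + g z * u z) - (1 - F z) * (1 + g w * u w))) * (z - w').
    rewrite -stein_slope_jump; have : (1 - F z) * u w - F z * v w' =
      ((1 - F z) * u w - (1 - F z) * u z) + (F z * v z - F z * v w') by rewrite uvz; ring.
    by move=> ->; rewrite Ec Ec'; ring.
  have cwd : `|c - w| <= d by rewrite ler_norml; lra.
  have zwd : `|z - w| <= d by rewrite ler_norml; lra.
  have czd : `|c' - z| <= d by rewrite ler_norml; lra.
  have c'wd : `|c' - w| <= d by rewrite ler_norml; lra.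
  have pq : 0 <= (w - z) * (z - w') by nra.
  have n1 : `|-1 : R| = 1 by rewrite normrN1.
  have := kink_combine (L1 _ _ cz wz cwd) (L1 _ _ (lexx z) wz zwd)
    (L2 _ _ zc' (lexx z) czd c'wd zwd) n1 pq.
  have -> : w - z + (z - w') = w - w' by ring.
  move=> /le_trans; apply; rewrite ler_wpM2r// lerD2r.
  have zdw : z - d < w by lra.
  rewrite /stein_sol_error wz zdw !mulr1 lerD2l.
  by rewrite -[leRHS]mulrA ler_wpM2l// mulrA ler_wpM2r.
- rewrite (stein_sol_right (ltW zw)) (stein_slope_right zw) (stein_sol_left wz').
  have [c cw Ec] := mvt_between w z dvr; have [c' cw' Ec'] := mvt_between z w' dul.
  rewrite (min_idPr (ltW zw)) (max_idPl (ltW zw)) in cw; case/andP: cw => zc cw.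
  rewrite (min_idPr wz') (max_idPl wz') in cw'; case/andP: cw' => wc' c'z.
  have -> : F z * v w - (1 - F z) * u w' - F z * (-1 + g w * v w) * (w - w') =
    (F z * (-1 + g c * v c) - F z * (-1 + g w * v w)) * (w - z) +
    ((1 - F z) * (1 + g c' * u c') - (1 - F z) * (1 + g z * u z) + 1
      + (F z * (-1 + g z * v z) - F z * (-1 + g w * v w))) * (z - w').
    have : F z * v w - (1 - F z) * u w' =
      (F z * v w - F z * v z) + ((1 - F z) * u z - (1 - F z) * u w') by rewrite uvz; ring.
    move=> ->; rewrite Ec Ec'.
    have := stein_slope_jump.
    set p := F z * (-1 + g z * v z); set q := (1 - F z) * (1 + g z * u z) => J.
    have -> : q = p + 1 by lra.
    ring.
  have cwd : `|c - w| <= d by rewrite ler_norml; lra.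
  have zwd : `|z - w| <= d by rewrite ler_norml; lra.
  have czd : `|c' - z| <= d by rewrite ler_norml; lra.
  have pq : 0 <= (w - z) * (z - w') by nra.
  have n1 : `|1 : R| = 1 by rewrite normr1.
  have := kink_combine (L2 _ _ zc (ltW zw) cwd cwd wwd) (L2 _ _ (lexx z) (ltW zw) zwd zwd wwd)
    (L1 _ _ c'z (lexx z) czd) n1 pq.
  have -> : w - z + (z - w') = w - w' by ring.
  move=> /le_trans; apply; rewrite ler_wpM2r// lerD2r.
  have zdw : z - d < w by lra.
  rewrite /stein_sol_error (lt_geF zw) zdw !mulr0 add0r mulr1.
  rewrite (max_idPl z0) (ger0_norm gz0).
  have := left_lip_kink; have gzw := tg_mono T (ltW zw).
  have gw0 : 0 <= g w := le_trans gz0 gzw.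
  rewrite (ger0_norm gw0) => lk.
  have lkw : (1 - F z) * (left_lip * ((1 + g z) ^+ 2 * expR (G z))) <= left_lip * (1 + c1) * (1 + g w).
    by apply: le_trans lk _; rewrite ler_wpM2l ?lerD2l// mulr_ge0// addr_ge0// ltW.
  have -> : d * ((1 + c3 / c1) * (A * (1 + g w))) + d * (left_lip * (1 - F z)) * ((1 + g z) ^+ 2 * expR (G z)) =
    d * ((1 + c3 / c1) * A * (1 + g w) + (1 - F z) * (left_lip * ((1 + g z) ^+ 2 * expR (G z)))) by ring.
  by rewrite -[leRHS]mulrA ler_wpM2l// /right_lip [leRHS]mulrDl lerD2l.
- rewrite eqxx addr0 (stein_sol_right (ltW zw)) (stein_sol_right (ltW zw')) (stein_slope_right zw).
  have [c cw ->] := mvt_between w w' dvr.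
  have cwd := le_trans (between_dist cw) ww.
  have cz : z <= c := between_ge cw (ltW zw) (ltW zw').
  rewrite -mulrBl normrM ler_wpM2r//.
  apply: le_trans (L2 _ _ cz (ltW zw) cwd cwd wwd) _.
  have zdw : z - d < w by lra.
  rewrite /stein_sol_error (lt_geF zw) zdw !mulr0 add0r mulr1.
  by rewrite -[leRHS]mulrA ler_wpM2l// mulrA ler_wpM2r.
Qed.

End SteinSolution.

Section Comparison.
Variables (R : realType) (c1 c3 A d0 alpha tau1 tau2 K0 : R).
Variables (g dg G F : R -> R) (d e1 e2 : R) (S : set R) (r : R -> R).
Variables (E : (R -> R) -> R) (z : R).
Hypothesis T : stein_target c1 c3 A g dg G F.
Hypothesis L : stein_law d0 alpha tau1 tau2 g d e1 e2 S r E.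
Hypotheses (alpha_lt1 : alpha < 1) (z0 : 0 <= z) (dgz : d * g z <= K0).
Hypotheses (tau1_ge0 : 0 <= tau1) (tau2_ge0 : 0 <= tau2).

Local Notation f := (stein_sol c1 G F z).
Local Notation h := (stein_sol_slope c1 g G F z).
Local Notation err := (stein_sol_error c1 c3 A g G F K0 z d).
Local Notation rmp := (ramp z d).

Let d_gt0 : 0 < d. Proof. by have /andP[] := law_d L. Qed.
Let d_le1 : d <= 1. Proof. by have /andP[] := law_d L. Qed.
Let zdd : z - d <= z + d. Proof. by have := d_gt0; lra. Qed.

(** Both points lie in the interval where the ramp has slope 1. *)
Lemma ramp_straddle w w' : `|w - w'| <= d ->
  ((w <= z) != (w' <= z))%R%:R * (w - w') ^+ 2 <= (w - w') * (rmp w - rmp w').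
Proof.
move=> ww; have ww2 : - d <= w - w' <= d by rewrite -ler_norml.
have -> : rmp w - rmp w' = clip (z - d) (z + d) w - clip (z - d) (z + d) w'.
  by rewrite /ramp; ring.
have /andP[s0 _] := clip_sign w w' zdd.
have [wz|zw] := leP w z; have [wz'|zw'] := leP w' z; rewrite ?eqxx ?mul0r//.
- by rewrite !clip_id ?mul1r//; lra.
- by rewrite !clip_id ?mul1r//; lra.
Qed.

Lemma ramp_range w : 0 <= rmp w <= 2 * d * (z - d < w)%R%:R.
Proof.
have /andP[h1 h2] := clip_in w zdd; rewrite /ramp subr_ge0 h1 /=.
have [zw|wz] := ltP (z - d) w; first by rewrite mulr1; lra.
by rewrite clip_left// subrr mulr0.
Qed.

Lemma stein_sol_ge0 w : 0 <= f w.
Proof.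
have F0 := tF_ge0 T z; have F1 := tF_le1 T z.
have u0 := mills_cdf_ge0 T w; have v0 := mills_tail_ge0 T w.
by rewrite /stein_sol addr_ge0// mulr_ge0 ?subr_ge0// mulr_ge0.
Qed.

(** Beyond [z] the factor [1 / (1 + g z)] comes from
    [(1 + g w) v w <= 1 + 1 / c1]. *)
Lemma stein_sol_bound w :
  f w <= (1 - F z) / c1 * (expR (G (Num.max w 0)) * (w <= z)%R%:R)
    + (1 + c1^-1) / (1 + g z) * (z < w)%R%:R.
Proof.
have F0 := tF_ge0 T z; have F1 := tF_le1 T z; have gz0 := g_ge0 T z0.
have c10 := tg_c1 T.
rewrite /stein_sol; apply: lerD.
  have -> : (1 - F z) / c1 * (expR (G (Num.max w 0)) * (w <= z)%R%:R) =
    (1 - F z) * (expR (G (Num.max w 0)) / c1 * (w <= z)%R%:R) by ring.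
  by rewrite ler_wpM2l ?subr_ge0// ler_wpM2r// (mills_cdf_le T).
have [wz|zw] := leP w z; first by rewrite !mulr0.
rewrite !mulr1.
have w0 : 0 <= w by rewrite (le_trans z0)// ltW.
have v0 := mills_tail_ge0 T w; have vl := mills_tail_le T w0; have gv := mills_tail_slope T w0.
apply: (@le_trans _ _ (mills_tail c1 G F w)); first by rewrite ler_piMl.
rewrite ler_pdivlMr; last lra.
have gzw := tg_mono T (ltW zw).
have : mills_tail c1 G F w * g z <= mills_tail c1 G F w * g w by rewrite ler_wpM2l.
lra.
Qed.

Lemma stein_slope_bound w :
  `|h w| <= (1 - F z) * (1 + c1^-1) *
      ((1 + `|g w|) * (expR (G (Num.max w 0)) * (w <= z)%R%:R)) + (z < w)%R%:R.
Proof.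
have F0 := tF_ge0 T z; have F1 := tF_le1 T z; have gz0 := g_ge0 T z0.
have c10 := tg_c1 T; have ci : 0 <= c1^-1 by rewrite invr_ge0 ltW.
have [wz|zw] := leP w z.
  rewrite stein_slope_left// addr0 mulr1 normrM ger0_norm ?subr_ge0// -mulrA ler_wpM2l ?subr_ge0//.
  have ul := mills_cdf_le T w; have u0 := mills_cdf_ge0 T w.
  have e1' : 1 <= expR (G (Num.max w 0)) by rewrite -expR0 ler_expR (G_ge0 T).
  apply: le_trans (ler_normD _ _) _; rewrite normr1 normrM (ger0_norm u0).
  have h1 : `|g w| * mills_cdf c1 G F w <= `|g w| * (expR (G (Num.max w 0)) / c1).
    by rewrite ler_wpM2l.
  apply: le_trans (lerD (lexx _) h1) _.
  have gn := normr_ge0 (g w).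
  set e := expR _ in e1' *; set a := `|g w| in gn *; set b := c1^-1 in ci *.
  have p1 : 0 <= a * e by rewrite mulr_ge0//; lra.
  have p2 : 0 <= b * e by rewrite mulr_ge0//; lra.
  lra.
rewrite mulr0 mulr0 mulr0 add0r stein_slope_right//.
have gv := mills_tail_slope T (le_trans z0 (ltW zw)).
have gw0 := g_ge0 T (le_trans z0 (ltW zw)).
have v0 : 0 <= g w * mills_tail c1 G F w by rewrite mulr_ge0// (mills_tail_ge0 T).
rewrite normrM ger0_norm// -[leRHS]mulr1 ler_pM// ler_norml; lra.
Qed.

Lemma stein_sol_bdd : bdd_on S f.
Proof.
have [bG leG] := expG_bdd S T z0; have F1 := tF_le1 T z.
have c10 := tg_c1 T; have ci : 0 <= c1^-1 by rewrite invr_ge0 ltW.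
split; last first.
  exists ((1 - F z) / c1 * expR (G z) + (1 + c1^-1) / (1 + g z)) => w _.
  rewrite ger0_norm ?stein_sol_ge0//; apply: le_trans (stein_sol_bound w) _.
  have gz0 := g_ge0 T z0.
  apply: lerD; first by rewrite ler_wpM2l// divr_ge0 ?subr_ge0// ltW.
  by rewrite ler_piMr ?divr_ge0 ?addr_ge0//; case: (z < w).
have [ml _] := bdd_le S z; have [mr _] := bdd_lt S z.
apply: measurable_funD; apply: measurable_funM => //; apply: measurable_funM => //.
  exact: measurable_of_derivative (mills_cdf_der T).
exact: measurable_of_derivative (mills_tail_der T).
Qed.

(** Stein's inequality for [f - ramp] and for [- f - ramp], where [f] is the
    solution of the Stein equation. The ramp is subtracted in both cases,
    because it compensates the jump of the slope in absolute value; its own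
    contribution is supported beyond [z - d]. In the sum, [E (g f)] cancels
    against the part [g f] of the slope. *)
Lemma stein_comparison :
  `|E (fun w => (z < w)%R%:R) - (1 - F z)| <=
    e1 * E (fun w => (1 + `|g w|) `^ tau1 * `|h w|) + d0 * E err
    + 4 * d * E (fun w => (1 + `|g w|) * (z - d < w)%R%:R)
    + e2 * E (fun w => (1 + `|g w|) `^ tau2 * f w).
Proof.
have bf := stein_sol_bdd.
have [bG _] := expG_bdd S T z0.
have bh : bdd_on S h by rewrite /stein_sol_slope; bdd.
have be : bdd_on S err by rewrite /stein_sol_error; bdd.
have br : bdd_on S rmp by have bc := bdd_clip S zdd; rewrite /ramp; bdd.
have bw a : 0 <= a -> bdd_on S (fun w => (1 + `|g w|) `^ a).
  by move=> a0; apply: bdd_powR => //; bdd.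
have bw1 := bw _ tau1_ge0; have bw2 := bw _ tau2_ge0.
have c30 := tg_c3 T; have c10 := tg_c1 T; have d00 := ltW d_gt0.
have err0 w : 0 <= err w.
  have l0 := left_lip_ge0 K0 T; have [r0 _ _] := right_lip_ge K0 T.
  have F1 := tF_le1 T z; have g1 : 0 <= 1 + `|g w| by rewrite addr_ge0.
  rewrite /stein_sol_error addr_ge0//.
    apply: mulr_ge0; first by rewrite mulr_ge0// mulr_ge0 ?subr_ge0.
    by rewrite mulr_ge0 ?exprn_ge0// mulr_ge0 ?expR_ge0.
  by apply: mulr_ge0; [rewrite mulr_ge0|rewrite mulr_ge0].
have inc w w' (ww : `|w - w'| <= d) :
    `|(w - w') * (f w - f w') - (w - w') ^+ 2 * h w| <=
    (w - w') ^+ 2 * err w + (w - w') * (rmp w - rmp w').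
  have -> : (w - w') * (f w - f w') - (w - w') ^+ 2 * h w =
    (w - w') * (f w - f w' - h w * (w - w')) by ring.
  rewrite normrM; have := stein_sol_increment T z0 d_gt0 d_le1 dgz ww.
  move=> /(ler_wpM2l (normr_ge0 (w - w'))) => /le_trans; apply.
  rewrite mulrCA -expr2 real_normK ?num_real// mulrDl lerD//.
    by rewrite mulrC.
  exact: ramp_straddle.
have pwp w w' : `|w - w'| <= d ->
    (w - w') * ((f w + - rmp w) - (f w' + - rmp w')) <= (w - w') ^+ 2 * (h w + err w).
  by move=> ww; have := inc w w' ww; rewrite ler_norml => /andP[_]; lra.
have pwm w w' : `|w - w'| <= d ->
    (w - w') * ((- f w + - rmp w) - (- f w' + - rmp w')) <= (w - w') ^+ 2 * (- h w + err w).
  by move=> ww; have := inc w w' ww; rewrite ler_norml => /andP[+ _]; lra.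
have := law_stein L (bddD bf (bddN br)) bh be err0 pwp.
have := law_stein L (bddD (bddN bf) (bddN br)) (bddN bh) be err0 pwm.
have bgf : bdd_on S (fun w => g w * f w) by bdd.
have brf : bdd_on S (fun w => r w * f w) by bdd.
have bgr : bdd_on S (fun w => (g w - r w) * rmp w) by bdd.
have ble := bdd_le S z; have blt := bdd_lt S z.
have hw : E (fun w => (1 + `|g w|) `^ tau1 * `|- h w|) = E (fun w => (1 + `|g w|) `^ tau1 * `|h w|).
  by congr E; apply/funext => w; rewrite normrN.
have b1 : bdd_on S (fun=> 1) := bdd_cst S 1.
have hm : E (fun w => - h w) = - E h.
  rewrite (law_comb3 L (a1 := -1) (a2 := 0) (a3 := 0) bh b1 b1); first by ring.
  by move=> w; ring.
have hE : E h = E (fun w => g w * f w) + (E (fun w => (w <= z)%R%:R) - F z).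
  rewrite (law_comb3 L (a1 := 1) (a2 := 1) (a3 := - F z) bgf ble b1).
    by rewrite (law_1 L); ring.
  by move=> w; rewrite /stein_sol_slope; ring.
have Ep : E (fun w => (g w - r w) * (f w + - rmp w)) =
    E (fun w => g w * f w) - E (fun w => r w * f w) - E (fun w => (g w - r w) * rmp w).
  rewrite (law_comb3 L (a1 := 1) (a2 := -1) (a3 := -1) bgf brf bgr); first by ring.
  by move=> w; ring.
have Em : E (fun w => (g w - r w) * (- f w + - rmp w)) =
    - E (fun w => g w * f w) + E (fun w => r w * f w) - E (fun w => (g w - r w) * rmp w).
  rewrite (law_comb3 L (a1 := -1) (a2 := 1) (a3 := -1) bgf brf bgr); first by ring.
  by move=> w; ring.
have El : E (fun w => (z < w)%R%:R) = 1 - E (fun w => (w <= z)%R%:R).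
  rewrite (law_comb3 L (a1 := 1) (a2 := -1) (a3 := 0) b1 ble b1).
    by rewrite (law_1 L); ring.
  by move=> w; case: leP => _ /=; ring.
have Er : E (fun w => (g w - r w) * rmp w) <=
    4 * d * E (fun w => (1 + `|g w|) * (z - d < w)%R%:R).
  apply: (law_le1 L) => //; first by bdd.
  move=> w Sw; have /andP[k0 k1] := ramp_range w.
  apply: le_trans (ler_norm _) _; rewrite normrM (ger0_norm k0).
  have gr : `|g w - r w| <= 2 * (1 + `|g w|).
    apply: le_trans (ler_normB _ _) _; have := law_ra L Sw.
    have := normr_ge0 (g w); have := alpha_lt1; nra.
  have -> : 4 * d * ((1 + `|g w|) * (z - d < w)%R%:R) =
    2 * (1 + `|g w|) * (2 * d * (z - d < w)%R%:R) by ring.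
  by rewrite ler_pM.
have bwf : bdd_on S (fun w => (1 + `|g w|) `^ tau2 * f w) by bdd.
have rf1 : E (fun w => r w * f w) <= e2 * E (fun w => (1 + `|g w|) `^ tau2 * f w).
  apply: (law_le1 L) => // w Sw; rewrite mulrA ler_wpM2r ?stein_sol_ge0//.
  by apply: le_trans (ler_norm _) (law_r2 L Sw).
have rf2 : - E (fun w => r w * f w) <= e2 * E (fun w => (1 + `|g w|) `^ tau2 * f w).
  have -> : - E (fun w => r w * f w) = E (fun w => - r w * f w).
    rewrite (law_comb3 L (h := fun w => - r w * f w) (a1 := -1) (a2 := 0) (a3 := 0) brf b1 b1).
      by ring.
    by move=> w; ring.
  apply: (law_le1 L) => //; first by bdd.
  move=> w Sw; rewrite mulrA ler_wpM2r ?stein_sol_ge0//.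
  by apply: le_trans (law_r2 L Sw); rewrite -normrN ler_norm.
rewrite hw hm Ep Em hE El.
set X1 := E (fun w => g w * f w); set X2 := E (fun w => r w * f w) in rf1 rf2 *.
set X3 := E (fun w => (g w - r w) * rmp w) in Er *.
set X4 := E (fun w => (w <= z)%R%:R); set X5 := E err.
set X6 := E (fun w => _ `^ tau2 * _) in rf1 rf2 *; set X7 := E (fun w => _ `^ tau1 * _).
set X8 := E (fun w => (1 + _) * _) in Er *.
move: X1 X2 X3 X4 X5 X6 X7 X8 rf1 rf2 Er => X1 X2 X3 X4 X5 X6 X7 X8 rf1 rf2 Er hp hn.
by rewrite ler_norml; lra.
Qed.

End Comparison.

(** * Comparison of the two tails *)

Lemma weighted_sum3 (R : realType) (k1 k2 k3 a b c : R) :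
  0 <= k1 -> 0 <= k2 -> 0 <= k3 -> 0 <= a -> 0 <= b -> 0 <= c ->
  k1 * b + k2 * a + k3 * c <= (k1 + k2 + k3) * (a + b + c).
Proof.
move=> k10 k20 k30 a0 b0 c0.
have := mulr_ge0 k10 a0; have := mulr_ge0 k10 c0; have := mulr_ge0 k20 b0.
have := mulr_ge0 k20 c0; have := mulr_ge0 k30 a0; have := mulr_ge0 k30 b0; lra.
Qed.

Section TailComparison.
Variables (R : realType) (c1 c3 A d0 alpha tau1 tau2 K0 : R).
Hypotheses (c1_gt0 : 0 < c1) (c3_ge0 : 0 <= c3) (A_ge1 : 1 <= A).
Hypotheses (d0_ge1 : 1 <= d0) (tau1_ge0 : 0 <= tau1) (tau2_ge0 : 0 <= tau2).
Hypotheses (alpha_ge0 : 0 <= alpha) (alpha_lt1 : alpha < 1) (K0_ge0 : 0 <= K0).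

(** Each expectation in [stein_comparison] is bounded by [weighted_left] for
    the part below [z] and [weighted_right] for the part beyond; the latter
    comes with [exp (- G z)], which is at most a multiple of
    [(1 + g z) (1 - F z)] by [tail_lower]. *)
Lemma tail_comparison : exists2 C, 0 <= C &
  forall g dg G F d e1 e2 S r E,
  stein_target c1 c3 A g dg G F ->
  stein_law d0 alpha tau1 tau2 g d e1 e2 S r E ->
  forall z, 0 <= z -> (1 + z) * rate tau1 tau2 d e1 e2 g z <= K0 ->
  `|E (fun w => (z < w)%R%:R) - (1 - F z)| <=
    C * ((1 - F z) * ((1 + z) * rate tau1 tau2 d e1 e2 g z)).
Proof.
have t1 : 0 <= tau1 + 1 by rewrite addr_ge0.
have [Ca Ca0 HCa] := weighted_left c1_gt0 c3_ge0 A_ge1 d0_ge1 tau1_ge0 tau2_ge0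
  alpha_ge0 alpha_lt1 K0_ge0 t1.
have [Cb Cb0 HCb] := weighted_left c1_gt0 c3_ge0 A_ge1 d0_ge1 tau1_ge0 tau2_ge0
  alpha_ge0 alpha_lt1 K0_ge0 (ler0n R 2).
have [Cc Cc0 HCc] := weighted_left c1_gt0 c3_ge0 A_ge1 d0_ge1 tau1_ge0 tau2_ge0
  alpha_ge0 alpha_lt1 K0_ge0 tau2_ge0.
have [Da Da0 HDa] := weighted_right c1_gt0 c3_ge0 A_ge1 d0_ge1 tau1_ge0 tau2_ge0
  alpha_ge0 alpha_lt1 K0_ge0 tau1_ge0.
have [Dc Dc0 HDc] := weighted_right c1_gt0 c3_ge0 A_ge1 d0_ge1 tau1_ge0 tau2_ge0
  alpha_ge0 alpha_lt1 K0_ge0 tau2_ge0.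
have [Cs Cs0 HCs] := slab_right c1_gt0 c3_ge0 A_ge1 d0_ge1 tau1_ge0 tau2_ge0
  alpha_ge0 alpha_lt1 K0_ge0.
have [k kE] : exists k, k = expR A / c1 by eexists.
have k0 : 0 <= k by rewrite kE divr_ge0 ?expR_ge0 ?ltW.
have [ci ciE] : exists ci, ci = c1^-1 by eexists.
have ci0 : 0 <= ci by rewrite ciE invr_ge0 ltW.
have [ll llE] : exists ll, ll = left_lip c1 c3 A K0 by eexists.
have [rl rlE] : exists rl, rl = right_lip c1 c3 A K0 by eexists.
have A0 : 0 <= A by rewrite (le_trans ler01).
have ll0 : 0 <= ll.
  rewrite llE /left_lip mulr_ge0 ?mulr_ge0 ?expR_ge0 ?exprn_ge0//.
  by rewrite addr_ge0// divr_ge0 ?(ltW c1_gt0)// addr_ge0.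
have rl0 : 0 <= rl.
  rewrite rlE /right_lip -llE addr_ge0//; last by rewrite mulr_ge0// addr_ge0// ltW.
  by rewrite mulr_ge0// addr_ge0// divr_ge0 ?(ltW c1_gt0).
have [k1 k1E] : exists k1, k1 = (1 + ci) * Ca + Da * k by eexists.
have [k2 k2E] : exists k2, k2 = ll * Cb + rl * (Cs * k) by eexists.
have [k3 k3E] : exists k3, k3 = 4 * (Cs * k) by eexists.
have [k4 k4E] : exists k4, k4 = ci * Cc + (1 + ci) * (Dc * k) by eexists.
have k10 : 0 <= k1 by rewrite k1E addr_ge0 ?mulr_ge0 ?addr_ge0.
have k20 : 0 <= k2 by rewrite k2E addr_ge0 ?mulr_ge0.
have k30 : 0 <= k3 by rewrite k3E !mulr_ge0.
have k40 : 0 <= k4 by rewrite k4E addr_ge0 ?mulr_ge0 ?addr_ge0.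
have d00 : 0 <= d0 by rewrite (le_trans ler01).
exists (k1 + (d0 * k2 + k3) + k4); first by rewrite !addr_ge0 ?mulr_ge0.
move=> g dg G F d e1 e2 S r E T L z z0 zr.
have [_ _ _ dgz] := rate_parts T L z0 zr.
have cmp := stein_comparison T L alpha_lt1 z0 dgz tau1_ge0 tau2_ge0.
have ha := HCa _ _ _ _ _ _ _ _ _ _ T L z z0 zr.
have hb := HCb _ _ _ _ _ _ _ _ _ _ T L z z0 zr.
have hc := HCc _ _ _ _ _ _ _ _ _ _ T L z z0 zr.
have ra := HDa _ _ _ _ _ _ _ _ _ _ T L z z0 zr.
have rc := HDc _ _ _ _ _ _ _ _ _ _ T L z z0 zr.
have hs := HCs _ _ _ _ _ _ _ _ _ _ T L z z0 zr.
have [bG _] := expG_bdd S T z0; have gz0 := g_ge0 T z0.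
have /andP[d_gt0 d_le1] := law_d L; have e10 := law_e1 L; have e20 := law_e2 L.
have bw a : 0 <= a -> bdd_on S (fun w => (1 + `|g w|) `^ a).
  by move=> a0; apply: bdd_powR => //; bdd.
have bw1 := bw _ tau1_ge0; have bw2 := bw _ tau2_ge0; have bw11 := bw _ t1.
have bw22 := bw _ (ler0n R 2).
have bf := stein_sol_bdd S T z0.
have bh : bdd_on S (stein_sol_slope c1 g G F z) by rewrite /stein_sol_slope; bdd.
have be : bdd_on S (stein_sol_error c1 c3 A g G F K0 z d) by rewrite /stein_sol_error; bdd.
have blt := bdd_lt S z; have bltd := bdd_lt S (z - d).
have [Q QE] : exists Q, Q = 1 - F z by eexists.
have Q0 : 0 <= Q by rewrite QE subr_ge0 (tF_le1 T).
have [y yE] : exists y, y = 1 + g z by eexists.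
have y1 : 1 <= y by rewrite yE lerDl.
have y0 : 0 < y := lt_le_trans ltr01 y1.
have [Z ZE] : exists Z, Z = 1 + z by eexists.
have Z0 : 0 <= Z by rewrite ZE addr_ge0.
have low : expR (- G z) <= k * (y * Q).
  have := tail_lower T z0; rewrite -yE -QE kE => tl.
  have -> : expR (- G z) = (c1 * expR (- A) * (expR (- G z) / y)) * (expR A / c1 * y).
    by rewrite !expRN; field; rewrite !gt_eqF ?expR_gt0.
  apply: (@le_trans _ _ (Q * (expR A / c1 * y))).
    by rewrite ler_wpM2r// mulr_ge0 ?(ltW y0)// divr_ge0 ?expR_ge0 ?ltW.
  by rewrite le_eqVlt; apply/orP; left; apply/eqP; ring.
rewrite -ZE -yE in ha hb hc ra rc hs.
have powS a : y `^ (a + 1) = y `^ a * y.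
  by rewrite powRD ?powRr1 ?(ltW y0)//; apply/implyP => _; rewrite gt_eqF.
have pow2 : y `^ 2%:R = y ^+ 2 by rewrite powR_mulrn// ltW.
have p1 : 0 <= y `^ tau1 by exact: powR_ge0.
have p2 : 0 <= y `^ tau2 by exact: powR_ge0.
have I1 : E (fun w => (1 + `|g w|) `^ tau1 * `|stein_sol_slope c1 g G F z w|) <=
    k1 * (Q * (Z * y `^ (tau1 + 1))).
  apply: (@le_trans _ _ (Q * (1 + ci) *
      E (fun w => (1 + `|g w|) `^ (tau1 + 1) * (expR (G (Num.max w 0)) * (w <= z)%R%:R))
      + 1 * E (fun w => (1 + `|g w|) `^ tau1 * (z < w)%R%:R))).
    apply: (law_le2 L); [by bdd|by bdd|by bdd|] => w _.
    have := stein_slope_bound T z0 w; rewrite -QE -ciE.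
    move=> /(ler_wpM2l (powR_ge0 (1 + `|g w|) tau1)) => /le_trans; apply.
    have gw1 : 0 < 1 + `|g w| by rewrite ltr_wpDr.
    rewrite powRD ?powRr1 ?(ltW gw1)//; last by apply/implyP => _; rewrite gt_eqF.
    by rewrite le_eqVlt; apply/orP; left; apply/eqP; ring.
  rewrite mul1r k1E mulrDl; apply: lerD.
    apply: (@le_trans _ _ (Q * (1 + ci) * (Ca * (Z * y `^ (tau1 + 1))))).
      by rewrite ler_wpM2l// mulr_ge0// addr_ge0.
    by rewrite le_eqVlt; apply/orP; left; apply/eqP; ring.
  apply: (le_trans ra); rewrite powS -[leRHS]mulrA ler_wpM2l//.
  have -> : k * (Q * (Z * (y `^ tau1 * y))) = Z * y `^ tau1 * (k * (y * Q)) by ring.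
  by rewrite ler_wpM2l// mulr_ge0.
have Is : E (fun w => (1 + `|g w|) * (z - d < w)%R%:R) <= Cs * k * (Q * (Z * y ^+ 2)).
  apply: (le_trans hs); rewrite -[leRHS]mulrA ler_wpM2l//.
  have -> : k * (Q * (Z * y ^+ 2)) = Z * y * (k * (y * Q)) by ring.
  by rewrite ler_wpM2l// mulr_ge0// ltW.
have I2 : E (stein_sol_error c1 c3 A g G F K0 z d) <= d * k2 * (Q * (Z * y ^+ 2)).
  apply: (@le_trans _ _ (d * (ll * Q) *
      E (fun w => (1 + `|g w|) `^ 2%:R * (expR (G (Num.max w 0)) * (w <= z)%R%:R))
      + d * rl * E (fun w => (1 + `|g w|) * (z - d < w)%R%:R))).
    apply: (law_le2 L); [by bdd|by bdd|by bdd|] => w _.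
    by rewrite /stein_sol_error -llE -rlE -QE powR_mulrn ?addr_ge0.
  have -> : d * k2 * (Q * (Z * y ^+ 2)) =
      d * (ll * Q) * (Cb * (Z * y ^+ 2)) + d * rl * (Cs * k * (Q * (Z * y ^+ 2))).
    by rewrite k2E; ring.
  apply: lerD; rewrite ler_wpM2l//.
  - by rewrite mulr_ge0 ?(ltW d_gt0)// mulr_ge0.
  - by rewrite -pow2.
  - by rewrite mulr_ge0 ?(ltW d_gt0).
have I4 : E (fun w => (1 + `|g w|) `^ tau2 * stein_sol c1 G F z w) <=
    k4 * (Q * (Z * y `^ tau2)).
  apply: (@le_trans _ _ (Q * ci *
      E (fun w => (1 + `|g w|) `^ tau2 * (expR (G (Num.max w 0)) * (w <= z)%R%:R))
      + (1 + ci) / y * E (fun w => (1 + `|g w|) `^ tau2 * (z < w)%R%:R))).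
    apply: (law_le2 L); [by bdd|by bdd|by bdd|] => w _.
    have := stein_sol_bound T z0 w; rewrite -QE -ciE -yE.
    move=> /(ler_wpM2l (powR_ge0 (1 + `|g w|) tau2)) => /le_trans; apply.
    by rewrite le_eqVlt; apply/orP; left; apply/eqP; ring.
  rewrite k4E [leRHS]mulrDl; apply: lerD.
    apply: (@le_trans _ _ (Q * ci * (Cc * (Z * y `^ tau2)))).
      by rewrite ler_wpM2l// mulr_ge0.
    by rewrite le_eqVlt; apply/orP; left; apply/eqP; ring.
  apply: (@le_trans _ _ ((1 + ci) / y * (Dc * (Z * y `^ tau2 * (k * (y * Q)))))).
    rewrite ler_wpM2l//; first by rewrite divr_ge0 ?(ltW y0)// addr_ge0.
    by apply: (le_trans rc); rewrite ler_wpM2l// ler_wpM2l// mulr_ge0.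
  by rewrite le_eqVlt; apply/orP; left; apply/eqP; field; rewrite gt_eqF.
apply: (le_trans cmp); rewrite -QE -ZE /rate -yE.
have U1 : 0 <= Q * (Z * y `^ (tau1 + 1)) by rewrite mulr_ge0// mulr_ge0 ?powR_ge0.
have U2 : 0 <= Q * (Z * y ^+ 2) by rewrite mulr_ge0// mulr_ge0// exprn_ge0// ltW.
have U4 : 0 <= Q * (Z * y `^ tau2) by rewrite mulr_ge0// mulr_ge0.
have -> : (k1 + (d0 * k2 + k3) + k4) *
   (Q * (Z * (d * y ^+ 2 + e1 * y `^ (tau1 + 1) + e2 * y `^ tau2))) =
   (k1 + (d0 * k2 + k3) + k4) * (d * (Q * (Z * y ^+ 2)) + e1 * (Q * (Z * y `^ (tau1 + 1)))
     + e2 * (Q * (Z * y `^ tau2))) by ring.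
move: U1 U2 U4 I1 I2 Is I4.
set U1 := Q * (Z * _); set U2 := Q * (Z * _); set U4 := Q * (Z * _).
set E1 := E _; set E2 := E _; set E3 := E _; set E4 := E _.
move: U1 U2 U4 E1 E2 E3 E4 => U1 U2 U4 E1 E2 E3 E4 u1 u2 u4 I1 I2 I3 I4.
have dk : 0 <= d0 * k2 + k3 by rewrite addr_ge0// mulr_ge0.
have P1 : e1 * E1 <= e1 * (k1 * U1) by rewrite ler_wpM2l.
have P2 : d0 * E2 <= d0 * (d * k2 * U2) by rewrite ler_wpM2l.
have P3 : 4 * d * E3 <= 4 * d * (Cs * k * U2) by rewrite ler_wpM2l// mulr_ge0// ltW.
have P4 : e2 * E4 <= e2 * (k4 * U4) by rewrite ler_wpM2l.
apply: (@le_trans _ _ (k1 * (e1 * U1) + (d0 * k2 + k3) * (d * U2) + k4 * (e2 * U4))).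
  have -> : k1 * (e1 * U1) + (d0 * k2 + k3) * (d * U2) + k4 * (e2 * U4) =
    e1 * (k1 * U1) + d0 * (d * k2 * U2) + 4 * d * (Cs * k * U2) + e2 * (k4 * U4).
    by rewrite k3E; ring.
  by rewrite lerD// lerD// lerD.
have v1 : 0 <= e1 * U1 by rewrite mulr_ge0.
have v2 : 0 <= d * U2 by rewrite mulr_ge0// ltW.
have v4 : 0 <= e2 * U4 by rewrite mulr_ge0.
exact: weighted_sum3.
Qed.

End TailComparison.

(** * From the random variables to the functional *)

Section EssBdd.
Variables (R : realType) (d : measure_display) (T : measurableType d).
Variable P : probability T R.

Definition ess_bdd (X : T -> R) : Prop :=
  measurable_fun setT X /\ exists M, {ae P, forall w, `|X w| <= M}.

Implicit Types X Y : T -> R.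
Local Notation Ex X := (\int[P]_w X w)%R.

Lemma ess_bdd_bounded X (M : R) : measurable_fun setT X -> (forall w, `|X w| <= M) -> ess_bdd X.
Proof. by move=> mX XM; split => //; exists M; apply: aeW. Qed.

Lemma ess_bddD X Y : ess_bdd X -> ess_bdd Y -> ess_bdd (fun w => X w + Y w).
Proof.
move=> [mX [M XM]] [mY [N YN]]; split; first exact: measurable_funD.
exists (M + N); apply: filterS2 XM YN => w XM YN.
by rewrite (le_trans (ler_normD _ _))// lerD.
Qed.

Lemma ess_bddM X Y : ess_bdd X -> ess_bdd Y -> ess_bdd (fun w => X w * Y w).
Proof.
move=> [mX [M XM]] [mY [N YN]]; split; first exact: measurable_funM.
exists (M * N); apply: filterS2 XM YN => w XM YN.
by rewrite normrM ler_pM.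
Qed.

Lemma ess_bdd_cst (c : R) : ess_bdd (fun=> c).
Proof. exact: (ess_bdd_bounded (M := `|c|)). Qed.

Lemma ess_bddZ c X : ess_bdd X -> ess_bdd (fun w => c * X w).
Proof. by move=> ?; apply: ess_bddM => //; exact: ess_bdd_cst. Qed.

Lemma ess_bdd_integrable X : ess_bdd X -> P.-integrable setT (EFin \o X).
Proof.
move=> [mX [M XM]]; apply/integrableP; split; first exact/measurable_EFinP.
apply: (@le_lt_trans _ _ (\int[P]_w (`|M|)%:E)%E).
  apply: ae_ge0_le_integral => //.
  - by apply: measurableT_comp => //; exact/measurable_EFinP.
  - apply: filterS XM => w XM _ /=; rewrite lee_fin.
    exact: le_trans XM (ler_norm _).
by rewrite integral_cst// [X in (_ * X)%E](probability_setT P) mule1 ltry.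
Qed.

Lemma Ex_D X Y : ess_bdd X -> ess_bdd Y -> Ex (fun w => X w + Y w) = Ex X + Ex Y.
Proof. by move=> bX bY; rewrite RintegralD//; exact: ess_bdd_integrable. Qed.

Lemma Ex_Z c X : ess_bdd X -> Ex (fun w => c * X w) = c * Ex X.
Proof. by move=> bX; rewrite RintegralZl//; exact: ess_bdd_integrable. Qed.

Lemma Ex_ae_eq X Y : measurable_fun setT X -> measurable_fun setT Y ->
  {ae P, forall w, X w = Y w} -> Ex X = Ex Y.
Proof.
move=> mX mY XY; rewrite /Rintegral; congr fine; apply: ae_eq_integral => //.
- exact/measurable_EFinP.
- exact/measurable_EFinP.
- by apply: filterS XY => w -> _.
Qed.

Lemma Ex_le X Y : ess_bdd X -> ess_bdd Y -> {ae P, forall w, X w <= Y w} -> Ex X <= Ex Y.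
Proof.
move=> bX bY XY; rewrite -subr_ge0.
have bZ : ess_bdd (fun w => Y w + -1 * X w) by apply: ess_bddD => //; exact: ess_bddZ.
have -> : Ex Y - Ex X = Ex (fun w => Y w + -1 * X w).
  by rewrite Ex_D// ?Ex_Z ?mulN1r//; exact: ess_bddZ.
have <- : Ex (fun w => `|Y w + -1 * X w|) = Ex (fun w => Y w + -1 * X w).
  case: bZ => mZ _; apply: Ex_ae_eq => //; first exact: measurableT_comp.
  by apply: filterS XY => w XY; rewrite ger0_norm// mulN1r subr_ge0.
exact: Rintegral_ge0.
Qed.

Lemma Ex_cst (c : R) : Ex (fun=> c) = c.
Proof. by rewrite Rintegral_cst// [X in fine X](probability_setT P) mulr1. Qed.

Lemma Ex_ind A : measurable A -> Ex (\1_A) = fine (P A).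
Proof. by move=> mA; rewrite /Rintegral integral_indic// setIT. Qed.

(** The sum counts the integers in [[1, y]] up to [n], so it is the integral part
    of [y] as long as [y <= n]. *)
Lemma floor_sum (n : nat) (y : R) : 0 <= y ->
  (y <= n%:R -> `|y - \sum_(k < n) (k.+1%:R <= y)%R%:R| <= 1) /\
  (n%:R <= y -> \sum_(k < n) (k.+1%:R <= y)%R%:R = n%:R :> R).
Proof.
move=> y0; elim: n => [|n [IH1 IH2]].
  rewrite !big_ord0; split=> // yn.
  have -> : y = 0 by apply/eqP; rewrite eq_le y0 yn.
  by rewrite subrr normr0.
rewrite !big_ord_recr/= -natr1; split=> yn.
  have [ny|ny] := leP (n%:R + 1) y.
    rewrite IH2; last lra.
    by rewrite /= ler_norml; lra.
  rewrite /= addr0; have [yn'|yn'] := leP y n%:R; first exact: IH1.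
  by rewrite IH2 ?(ltW yn')// ler_norml; lra.
by rewrite yn IH2//; lra.
Qed.

Lemma integrable_test (D : T -> R) (phi : T -> R) (M : R) :
  P.-integrable setT (EFin \o D) -> measurable_fun setT phi -> (forall w, `|phi w| <= M) ->
  P.-integrable setT (EFin \o (fun w => D w * phi w)).
Proof.
move=> iD mp pM; have b : [bounded phi x | x in (setT : set T)].
  exists M; split; first exact: num_real.
  by move=> x Mx w _; exact: le_trans (pM w) (ltW Mx).
by have := integrableMl measurableT iD mp b; apply: eq_integrable.
Qed.

(** [phi] is within [1 / n] of the average of the indicators of
    [k / n <= phi], [1 <= k <= n], by [floor_sum], and [D] is orthogonal to
    each of them. *)
Lemma orthogonal_test (D phi : T -> R) :
  P.-integrable setT (EFin \o D) -> measurable_fun setT phi -> (forall w, 0 <= phi w <= 1) ->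
  (forall t : R, Ex (fun w => D w * (t <= phi w)%R%:R) = 0) ->
  Ex (fun w => D w * phi w) = 0.
Proof.
move=> iD mp p01 D0.
have iDp := integrable_test iD mp (M := 1).
have mind (t : R) : measurable_fun setT (fun w => (t <= phi w)%R%:R : R).
  have -> : (fun w => (t <= phi w)%R%:R : R) = \1_(phi @^-1` `[t, +oo[%classic) :> (T -> R).
    apply/funext => w; rewrite indicE; congr (nat_of_bool _)%:R.
    by apply/idP/idP; rewrite inE/= in_itv/= andbT.
  by apply: measurable_indic; rewrite -[X in measurable X]setTI; exact: mp.
have bind (t : R) w : `|(t <= phi w)%R%:R : R| <= 1.
  by case: (t <= phi w); rewrite ?normr1 ?normr0.
have sumE n (a : nat -> R) (s := fun w => \sum_(k < n) (a k <= phi w)%R%:R : R) :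
    P.-integrable setT (EFin \o (fun w => D w * s w)) /\ Ex (fun w => D w * s w) = 0.
  rewrite {}/s; elim: n => [|n [IH1 IH2]].
    under eq_fun do rewrite big_ord0 mulr0.
    split; last by rewrite Ex_cst.
    exact: ess_bdd_integrable (ess_bdd_cst 0).
  have i2 := integrable_test iD (mind (a n)) (bind (a n)).
  have E w : D w * \sum_(k < n.+1) (a k <= phi w)%R%:R =
      D w * \sum_(k < n) (a k <= phi w)%R%:R + D w * (a n <= phi w)%R%:R :> R.
    by rewrite big_ord_recr/= mulrDr.
  split; under eq_fun do rewrite E.
    by have := integrableD measurableT IH1 i2; apply.
  by rewrite RintegralD// IH2 D0 addr0.
apply/eqP; rewrite -normr_eq0 eq_le normr_ge0 andbT.
have iN : P.-integrable setT (EFin \o (fun w => `|D w|)) by exact: integrable_norm.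
apply/ler_addgt0Pl => /= e e0; rewrite addr0.
have [n nE] : exists n : nat, Ex (fun w => `|D w|) <= e * n.+1%:R.
  exists (Num.bound (Ex (fun w => `|D w|) / e)); rewrite -ler_pdivrMl// mulrC.
  apply: le_trans (ltW (archi_boundP _)) _; last by rewrite ler_nat.
  by rewrite divr_ge0 ?(ltW e0)//; apply: Rintegral_ge0.
have [iS Es] := sumE n.+1 (fun k => k.+1%:R / n.+1%:R).
pose s w : R := \sum_(k < n.+1) (k.+1%:R / n.+1%:R <= phi w)%R%:R.
have n0 : 0 < n.+1%:R :> R by rewrite ltr0n.
have close w : `|phi w - n.+1%:R^-1 * s w| <= n.+1%:R^-1.
  have /andP[p0 p1] := p01 w.
  have y0 : 0 <= n.+1%:R * phi w by rewrite mulr_ge0.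
  have [+ _] := floor_sum n.+1 y0.
  rewrite ler_piMr// => /(_ isT).
  under eq_bigr do rewrite mulrC -ler_pdivrMr//.
  rewrite -/(s w) => sw; rewrite -[leRHS]mulr1 -ler_pdivrMl ?invr_gt0// invrK.
  by rewrite -[X in X * _](gtr0_norm n0) -normrM mulrBr mulVKf ?gt_eqF.
have iDs : P.-integrable setT (EFin \o (fun w => n.+1%:R^-1 * (D w * s w))).
  by have := integrableZl measurableT n.+1%:R^-1 iS; apply: eq_integrable.
have iDp1 : P.-integrable setT (EFin \o (fun w => D w * phi w)).
  by apply: iDp => w; have /andP[p0 p1] := p01 w; rewrite ger0_norm.
have iDd : P.-integrable setT (EFin \o (fun w => D w * phi w - n.+1%:R^-1 * (D w * s w))).
  by have := integrableB measurableT iDp1 iDs; apply: eq_integrable.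
have -> : Ex (fun w => D w * phi w) =
    Ex (fun w => D w * phi w - n.+1%:R^-1 * (D w * s w)).
  by rewrite RintegralB// RintegralZl// Es mulr0 subr0.
apply: le_trans (le_normr_Rintegral measurableT iDd) _.
apply: (@le_trans _ _ (Ex (fun w => n.+1%:R^-1 * `|D w|))).
  apply: le_Rintegral => //; first exact: integrable_norm.
    by have := integrableZl measurableT n.+1%:R^-1 iN; apply: eq_integrable.
  move=> w _; have -> : D w * phi w - n.+1%:R^-1 * (D w * s w) =
    D w * (phi w - n.+1%:R^-1 * s w) by ring.
  by rewrite normrM mulrC ler_wpM2r.
by rewrite RintegralZl// mulrC ler_pdivrMr.
Qed.

End EssBdd.

Section Pair.
Variables (R : realType) (d : measure_display) (T : measurableType d).
Variable P : probability T R.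
Local Notation Ex X := (\int[P]_w X w)%R.

Lemma Ex_restrict (X : T -> R) (A : set T) (a : T -> bool) :
  (forall w, A w <-> a w) ->
  Ex (fun w => X w * (a w)%:R) = fine (\int[P]_(w in A) (X w)%:E)%E.
Proof.
move=> Aa; rewrite -[RHS]/(\int[P]_(w in A) X w)%R [RHS]Rintegral_mkcond; apply: eq_Rintegral => w _.
rewrite patchE; case: ifPn => [|].
  by rewrite inE => /Aa ->; rewrite mulr1.
by rewrite notin_setE => nA; case: (boolP (a w)) => [/Aa//|_]; rewrite mulr0.
Qed.

(** The defining property of a conditional expectation concerns events. A
    bounded [phi] is rescaled to [[0, 1]], after clipping at its essential
    bound, so that [orthogonal_test] applies to [X - Z]. *)
Lemma cond_exp_test (X Z : T -> R) (W : {RV P >-> R}) (phi : R -> R) :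
  is_cond_exp X W Z -> ess_bdd P X -> ess_bdd P Z -> measurable_fun setT phi ->
  (exists M, {ae P, forall w, `|phi (W w)| <= M}) ->
  Ex (fun w => X w * phi (W w)) = Ex (fun w => Z w * phi (W w)).
Proof.
move=> [iX _ iZ XZ] bX bZ mphi [M0 pM].
have [M M_gt0 {}pM] : exists2 M, 0 < M & {ae P, forall w, `|phi (W w)| <= M}.
  exists (`|M0| + 1); first by rewrite ltr_wpDl.
  by apply: filterS pM => w h; apply: le_trans h (le_trans (ler_norm _) _); rewrite lerDl.
have mM : - M <= M by lra.
pose cl x := clip (- M) M (phi x).
have mcl : measurable_fun setT cl by apply: measurableT_comp mphi; exact: clip_measurable.
have bp : ess_bdd P (fun w => phi (W w)).
  by split; [exact: measurableT_comp|exists M].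
have bcl : ess_bdd P (fun w => cl (W w)).
  apply: (ess_bdd_bounded P (M := M)) => [|w]; first exact: measurableT_comp.
  by rewrite ler_norml clip_in.
pose D w := X w + -1 * Z w.
have bD : ess_bdd P D by apply: ess_bddD => //; exact: ess_bddZ.
pose psi w := (cl (W w) + M) / (2 * M).
have mpsi : measurable_fun setT (fun x => (cl x + M) / (2 * M)).
  by apply: measurable_funM => //; apply: measurable_funD.
have psi01 w : 0 <= psi w <= 1.
  have /andP[h1 h2] := clip_in (phi (W w)) mM.
  rewrite /psi divr_ge0 ?ler_pdivrMr /cl//; lra.
have D0 (t : R) : Ex (fun w => D w * (t <= psi w)%R%:R) = 0.
  pose B := (fun x => (cl x + M) / (2 * M)) @^-1` `[t, +oo[%classic.
  have mB : measurable B by rewrite -[B]setTI; exact: mpsi.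
  have Bt w : (W @^-1` B) w <-> t <= psi w by rewrite /B /= in_itv/= andbT.
  have sB : g_sigma_algebra_preimage W (W @^-1` B).
    by exists B => //; rewrite setTI.
  have mi : measurable_fun setT (fun w => (t <= psi w)%R%:R : R).
    have -> : (fun w => (t <= psi w)%R%:R : R) = \1_(W @^-1` B) :> (T -> R).
      apply/funext => w; rewrite indicE; congr (nat_of_bool _)%:R.
      by apply/idP/idP; rewrite inE => /Bt.
    by apply: measurable_indic; rewrite -[X in measurable X]setTI; exact: measurable_funP.
  have bi : ess_bdd P (fun w => (t <= psi w)%R%:R).
    by apply: (ess_bdd_bounded P (M := 1)) => // w; case: (t <= psi w); rewrite ?normr1 ?normr0.
  have -> : Ex (fun w => D w * (t <= psi w)%R%:R) =
      Ex (fun w => X w * (t <= psi w)%R%:R) + -1 * Ex (fun w => Z w * (t <= psi w)%R%:R).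
    rewrite -Ex_Z; last exact: ess_bddM.
    rewrite -Ex_D; [|exact: ess_bddM|by apply: ess_bddZ; exact: ess_bddM].
    by congr (Rintegral _ _ _); apply/funext => w; rewrite /D; ring.
  by rewrite !(Ex_restrict _ Bt) XZ// mulN1r subrr.
have E0 : Ex (fun w => D w * psi w) = 0.
  apply: orthogonal_test => //; first exact: ess_bdd_integrable.
  exact: (measurableT_comp mpsi).
have DD : Ex D = 0.
  rewrite -[RHS](D0 0); congr (Rintegral _ _ _); apply/funext => w.
  by have /andP[-> _] := psi01 w; rewrite mulr1.
have bpsi : ess_bdd P psi.
  split; first exact: (measurableT_comp mpsi).
  by exists 1; apply: aeW => w; have /andP[h0 h1] := psi01 w; rewrite ger0_norm.
have Ec : Ex (fun w => D w * cl (W w)) = 0.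
  have -> : Ex (fun w => D w * cl (W w)) = 2 * M * Ex (fun w => D w * psi w) + - M * Ex D.
    rewrite -!Ex_Z//; last exact: ess_bddM.
    rewrite -Ex_D; [|by apply: ess_bddZ; exact: ess_bddM|exact: ess_bddZ].
    congr (Rintegral _ _ _); apply/funext => w.
    by rewrite /psi; field; rewrite gt_eqF.
  by rewrite E0 DD !mulr0 addr0.
have : Ex (fun w => D w * phi (W w)) = 0.
  have [m1 _] := ess_bddM bD bp; have [m2 _] := ess_bddM bD bcl.
  rewrite -Ec; apply: Ex_ae_eq => //; apply: filterS pM => w.
  by rewrite ler_norml => h; rewrite /cl clip_id.
have -> : Ex (fun w => D w * phi (W w)) =
    Ex (fun w => X w * phi (W w)) + -1 * Ex (fun w => Z w * phi (W w)).
  rewrite -Ex_Z; last exact: ess_bddM.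
  rewrite -Ex_D; [|exact: ess_bddM|by apply: ess_bddZ; exact: ess_bddM].
  by congr (Rintegral _ _ _); apply/funext => w; rewrite /D; ring.
by rewrite mulN1r => /eqP; rewrite subr_eq0 => /eqP.
Qed.

Lemma exchangeable_Ex (W W' : {RV P >-> R}) (phi : R * R -> R) :
  exchangeable W W' -> measurable_fun setT phi ->
  ess_bdd P (fun w => phi (W w, W' w)) -> ess_bdd P (fun w => phi (W' w, W w)) ->
  Ex (fun w => phi (W w, W' w)) = Ex (fun w => phi (W' w, W w)).
Proof.
move=> ex mphi b1 b2.
have m1 : measurable_fun setT (fun w => (W w, W' w)) by apply: measurable_fun_pair.
have m2 : measurable_fun setT (fun w => (W' w, W w)) by apply: measurable_fun_pair.
have mE : measurable_fun setT (EFin \o phi) by exact/measurable_EFinP.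
rewrite /Rintegral; congr fine.
have := integral_pushforward m1 (D := setT) mE (ess_bdd_integrable b1) measurableT.
have := integral_pushforward m2 (D := setT) mE (ess_bdd_integrable b2) measurableT.
rewrite !preimage_setT => <- <-; apply: eq_measure_integral => B mB _.
exact: ex.
Qed.

(** [W'] has the distribution of [W]. *)
Lemma exchangeable_ae (W W' : {RV P >-> R}) (phi : R -> R) (M : R) :
  exchangeable W W' -> measurable_fun setT phi ->
  {ae P, forall w, `|phi (W w)| <= M} -> {ae P, forall w, `|phi (W' w)| <= M}.
Proof.
move=> ex mphi pM.
pose B := (fun x => `|phi x|) @^-1` `]M, +oo[%classic.
have mB : measurable B.
  have mn : measurable_fun setT (fun x => `|phi x|) by exact: measurableT_comp.
  by rewrite -[B]setTI; exact: mn.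
have Bx (V : T -> R) : ~` [set w | `|phi (V w)| <= M] = V @^-1` B.
  by apply/seteqP; split=> w; rewrite /B /= in_itv/= andbT ltNge => /negP.
have mV (V : {RV P >-> R}) : measurable (V @^-1` B).
  by rewrite -[X in measurable X]setTI; exact: measurable_funP.
have nW : P.-negligible (W @^-1` B) by rewrite -Bx.
have P0 : P (W @^-1` B) = 0%E := (measure_negligible (mV W) nW).
rewrite /prop_near1 /nbhs/= /almost_everywhere/= Bx.
suff P0' : P (W' @^-1` B) = 0%E by exists (W' @^-1` B); split.
have mBT : measurable (B `*` (setT : set R)) by exact: measurableX.
have := ex _ mBT.
have -> : (fun w => (W w, W' w)) @^-1` (B `*` setT) = W @^-1` B.
  by apply/seteqP; split=> w /=; [case|].
have -> : (fun w => (W' w, W w)) @^-1` (B `*` setT) = W' @^-1` B.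
  by apply/seteqP; split=> w /=; [case|].
by rewrite P0.
Qed.

End Pair.

Lemma powR_add1_le (R : realType) (a t : R) : 0 <= a -> 0 <= t ->
  a `^ t + 1 <= 2 * (1 + a) `^ t.
Proof.
move=> a0 t0.
have h1 : a `^ t <= (1 + a) `^ t by apply: ge0_ler_powR; rewrite ?nnegrE//; lra.
have h2 : 1 <= (1 + a) `^ t.
  by rewrite -[X in X <= _](powRr0 (1 + a)) ler_powR//; lra.
lra.
Qed.

Section LawOfPair.
Variables (R : realType) (d : measure_display) (T : measurableType d).
Variables (P : probability T R) (W W' : {RV P >-> R}).
Variables (g : R -> R) (Rf : {mfun R >-> R}) (EK : T -> R).
Variables (d0 d1 alpha tau1 tau2 delta lambda delta1 delta2 : R).
Local Notation Ex X := (\int[P]_w X w)%R.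

(** The values of [W] at which the almost sure bounds hold; the first one makes
    [g] bounded there. *)
Definition good_values : set R := [set x | [/\ delta * `|g x| <= d1,
  `|Rf x| <= delta2 * (`|g x| `^ tau2 + 1) & `|Rf x| <= alpha * (`|g x| + 1)]].
Definition law_Ex (phi : R -> R) : R := Ex (fun w => phi (W w)).

(** The antisymmetry of [(W - W') (f W + f W')] under exchange gives
    [E ((W - W') f W) = E ((W - W') (f W - f W')) / 2]. The left side is
    [lambda E ((g - Rf) f)], and on the right side [(W - W')^2 / (2 lambda)] is
    replaced by its conditional expectation [EK]. *)
Lemma law_of_pair :
  let Delta := fun w => W w - W' w in
  let K1 := fun w => (2 * lambda)^-1 * Delta w ^+ 2 in
  measurable_fun setT g -> 0 <= d0 -> 0 <= alpha -> 0 <= tau1 -> 0 <= tau2 ->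
  exchangeable W W' ->
  0 < delta -> delta <= 1 -> {ae P, forall w, `|Delta w| <= delta} ->
  0 < lambda ->
  is_cond_exp Delta W (fun w => lambda * (g (W w) - Rf (W w))) ->
  is_cond_exp K1 W EK ->
  0 <= delta1 -> 0 <= delta2 ->
  {ae P, forall w, `|EK w - 1| <= delta1 * (`|g (W w)| `^ tau1 + 1)} ->
  {ae P, forall w, `|Rf (W w)| <= delta2 * (`|g (W w)| `^ tau2 + 1)} ->
  {ae P, forall w, EK w <= d0} ->
  {ae P, forall w, delta * `|g (W w)| <= d1} ->
  {ae P, forall w, `|Rf (W w)| <= alpha * (`|g (W w)| + 1)} ->
  stein_law d0 alpha tau1 tau2 g delta (2 * delta1) (2 * delta2) good_values Rf law_Ex.
Proof.
move=> Delta K1 mg d00 a0 t10 t20 ex dl0 dl1 Dd la0 cD cK de1 de2 EK1 R2 EKd gd1 Ra.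
have SW : {ae P, forall w, good_values (W w)}.
  by apply: filterS3 gd1 R2 Ra => w h1 h2 h3; split.
have mW : measurable_fun setT W by exact: measurable_funP.
have mW' : measurable_fun setT W' by exact: measurable_funP.
have eb f : bdd_on good_values f -> ess_bdd P (fun w => f (W w)).
  move=> [mf [M fM]]; split; first exact: measurableT_comp.
  by exists M; apply: filterS SW => w; exact: fM.
have bg : bdd_on good_values g.
  split=> //; exists (d1 / delta) => w [h _ _].
  by rewrite ler_pdivlMr// mulrC.
have bR : bdd_on good_values Rf.
  split; first exact: measurable_funP.
  have [_ [M gM]] := bg; exists (alpha * (M + 1)) => w Sw.
  have [_ _ h] := Sw; apply: le_trans h _; rewrite ler_wpM2l// lerD2r.
  exact: gM.
have bD : ess_bdd P Delta.
  by split; [exact: measurable_funB|exists delta].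
have bK1 : ess_bdd P K1.
  by apply: ess_bddZ; exact: (ess_bddM bD bD).
have bgR : ess_bdd P (fun w => lambda * (g (W w) - Rf (W w))).
  apply: ess_bddZ; apply: ess_bddD; first exact: eb.
  by have := ess_bddZ (-1) (eb _ bR); under eq_fun do rewrite mulN1r.
have bEK : ess_bdd P EK.
  split.
    have [_ mE _ _] := cK; move=> _ B mB.
    have [C mC <-] := mE B mB; rewrite !setTI -[X in measurable X]setTI.
    exact: measurable_funP.
  have [_ [M gM]] := bg; exists (1 + delta1 * ((`|M|) `^ tau1 + 1)).
  apply: filterS2 EK1 SW => w h Sw.
  have -> : EK w = 1 + (EK w - 1) by ring.
  apply: le_trans (ler_normD _ _) _; rewrite normr1 lerD2l; apply: le_trans h _.
  rewrite ler_wpM2l// lerD2r; apply: ge0_ler_powR; rewrite ?nnegrE//.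
  exact: le_trans (gM _ Sw) (ler_norm _).
split.
- by rewrite dl0 dl1.
- by rewrite mulr_ge0.
- by rewrite mulr_ge0.
- move=> a f h bf bh; rewrite /law_Ex Ex_D ?Ex_Z//; [exact: eb|exact/ess_bddZ/eb|exact: eb].
- move=> f h bf bh fh; apply: Ex_le; [exact: eb|exact: eb|].
  by apply: filterS SW => w; exact: fh.
- exact: Ex_cst.
- exact: bg.
- exact: bR.
- move=> w [_ h _]; apply: le_trans h _; rewrite [2 * _]mulrC -mulrA ler_wpM2l//.
  exact: powR_add1_le.
- by move=> w [].
move=> f h rho bf bh br rho0 fhr.
have [mf _] := bf; have bfW := eb _ bf; have bhW := eb _ bh; have brW := eb _ br.
have bfW' : ess_bdd P (fun w => f (W' w)).
  split; first exact: measurableT_comp.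
  have [_ [M fM]] := bfW; exists M; exact: exchangeable_ae ex mf fM.
have step1 : lambda * law_Ex (fun w => (g w - Rf w) * f w) = Ex (fun w => Delta w * f (W w)).
  have bX : ess_bdd P (fun w => (g (W w) - Rf (W w)) * f (W w)).
    have := ess_bddZ lambda^-1 (ess_bddM bgR bfW).
    by under eq_fun do rewrite -mulrA mulKf ?gt_eqF//.
  have [_ fM] := bfW.
  rewrite (cond_exp_test cD bD bgR mf fM) /law_Ex -Ex_Z//.
  by congr (Rintegral _ _ _); apply/funext => w; rewrite mulrA.
(* Exchanging [W] and [W'] changes the sign of [Delta]. *)
have step2 : Ex (fun w => Delta w * f (W w)) = - Ex (fun w => Delta w * f (W' w)).
  have mphi : measurable_fun setT (fun x : R * R => (x.1 - x.2) * f x.1).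
    apply: measurable_funM; first exact: measurable_funB.
    exact: measurableT_comp.
  have b2 : ess_bdd P (fun w => (W' w - W w) * f (W' w)).
    have := ess_bddZ (-1) (ess_bddM bD bfW').
    by under eq_fun do rewrite mulrA mulN1r opprB.
  have := exchangeable_Ex ex mphi (ess_bddM bD bfW) b2 => /= ->.
  rewrite -mulN1r -Ex_Z; last exact: ess_bddM.
  by congr (Rintegral _ _ _); apply/funext => w; rewrite mulrA mulN1r opprB.
have step3 : Ex (fun w => Delta w * (f (W w) - f (W' w))) =
    2 * (lambda * law_Ex (fun w => (g w - Rf w) * f w)).
  have -> : Ex (fun w => Delta w * (f (W w) - f (W' w))) =
      Ex (fun w => Delta w * f (W w)) + -1 * Ex (fun w => Delta w * f (W' w)).
    rewrite -Ex_Z; last exact: ess_bddM.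
    rewrite -Ex_D; [|exact: ess_bddM|by apply: ess_bddZ; exact: ess_bddM].
    by congr (Rintegral _ _ _); apply/funext => w; ring.
  by rewrite step1 mulN1r -step2; ring.
have bhr : bdd_on good_values (fun w => h w + rho w) by exact: bddD.
have bhrW := eb _ bhr; have bDf : ess_bdd P (fun w => Delta w * (f (W w) - f (W' w))).
  apply: ess_bddM => //; apply: ess_bddD => //.
  by have := ess_bddZ (-1) bfW'; under eq_fun do rewrite mulN1r.
have step4 : law_Ex (fun w => (g w - Rf w) * f w) <= Ex (fun w => K1 w * (h (W w) + rho (W w))).
  have -> : law_Ex (fun w => (g w - Rf w) * f w) =
      Ex (fun w => (2 * lambda)^-1 * (Delta w * (f (W w) - f (W' w)))).
    by rewrite Ex_Z// step3; field; rewrite gt_eqF.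
  apply: Ex_le; [exact: ess_bddZ|exact: ess_bddM|].
  apply: filterS Dd => w Dw; rewrite /K1 -mulrA ler_wpM2l ?invr_ge0 ?mulr_ge0 ?(ltW la0)//.
  exact: fhr.
apply: (le_trans step4).
have [mhr _] := bhr; have [_ hrM] := bhrW.
rewrite (cond_exp_test cK bK1 bEK mhr hrM).
have bw : bdd_on good_values (fun w => (1 + `|g w|) `^ tau1).
  apply: bdd_powR => //; first by apply: bddD; [exact: bdd_cst|exact: bdd_norm].
have bwh : bdd_on good_values (fun w => (1 + `|g w|) `^ tau1 * `|h w|).
  by apply: bddM => //; exact: bdd_norm.
have -> : law_Ex h + 2 * delta1 * law_Ex (fun w => (1 + `|g w|) `^ tau1 * `|h w|) + d0 * law_Ex rho
  = Ex (fun w => h (W w) + 2 * delta1 * ((1 + `|g (W w)|) `^ tau1 * `|h (W w)|) + d0 * rho (W w)).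
  rewrite /law_Ex Ex_D ?Ex_D ?Ex_Z//; do ?[exact: (eb _ bwh)|exact: ess_bddZ|exact/ess_bddZ/(eb _ bwh)].
  by apply: ess_bddD => //; exact/ess_bddZ/(eb _ bwh).
apply: Ex_le; first exact: ess_bddM.
  apply: ess_bddD; last exact: ess_bddZ.
  by apply: ess_bddD => //; exact/ess_bddZ/(eb _ bwh).
apply: filterS2 EK1 EKd => w E1 Ed.
(* [EK] is close to 1 where it multiplies [h] and at most [d0] where it
   multiplies the nonnegative [rho]. *)
have -> : EK w * (h (W w) + rho (W w)) = h (W w) + (EK w - 1) * h (W w) + EK w * rho (W w) by ring.
apply: lerD; last by rewrite ler_wpM2r.
rewrite lerD2l; apply: le_trans (ler_norm _) _; rewrite normrM mulrA ler_wpM2r//.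
apply: le_trans E1 _; rewrite [2 * _]mulrC -mulrA ler_wpM2l//.
exact: powR_add1_le.
Qed.

End LawOfPair.

(** * The density attached to g *)

Section TargetOfPdf.
Variable R : realType.
Local Notation mu := (@lebesgue_measure R).

Lemma is_derive_of_derive1 (f : R -> R) (x l : R) :
  derivable f x 1 /\ derive1 f x = l -> is_derive x 1 f l.
Proof. by case=> fd fl; apply: DeriveDef => //; rewrite -derive1E. Qed.

(** Starting the integral to the left of both 0 and [y] turns the two cases of
    the definition into a difference of values of a single primitive. *)
Lemma oriented_primitive_der (g : R -> R) (y : R) :
  continuous g -> is_derive y 1 (oriented_primitive g) (g y).
Proof.
move=> cg; pose a := Num.min y 0 - 1.
have ig (b c : R) : mu.-integrable `[b, c] (EFin \o g).
  apply: continuous_compact_integrable; first exact: segment_compact.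
  exact: continuous_subspaceT.
have h1 : Num.min y 0 <= y by rewrite ge_min lexx.
have h2 : Num.min y 0 <= 0 by rewrite ge_min lexx orbT.
have ay : a < y by rewrite /a; lra.
have a0 : a < 0 by rewrite /a; lra.
pose H x := (\int[mu]_(t in `[a, x]) g t)%R.
have split_at (b c : R) : a <= b -> b <= c ->
    H c - H b = (\int[mu]_(t in `[b, c]) g t)%R.
  move=> ab bc; rewrite /H Rintegral_itvB ?bnd_simp//.
  rewrite Rintegral_itv_obnd_cbnd//.
  apply: integrableS (ig b c) => //.
  by apply: subset_itvr; rewrite bnd_simp.
have E x : a < x -> H x - H 0 = oriented_primitive g x.
  move=> ax; rewrite /oriented_primitive; case: ifPn => x0.
    by rewrite split_at// ltW.
  rewrite -ltNge in x0.
  by rewrite -split_at ?opprB// ltW.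
apply: (@near_eq_is_derive _ _ _ (fun x => H x - H 0)).
  by near=> x; apply: E; near: x; exact: lt_nbhsr.
have dH : is_derive y 1 H (g y).
  apply: is_derive_of_derive1.
  apply: (@continuous_FTC1_closed _ g a y (y + 1)) => //; first by rewrite ltrDl.
  exact: cg.
by rewrite -[g y]subr0; apply: is_deriveB.
Unshelve. all: by end_near. Qed.

Lemma pdf_constant_gt0 (c1 : R) (g : R -> R) :
  is_pdf (fun y => c1 * expR (- oriented_primitive g y)) -> 0 < c1.
Proof.
case=> _ p0 p1; rewrite lt_neqAle -(pmulr_lge0 _ (expR_gt0 (- oriented_primitive g 0))) p0 andbT.
apply/eqP => c10; move: p1; rewrite -c10.
under eq_integral do rewrite mul0r.
by rewrite integral0 => /eqP; rewrite eqe eq_sym oner_eq0.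
Qed.

Section CdfOfDensity.
Variables (d : measure_display) (T : measurableType d) (P : probability T R).
Variables (Y : {RV P >-> R}) (p : R -> R).
Hypotheses (pdf : is_pdf p) (cp : continuous p) (dY : has_density Y p).

Definition real_cdf (x : R) : R := fine (cdf Y x).

Lemma real_cdf_der (x : R) : is_derive x 1 real_cdf (p x).
Proof.
have [mp p0 p1] := pdf.
have ip : mu.-integrable setT (EFin \o p).
  apply/integrableP; split; first exact/measurable_EFinP.
  under eq_integral do rewrite /= ger0_norm//.
  by rewrite p1 ltry.
have -> : real_cdf = fun y => (\int[mu]_(t in `]-oo, y]) p t)%R.
  by apply/funext => y; rewrite /real_cdf /cdf dY.
apply: is_derive_of_derive1.
apply: (@continuous_FTC1 _ p -oo%O x (x + 1)) => //; first by rewrite ltrDl.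
  by apply: integrableS ip.
  exact: ltNye.
exact: cp.
Qed.

Lemma real_cdf_ge0 x : 0 <= real_cdf x.
Proof. by rewrite /real_cdf fine_ge0. Qed.

Lemma real_cdfE x : (real_cdf x)%:E = cdf Y x.
Proof. by rewrite /real_cdf fineK// fin_num_measure. Qed.

Lemma real_cdf_le1 x : real_cdf x <= 1.
Proof. by rewrite -lee_fin real_cdfE cdf_le1. Qed.

Lemma real_cdf_top (e : R) : 0 < e -> exists2 x, 0 <= x & 1 - real_cdf x < e.
Proof.
move=> e0; have /fine_cvg/cvgrPdist_lt/(_ _ e0) h := cvg_cdfy1 Y.
have h0 : \forall x \near +oo%R, (0 : R) <= x by apply: nbhs_pinfty_ge; exact: num_real.
have [x [xe x0]] := filter_ex (filterI h h0).
by exists x => //; apply: le_lt_trans xe; exact: ler_norm.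
Qed.

Lemma real_cdf_bot (e : R) : 0 < e -> exists2 x, x <= 0 & real_cdf x < e.
Proof.
move=> e0; have /fine_cvg/cvgrPdist_lt/(_ _ e0) h := cvg_cdfNy0 Y.
have h0 : \forall x \near -oo%R, x <= (0 : R) by apply: nbhs_ninfty_le; exact: num_real.
have [x [xe x0]] := filter_ex (filterI h h0).
by exists x => //; apply: le_lt_trans xe; rewrite sub0r normrN; exact: ler_norm.
Qed.

Lemma real_ccdf z : fine (P [set w | z < Y w]) = 1 - real_cdf z.
Proof.
have mY : measurable (Y @^-1` `]-oo, z]).
  by rewrite -[X in measurable X]setTI; exact: measurable_funP.
have -> : [set w | z < Y w] = ~` (Y @^-1` `]-oo, z]).
  apply/seteqP; split => w /=; rewrite in_itv/= ltNge; [by move/negP|by move/negP].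
by rewrite probability_setC// -[P _]/(cdf Y z) -real_cdfE.
Qed.

End CdfOfDensity.

(** For [|t| <= 1] monotonicity gives [|g t| <= m], and the subadditivity of
    [|g|] up to constants becomes the bound on unit shifts. *)
Lemma target_of_pdf (g : R -> R) (c1 c2 c3 m : R)
    (d : measure_display) (T : measurableType d) (P : probability T R) (Y : {RV P >-> R}) :
  0 < c2 -> 1 <= c3 ->
  (forall y, derivable g y 1) -> {homo g : x y / x <= y} -> g 0 = 0 ->
  (forall x y, `|g (x + y)| <= c2 * (`|g x| + `|g y| + 1)) ->
  (forall y, `|derive1 g y| <= c3 * ((1 + `|g y|) / (1 + `|y|))) ->
  m = Num.max (g 1) `|g (-1)| ->
  is_pdf (fun y => c1 * expR (- oriented_primitive g y)) ->
  has_density Y (fun y => c1 * expR (- oriented_primitive g y)) ->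
  stein_target c1 c3 (1 + c2 * (1 + `|m|)) g (derive1 g) (oriented_primitive g) (real_cdf Y).
Proof.
move=> c20 c31 dg mono g0 sub dgb mE pdf dY.
have m0 : 0 <= m by rewrite mE le_max normr_ge0 orbT.
have cg : continuous g.
  by move=> x; apply: differentiable_continuous; apply/derivable1_diffP; exact: dg.
have dG x := oriented_primitive_der x cg.
have cp : continuous (fun y => c1 * expR (- oriented_primitive g y)).
  have dp (x : R) : is_derive x 1 (fun y => c1 * expR (- oriented_primitive g y))
      (c1 * (expR (- oriented_primitive g x) * - g x)).
    by have dGx := dG x; apply: is_derive_eq.
  by move=> x; apply: differentiable_continuous; apply/derivable1_diffP; case: (dp x).
have G0 : oriented_primitive g 0 = 0.
  by rewrite /oriented_primitive lexx set_itv1 Rintegral_set1.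
split.
- exact: pdf_constant_gt0 pdf.
- lra.
- by rewrite lerDl mulr_ge0 ?(ltW c20)// addr_ge0.
- by move=> x; apply: is_derive_of_derive1.
- move=> x; apply: le_trans (dgb x) _; rewrite ler_wpM2l//; first lra.
  by rewrite ler_pdivrMr ?ltr_wpDr// ler_peMr ?addr_ge0// lerDl.
- exact: mono.
- exact: g0.
- move=> x t t1; have gt : `|g t| <= m.
    move: t1; rewrite ler_norml => /andP[t1 t2]; rewrite ler_norml.
    have h1 : g (-1) <= g t by apply: mono.
    have h2 : g t <= g 1 by apply: mono.
    have h3 : g 1 <= m by rewrite mE le_max lexx.
    have h4 : `|g (-1)| <= m by rewrite mE le_max lexx orbT.
    have := ler_norm (- g (-1)); rewrite normrN; lra.
  rewrite (ger0_norm m0).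
  have h : c2 * (`|g x| + `|g t| + 1) <= c2 * (`|g x| + m + 1).
    by rewrite ler_wpM2l ?(ltW c20)// lerD2r lerD2l.
  have h' : 0 <= c2 * m * `|g x| by rewrite !mulr_ge0// ltW.
  have := sub x t; have := normr_ge0 (g x); lra.
- exact: dG.
- exact: G0.
- exact: real_cdf_der.
- exact: real_cdf_ge0.
- exact: real_cdf_le1.
- exact: real_cdf_top.
- exact: real_cdf_bot.
Qed.

End TargetOfPdf.

(** * Error terms of the theorem *)

Section Conversion.
Variables (R : realType) (c1 c3 A : R).
Hypothesis c1_gt0 : 0 < c1.

Let X := growth_point c1.
Let X0 : 0 < X. Proof. by rewrite divr_gt0 ?expR_gt0. Qed.

(** Beyond the growth point [X], [1 + g z <= (1 + X) * g z] and [1 + z <= 2 * z];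
    before it, all terms are bounded. *)
Lemma weight_convert (a : R) : 0 < a -> exists2 C, 0 <= C &
  forall g dg G F, stein_target c1 c3 A g dg G F -> forall z, 0 <= z ->
  (1 + z) * (1 + g z) `^ a <= C * (1 + z * g z `^ a).
Proof.
move=> a0; have X00 := X0.
have [C0 C01 HC] := target_bounded c1 c3 A (X + 1).
have p0 : 0 <= (2 + X) * C0 `^ a by rewrite mulr_ge0 ?powR_ge0//; lra.
have p1 : 0 <= 2 * (1 + X) `^ a by rewrite mulr_ge0 ?powR_ge0.
exists ((2 + X) * C0 `^ a + 2 * (1 + X) `^ a); first by rewrite addr_ge0.
move=> g dg G F T z z0; have gz0 := g_ge0 T z0.
have zg : 0 <= z * g z `^ a by rewrite mulr_ge0 ?powR_ge0.
have [zX|Xz] := leP z (X + 1).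
  have [h _] := HC _ _ _ _ T z z0 zX.
  apply: (@le_trans _ _ ((2 + X) * C0 `^ a)).
    apply: ler_pM; rewrite ?powR_ge0//; [lra|lra|].
    by apply: ge0_ler_powR; rewrite ?nnegrE ?(ltW a0)//; lra.
  by apply: (@le_trans _ _ ((2 + X) * C0 `^ a + 2 * (1 + X) `^ a));
    [lra|rewrite ler_peMr ?addr_ge0// lerDl].
have gX : X^-1 <= g z by apply: (g_lower T); rewrite -/X; lra.
have h : 1 + g z <= (1 + X) * g z.
  have : X * X^-1 <= X * g z by rewrite ler_wpM2l// ltW.
  by rewrite divff ?gt_eqF//; lra.
have h2 : (1 + g z) `^ a <= (1 + X) `^ a * g z `^ a.
  have X1 : 0 <= 1 + X by lra.
  rewrite -powRM//.
  by apply: ge0_ler_powR; rewrite ?nnegrE ?(ltW a0)//; lra.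
apply: (@le_trans _ _ (2 * z * ((1 + X) `^ a * g z `^ a))).
  by apply: ler_pM; rewrite ?powR_ge0//; lra.
have -> : 2 * z * ((1 + X) `^ a * g z `^ a) = 2 * (1 + X) `^ a * (z * g z `^ a) by ring.
by apply: ler_pM => //; lra.
Qed.

(** [g] is bounded below beyond the growth point. *)
Lemma level_bounded (a : R) : 0 <= a -> exists Z,
  forall g dg G F, stein_target c1 c3 A g dg G F -> forall z, 0 <= z ->
  z * g z `^ a <= 1 -> z <= Z.
Proof.
move=> a0; have X00 := X0; exists (X + X `^ a) => g dg G F T z z0 zg.
have Xa := powR_ge0 X a.
have [zX|Xz] := leP z X; first by lra.
have gX : X^-1 <= g z by apply: (g_lower T); rewrite -/X; lra.
have h : (X `^ a)^-1 <= g z `^ a.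
  rewrite -powR_inv1 ?powR_ge0// powRAC powR_inv1 ?(ltW X00)//.
  apply: ge0_ler_powR => //; rewrite nnegrE ?invr_ge0 ?(ltW X00)//.
  by rewrite (le_trans _ gX)// invr_ge0 ltW.
have Xp : 0 < X `^ a by rewrite powR_gt0.
have : z * (X `^ a)^-1 <= 1 by apply: le_trans zg; rewrite ler_wpM2l.
by rewrite ler_pdivrMr// mul1r; lra.
Qed.

Lemma tail_bounded_below (Z : R) : exists2 q, 0 < q &
  forall g dg G F, stein_target c1 c3 A g dg G F -> forall z, 0 <= z -> z <= Z ->
  q <= 1 - F z.
Proof.
have [C0 C01 HC] := target_bounded c1 c3 A Z.
have C00 : 0 < C0 by lra.
exists (c1 * expR (- A) / (C0 * C0)); first by rewrite divr_gt0 ?mulr_gt0 ?expR_gt0.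
move=> g dg G F T z z0 zZ; have [h1 h2] := HC _ _ _ _ T z z0 zZ.
apply: le_trans (tail_lower T z0); have gz0 := g_ge0 T z0.
rewrite ler_wpM2l ?mulr_ge0 ?expR_ge0 ?(ltW c1_gt0)// invfM expRN.
by apply: ler_pM; rewrite ?invr_ge0 ?(ltW C00)// lef_pV2 ?posrE ?expR_gt0//; lra.
Qed.

End Conversion.

Lemma weighted_sum_le (R : realType) (x1 x2 x3 y1 y2 y3 V1 V2 V3 s1 s2 s3 : R) :
  0 <= s1 -> 0 <= s2 -> 0 <= s3 -> 0 <= V1 -> 0 <= V2 -> 0 <= V3 ->
  0 <= y1 -> 0 <= y2 -> 0 <= y3 ->
  x1 <= V1 * (1 + y1) -> x2 <= V2 * (1 + y2) -> x3 <= V3 * (1 + y3) ->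
  s1 * x1 + 2 * s2 * x2 + 2 * s3 * x3 <=
    2 * (V1 + V2 + V3) * (s1 * (1 + y1) + s2 * (1 + y2) + s3 * (1 + y3)).
Proof.
move=> s10 s20 s30 V10 V20 V30 y10 y20 y30 h1 h2 h3.
have k1 := ler_wpM2l s10 h1; have k2 := ler_wpM2l s20 h2; have k3 := ler_wpM2l s30 h3.
have x1' : 0 <= s1 * (1 + y1) by rewrite mulr_ge0 ?addr_ge0.
have x2' : 0 <= s2 * (1 + y2) by rewrite mulr_ge0 ?addr_ge0.
have x3' : 0 <= s3 * (1 + y3) by rewrite mulr_ge0 ?addr_ge0.
have u1 := mulr_ge0 V10 x1'; have u2 := mulr_ge0 V10 x2'; have u3 := mulr_ge0 V10 x3'.
have w1 := mulr_ge0 V20 x1'; have w2 := mulr_ge0 V20 x2'; have w3 := mulr_ge0 V20 x3'.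
have v1 := mulr_ge0 V30 x1'; have v2 := mulr_ge0 V30 x2'; have v3 := mulr_ge0 V30 x3'.
lra.
Qed.

Lemma level_le1 (R : realType) (s a t : R) :
  1 < s -> 0 <= a -> 0 <= t -> s * a + t <= 1 -> a <= 1.
Proof. by move=> s1 a0 t0 h; nra. Qed.

(** The error term is at least 1, so any bound on the ratio suffices. *)
Lemma ratio_crude (R : realType) (p Q q C err : R) :
  0 < q -> q <= Q -> 0 <= p -> p <= 1 -> 0 <= C -> 1 <= err ->
  `|p / Q - 1| <= (C + (q^-1 + 1)) * err.
Proof.
move=> q0 qQ p0 p1 C0 err1; have Q0 : 0 < Q := lt_le_trans q0 qQ.
have qi : 0 < q^-1 by rewrite invr_gt0.
have h1 : p / Q <= q^-1.
  rewrite ler_pdivrMr//; apply: le_trans p1 _.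
  by rewrite mulrC ler_pdivlMr// mul1r.
have h0 : 0 <= p / Q by rewrite divr_ge0// ltW.
have h : `|p / Q - 1| <= q^-1 + 1 by rewrite ler_norml; lra.
apply: (le_trans h); rewrite -[leLHS]mulr1; apply: ler_pM => //; lra.
Qed.

Lemma error_range (R : realType) (s1 s2 s3 a b c : R) :
  0 <= s1 -> 0 <= s2 -> 0 <= s3 -> 0 <= a -> 0 <= b -> 0 <= c ->
  ([|| 1 < s1, 1 < s2 | 1 < s3] ->
     1 <= s1 * (1 + a) + s2 * (1 + b) + s3 * (1 + c)) /\
  (s1 <= 1 -> s2 <= 1 -> s3 <= 1 -> s1 * a + s2 * b + s3 * c <= 1 ->
     s1 * (1 + a) + s2 * (1 + b) + s3 * (1 + c) <= 4).
Proof.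
move=> s10 s20 s30 a0 b0 c0.
have x1 := mulr_ge0 s10 a0; have x2 := mulr_ge0 s20 b0; have x3 := mulr_ge0 s30 c0.
by split=> [/or3P[] ?|????]; lra.
Qed.

Theorem corollary2p1 (R : realType)
    (d0 d1 c1 c2 c3 tau1 tau2 alpha m : R) :
  1 <= d0 -> 0 < d1 -> 0 < c2 -> 1 <= c3 -> 0 < tau1 -> 0 < tau2 ->
  0 <= alpha -> alpha < 1 ->
  exists C : R,
  forall (g : R -> R),
    (forall y, derivable g y 1) ->
    {homo g : x y / x <= y} -> g 0 = 0 ->
    (forall y, y != 0 -> 0 < y * g y) ->
    (forall x y, `|g (x + y)| <= c2 * (`|g x| + `|g y| + 1)) ->
    (forall y, `|derive1 g y| <= c3 * ((1 + `|g y|) / (1 + `|y|))) ->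
    m = Num.max (g 1) `|g (-1)| ->
    is_pdf (fun y => c1 * expR (- oriented_primitive g y)) ->
  forall (d : measure_display) (T : measurableType d) (P : probability T R)
    (W W' : {RV P >-> R}) (delta lambda delta1 delta2 : R)
    (Rf : {mfun R >-> R}) (EK : T -> R),
    let Delta := fun w => W w - W' w in
    let K1 := fun w => (2 * lambda)^-1 * Delta w ^+ 2 in
    exchangeable W W' ->
    0 < delta -> {ae P, forall w, `|Delta w| <= delta} ->
    0 < lambda -> lambda < 1 ->
    is_cond_exp Delta W (fun w => lambda * (g (W w) - Rf (W w))) ->
    is_cond_exp K1 W EK ->
    0 < delta1 -> 0 <= delta2 ->
    {ae P, forall w, `|EK w - 1| <= delta1 * (`|g (W w)| `^ tau1 + 1)} ->
    {ae P, forall w, `|Rf (W w)| <= delta2 * (`|g (W w)| `^ tau2 + 1)} ->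
    {ae P, forall w, EK w <= d0} ->
    {ae P, forall w, delta * `|g (W w)| <= d1} ->
    {ae P, forall w, `|Rf (W w)| <= alpha * (`|g (W w)| + 1)} ->
  forall (d' : measure_display) (T' : measurableType d')
    (P' : probability T' R) (Y : {RV P' >-> R}),
    has_density Y (fun y => c1 * expR (- oriented_primitive g y)) ->
  forall z : R, 0 <= z ->
    delta * (z * g z ^+ 2) + delta1 * (z * g z `^ (tau1 + 1))
      + delta2 * (z * g z `^ tau2) <= 1 ->
  exists O1 : R, `|O1| <= C /\
    fine (P [set w | z < W w]) / fine (P' [set w | z < Y w]) =
      1 + O1 * (delta * (1 + z * g z ^+ 2)
                + delta1 * (1 + z * g z `^ (tau1 + 1))
                + delta2 * (1 + z * g z `^ tau2)).
Proof.
move=> d0_ge1 d1_gt0 c2_gt0 c3_ge1 tau1_gt0 tau2_gt0 alpha_ge0 alpha_lt1.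
(* A nonpositive [c1] gives no density, so any constant will do. *)
have [c1_le0|c1_gt0] := leP c1 0.
  exists 0 => g _ _ _ _ _ _ _ /pdf_constant_gt0; rewrite ltNge c1_le0//.
pose A := 1 + c2 * (1 + `|m|).
have A_ge1 : 1 <= A by rewrite lerDl mulr_ge0 ?(ltW c2_gt0)// addr_ge0.
have c3_ge0 : 0 <= c3 by rewrite (le_trans ler01).
have t1 : 0 < tau1 + 1 by rewrite addr_gt0.
have two : 0 < 2%:R :> R by rewrite ltr0n.
have [V1 V10 HV1] := weight_convert c3 A c1_gt0 two.
have [V2 V20 HV2] := weight_convert c3 A c1_gt0 t1.
have [V3 V30 HV3] := weight_convert c3 A c1_gt0 tau2_gt0.
have [Z1 HZ1] := level_bounded c3 A c1_gt0 (ltW two).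
have [Z2 HZ2] := level_bounded c3 A c1_gt0 (ltW t1).
have [Z3 HZ3] := level_bounded c3 A c1_gt0 (ltW tau2_gt0).
have [q q0 Hq] := tail_bounded_below c3 A c1_gt0 (`|Z1| + `|Z2| + `|Z3|).
have [V VE] : exists V, V = 2 * (V1 + V2 + V3) by eexists.
have V0 : 0 <= V by rewrite VE mulr_ge0// !addr_ge0.
(* The error term is at most 4 if [delta], [delta1], [delta2] are at most 1,
   and [(1 + z) * rate z] is at most [V] times the error term. *)
have K0_ge0 : 0 <= V * 4 by rewrite mulr_ge0.
have [C C0 HC] := tail_comparison c1_gt0 c3_ge0 A_ge1 d0_ge1 (ltW tau1_gt0)
  (ltW tau2_gt0) alpha_ge0 alpha_lt1 K0_ge0.
exists (C * V + (q^-1 + 1)).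
move=> g dg mono g0 _ sub dgb mE pdf d T P W W' delta lambda delta1 delta2 Rf EK Delta K1.
move=> ex delta_gt0 Dd la0 _ cD cK de1 de2 EK1 R2 EKd gd1 Ra d' T' P' Y dY z z0 cond.
have Tg := target_of_pdf c2_gt0 c3_ge1 dg mono g0 sub dgb mE pdf dY.
rewrite -/A in Tg.
have gz0 := g_ge0 Tg z0.
rewrite (real_ccdf Y z).
set Q := 1 - real_cdf Y z; set p := fine (P _).
have Q0 : 0 < Q.
  apply: lt_le_trans (tail_lower Tg z0).
  have g1 : 0 < 1 + g z by rewrite ltr_wpDr.
  by apply: mulr_gt0; [rewrite mulr_gt0 ?expR_gt0|rewrite divr_gt0 ?expR_gt0].
have mzW : measurable [set w | z < W w].
  have -> : [set w | z < W w] = W @^-1` `]z, +oo[.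
    by apply/seteqP; split => w /=; rewrite in_itv/= andbT.
  by rewrite -[X in measurable X]setTI; exact: measurable_funP.
have p0 : 0 <= p by rewrite fine_ge0.
have p1 : p <= 1 by rewrite -lee_fin fineK ?fin_num_measure// probability_le1.
have pE : law_Ex W (fun w => (z < w)%R%:R) = p.
  rewrite /p -(Ex_ind P mzW) /law_Ex; congr (Rintegral _ _ _); apply/funext => w.
  rewrite indicE; congr (nat_of_bool _)%:R.
  by apply/idP/idP; rewrite inE.
set a := z * g z ^+ 2 in cond *; set b := z * g z `^ (tau1 + 1) in cond *.
set c := z * g z `^ tau2 in cond *.
have a0 : 0 <= a by rewrite mulr_ge0// exprn_ge0.
have b0 : 0 <= b by rewrite mulr_ge0// powR_ge0.
have c0 : 0 <= c by rewrite mulr_ge0// powR_ge0.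
have da0 : 0 <= delta * a by rewrite mulr_ge0// ltW.
have db0 : 0 <= delta1 * b by rewrite mulr_ge0// ltW.
have dc0 : 0 <= delta2 * c by rewrite mulr_ge0.
set err := delta * (1 + a) + delta1 * (1 + b) + delta2 * (1 + c).
have err0 : 0 < err.
  have h1 : 0 < delta * (1 + a) by rewrite mulr_gt0// ltr_wpDr.
  by rewrite /err -addrA ltr_wpDr// addr_ge0// mulr_ge0 ?addr_ge0// ltW.
have [err_large err_small] := error_range (ltW delta_gt0) (ltW de1) de2 a0 b0 c0.
suff bound : `|p / Q - 1| <= (C * V + (q^-1 + 1)) * err.
  exists ((p / Q - 1) / err); split; last by rewrite divfK ?gt_eqF//; ring.
  by rewrite normrM normfV (gtr0_norm err0) ler_pdivrMr.
have CV0 : 0 <= C * V by rewrite mulr_ge0.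
(* A parameter above 1 confines [z] to a bounded interval. *)
have [big|small] := boolP [|| 1 < delta, 1 < delta1 | 1 < delta2].
  have zZ : z <= `|Z1| + `|Z2| + `|Z3|.
    have n1 := ler_norm Z1; have n2 := ler_norm Z2; have n3 := ler_norm Z3.
    have cond1 : delta * a + (delta1 * b + delta2 * c) <= 1 by rewrite addrA.
    have cond2 : delta1 * b + (delta * a + delta2 * c) <= 1 by rewrite addrCA.
    have cond3 : delta2 * c + (delta * a + delta1 * b) <= 1 by rewrite addrC.
    case/or3P: big => big.
    - apply: (@le_trans _ _ `|Z1|); last by rewrite -addrA lerDl addr_ge0.
      apply: le_trans n1; apply: (HZ1 _ _ _ _ Tg) => //; rewrite powR_mulrn// -/a.
      by apply: level_le1 big a0 _ cond1; exact: addr_ge0.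
    - apply: (@le_trans _ _ `|Z2|); last by rewrite addrAC lerDr addr_ge0.
      apply: le_trans n2; apply: (HZ2 _ _ _ _ Tg) => //; rewrite -/b.
      by apply: level_le1 big b0 _ cond2; exact: addr_ge0.
    - apply: (@le_trans _ _ `|Z3|); last by rewrite lerDr addr_ge0.
      apply: le_trans n3; apply: (HZ3 _ _ _ _ Tg) => //; rewrite -/c.
      by apply: level_le1 big c0 _ cond3; exact: addr_ge0.
  have Qq : q <= Q := Hq _ _ _ _ Tg z z0 zZ.
  exact: ratio_crude (err_large big).
move: small; rewrite !negb_or -!leNgt => /and3P[dl1 d11 d21].
have mg : measurable_fun setT g := measurable_of_derivative (tg_der Tg).
have Lw := law_of_pair mg (le_trans ler01 d0_ge1) alpha_ge0 (ltW tau1_gt0)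
  (ltW tau2_gt0) ex delta_gt0 dl1 Dd la0 cD cK (ltW de1) de2 EK1 R2 EKd gd1 Ra.
have rV : (1 + z) * rate tau1 tau2 delta (2 * delta1) (2 * delta2) g z <= V * err.
  have h1 := HV1 _ _ _ _ Tg z z0; have h2 := HV2 _ _ _ _ Tg z z0; have h3 := HV3 _ _ _ _ Tg z z0.
  rewrite !powR_mulrn ?addr_ge0// -/a in h1; rewrite -/b in h2; rewrite -/c in h3.
  rewrite VE /err; apply: le_trans (weighted_sum_le (ltW delta_gt0) (ltW de1) de2
    V10 V20 V30 a0 b0 c0 h1 h2 h3).
  by rewrite le_eqVlt; apply/orP; left; apply/eqP; rewrite /rate; ring.
have rK : (1 + z) * rate tau1 tau2 delta (2 * delta1) (2 * delta2) g z <= V * 4.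
  by apply: le_trans rV _; rewrite ler_wpM2l// err_small.
have := HC _ _ _ _ _ _ _ _ _ _ Tg Lw z z0 rK.
rewrite pE -/Q => cmp.
have -> : p / Q - 1 = (p - Q) / Q by field; rewrite gt_eqF.
rewrite normrM normfV (gtr0_norm Q0) ler_pdivrMr//; apply: (le_trans cmp).
apply: (@le_trans _ _ (C * (Q * (V * err)))).
  by rewrite ler_wpM2l// ler_wpM2l// ltW.
have -> : C * (Q * (V * err)) = C * V * err * Q by ring.
by rewrite ler_wpM2r ?(ltW Q0)// ler_wpM2r ?(ltW err0)// lerDl addr_ge0// invr_ge0 ltW.
Qed.
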